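(* Let $\alpha:(0,\infty)\to(0,\infty)$ be a dimension function such that the limit $\nu=\lim_{x\to0}\frac{\log\alpha(x)}{\log x}$ exists with $0<\nu<\infty$, and such that for some $\rho<1$ one has $\frac{\alpha(x_1)}{\alpha(x_2)}\ge\left(\frac{x_1}{x_2}\right)^{\rho}$ for all sufficiently small $x_1<x_2$. Let $\omega:[0,\infty)\to(0,\infty)$ be increasing with $\lim_{\xi\to\infty}\omega(\xi)=\infty$. Then there exist a compact set $F_\alpha\subset\mathbb{R}$ with zero $\alpha$-Hausdorff measure, a Borel probability measure $\mu$ supported on $F_\alpha$, and a constant $C$ such that $$|\hat\mu(\xi)|\le C\sqrt{\alpha(1/|\xi|)}\;\omega(|\xi|)\qquad\text{for all }\xi\in\mathbb{R},\ \xi\ne0.$$ Such a set $F_\alpha$ is given by an appropriately chosen subset of the set $E(\psi)$ of well-approximable numbers, where $\psi(q)=\alpha^{-1}(q^{-2})$.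
   Context: A dimension function is a positive increasing function $\alpha$ with $\alpha(u)\to0$ as $u\to0$. The $\alpha$-Hausdorff measure is the generalized Hausdorff measure $\mathcal{H}_\alpha(E)=\lim_{\delta\to0}\inf\{\sum_i\alpha(\operatorname{diam}U_i): E\subset\bigcup_iU_i,\ \operatorname{diam}U_i\le\delta\}$. $\alpha^{-1}(t)=\inf\{x>0:\alpha(x)\ge t\}$ for small $t>0$ (the ordinary inverse if $\alpha$ is continuous and strictly increasing). $E(\psi)=\{x\in\mathbb{R}: |x-\frac pq|\le\psi(q)\text{ for infinitely many pairs of integers }(p,q),\ q\ge1\}$ (values of $\psi$ at finitely many $q$ are irrelevant, so $\psi(q)$ need only be given by the formula for large $q$). $\hat\mu(\xi)=\int e^{-2\pi i x\xi}\,d\mu(x)$. *)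

(* Defs.v *)
From HB Require Import structures.
From mathcomp Require Import all_boot all_order all_algebra.
From mathcomp Require Import all_classical all_reals all_analysis.
From mathcomp Require Import complex.

Set Implicit Arguments.
Unset Strict Implicit.
Unset Printing Implicit Defensive.
Import Order.TTheory GRing.Theory Num.Theory.
Import numFieldNormedType.Exports.
Local Open Scope classical_set_scope.
Local Open Scope ring_scope.

(* Functions on (0, oo), resp. [0, oo), are total functions R -> R of which
   only the values on that half-line matter. "Increasing" is understood in the
   weak sense, so that strictly increasing functions are a special case. *)

Definition dimension_function (R : realType) (alpha : R -> R) : Prop :=
  [/\ forall x, 0 < x -> 0 < alpha x,
      forall x y, 0 < x -> x <= y -> alpha x <= alpha y
    & alpha u @[u --> 0^'+] --> 0].

(* The element 0 makes the diameter of the empty set 0 rather than -oo. *)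
Definition diam (R : realType) (U : set R) : \bar R :=
  ereal_sup (0%E |` [set (`|xy.1 - xy.2|)%:E | xy in U `*` U]).

(* alpha is extended by alpha 0 = 0, its limit at 0: singletons and empty sets
   contribute nothing to the sum over a cover. *)
Definition gauge (R : realType) (alpha : R -> R) (d : R) : R :=
  if 0 < d then alpha d else 0.

(* Finite covers are included, since the sets U i may be empty. As
   diam (U i) <= delta is finite, fine loses no information. *)
Definition hausdorff_content (R : realType) (alpha : R -> R) (E : set R)
    (delta : R) : \bar R :=
  ereal_inf [set (\sum_(0 <= i <oo) (gauge alpha (fine (diam (U i))))%:E)%E
    | U in [set U : nat -> set R |
        E `<=` \bigcup_i U i /\ forall i, (diam (U i) <= delta%:E)%E]].

Definition hausdorff_measure (R : realType) (alpha : R -> R) (E : set R)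
    : \bar R :=
  lim (hausdorff_content alpha E delta @[delta --> 0^'+]).

(* The limit above always exists, so lim never takes its default value. *)
Lemma is_cvg_hausdorff_content (R : realType) (alpha : R -> R) (E : set R) :
  cvg (hausdorff_content alpha E delta @[delta --> 0^'+]).
Proof.
apply: nonincreasing_at_right_is_cvge; near=> e => x y _ _ xy.
apply: ereal_inf_le_tmp => _ [U [EU dU] <-]; exists U => //; split=> // i.
by rewrite (le_trans (dU i))// lee_fin.
Unshelve. all: by end_near. Qed.

(* For t > 0 so large that no x satisfies alpha x >= t, the set is empty and
   the infimum takes the default value 0. *)
Definition ginv (R : realType) (alpha : R -> R) (t : R) : R :=
  inf [set x | 0 < x /\ t <= alpha x].

Definition well_approximable (R : realType) (psi : nat -> R) : set R :=
  [set x | infinite_set [set pq : int * nat |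
    (1 <= pq.2)%N /\ `|x - pq.1%:~R / pq.2%:R| <= psi pq.2]].

Definition expi (R : realType) (t : R) : R[i] := (cos t +i* sin t)%C.

Definition complex_integral d (T : measurableType d) (R : realType)
    (mu : {measure set T -> \bar R}) (f : T -> R[i]) : R[i] :=
  (Rintegral mu setT (fun x => complex.Re (f x)) +i*
   Rintegral mu setT (fun x => complex.Im (f x)))%C.

Definition fourier (R : realType)
    (mu : {measure set (measurableTypeR R) -> \bar R}) (xi : R) : R[i] :=
  complex_integral mu (fun x : measurableTypeR R => expi (- 2 * pi * x * xi)).

(* Main.v *)
(* The measure is a limit of smooth densities f_k, obtained by multiplying f_(k-1)
   by a weighted average, with weights proportional to 1/q over a finite set P_k of
   large primes, of combs of bumps of width about psi(q) centred at the fractions p/q.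
   Such a comb has mean 1 and correlates with a wave of frequency xi only when xi is
   close to a multiple of q. An integer n <= 2 xi has boundedly many prime divisors
   q with q^4 >= 1/alpha(1/xi), and smaller primes are harmless because a bump of
   width psi(q) is smooth at the scale 1/xi; so the weighted average has Fourier
   transform at most C sqrt(alpha(1/xi)) / s, where s is the sum of 1/q over P_k. The sum s is
   also, up to a constant, the alpha-cost of covering the support of f_k. As the sum
   of the reciprocals of the primes diverges, s can be prescribed (here s is about
   2^-k) while the primes of P_k are taken arbitrarily large; then omega absorbs 1/s,
   and the covering costs tend to 0.

   All estimates use differences instead of derivatives: translating by 1/q and by
   1/(2 xi) replaces Fourier series and integration by parts. *)
Require Import Defs.
From HB Require Import structures.
From mathcomp Require Import all_boot all_order all_algebra.
From mathcomp Require Import all_classical all_reals all_analysis.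
From mathcomp Require Import complex.
From mathcomp Require Import measurable_realfun ring lra zify.

Set Implicit Arguments.
Unset Strict Implicit.
Unset Printing Implicit Defensive.
Import Order.TTheory GRing.Theory Num.Theory.
Import numFieldNormedType.Exports.
Local Open Scope classical_set_scope.
Local Open Scope ring_scope.

(** Let [d] be the larger of 1 and the distance from [xi] to the nearest multiple of [q], and
    [r = psi q / 4]. Against a fixed smooth function the comb of [q] has transform O(1 / (d max(d, r
    xi))): each translation by [1/q] gains [1/d], a translation by half a period gains [1/(r xi)].
    The hypothesis on [rho < 1] makes alpha(x)/x monotone near 0, and the definition of [psi] then
    gives 1 <= 8 q^2 alpha(1/xi) max(1, r xi). A geometric mean spends half a power of the maximum
    on turning the weight [1/q] into sqrt(alpha(1/xi)); what remains is d^(-3/2), still summable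
    over the integers. The exponent in [q^4] comes from the small primes: there are at most
    alpha^(-1/4) of them and each costs O(alpha^(3/4)). For the large ones, [nu > 0] bounds
    alpha(1/xi) by a negative power of [xi], so that few of them divide one integer. Multiplication
    by a comb preserves the total mass only approximately. Hence the distribution functions are
    required to move by at most 2^-(k+2) from [f_k] to [f_(k+1)]: they converge uniformly, the limit
    keeps mass at least 1/2, and it is normalised at the end. *)

(** * Integrals of continuous functions with compact support *)

Definition ccf (R : realType) (F : R -> R) : Prop :=
  continuous F /\ exists K : R, forall x, K < `|x| -> F x = 0.

(** [Rintegral] is the finite part of an extended integral; on [ccf] functions that integral is
    finite, so linearity, monotonicity and translation invariance need no hypothesis beyond
    [ccf]. *)
Definition Int (R : realType) (F : R -> R) : R :=
  Rintegral (@lebesgue_measure R) setT F.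

Section Int.
Context {R : realType}.
Implicit Types F G : R -> R.
Let mu := @lebesgue_measure R.

Lemma ccf_integrable F : ccf F -> mu.-integrable setT (EFin \o F).
Proof.
move=> [cF [K hK]].
have -> : EFin \o F = (EFin \o F) \_ `[- K, K].
  apply/funext => x; rewrite patchE; case: ifPn => //= /negP h.
  rewrite hK//; apply/contra_notT : h; rewrite -leNgt ler_norml => h.
  by rewrite inE/= in_itv.
rewrite -(integrable_mkcond (mu := mu))//.
by apply: continuous_compact_integrable; [exact: segment_compact|exact: continuous_subspaceT].
Qed.

Lemma ccfM F G : ccf F -> continuous G -> ccf (fun x => F x * G x).
Proof.
move=> [cF [K hK]] cG; split; first by move=> x; apply: cvgM; [exact: cF|exact: cG].
by exists K => x /hK ->; rewrite mul0r.
Qed.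

Lemma ccfD F G : ccf F -> ccf G -> ccf (fun x => F x + G x).
Proof.
move=> [cF [K hK]] [cG [L hL]]; split; first by move=> x; apply: cvgD; [exact: cF|exact: cG].
exists (Num.max K L) => x; rewrite gt_max => /andP[/hK -> /hL ->]; exact: addr0.
Qed.

Lemma ccfZ a F : ccf F -> ccf (fun x => a * F x).
Proof.
move=> [cF [K hK]]; split; first by move=> x; apply: cvgM; [exact: cvg_cst|exact: cF].
by exists K => x /hK ->; rewrite mulr0.
Qed.

Lemma ccfN F : ccf F -> ccf (fun x => - F x).
Proof.
move=> [cF [K hK]]; split; first by move=> x; apply: cvgN; exact: cF.
by exists K => x /hK ->; rewrite oppr0.
Qed.

Lemma ccfB F G : ccf F -> ccf G -> ccf (fun x => F x - G x).
Proof. by move=> hF hG; apply: ccfD => //; exact: ccfN. Qed.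

Lemma ccf_abs F : ccf F -> ccf (fun x => `|F x|).
Proof.
move=> [cF [K hK]]; split.
  by move=> x; apply: (@continuous_comp _ _ _ F); [exact: cF|exact: norm_continuous].
by exists K => x /hK ->; rewrite normr0.
Qed.

Lemma ccf_shift F a : ccf F -> ccf (fun x => F (x + a)).
Proof.
move=> [cF [K hK]]; split.
  move=> x; apply: (@continuous_comp _ _ _ (fun x => x + a) F); last exact: cF.
  by apply: cvgD; [exact: cvg_id|exact: cvg_cst].
exists (K + `|a|) => x h; apply: hK.
have := ler_normB (x + a) a; rewrite addrK => h2.
lra.
Qed.

Lemma ccf_sum (I : Type) (r : seq I) (F : I -> R -> R) :
  (forall i, ccf (F i)) -> ccf (fun x => \sum_(i <- r) F i x).
Proof.
move=> h; elim: r => [|i r IH].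
  under eq_fun do rewrite big_nil.
  by split; [move=> x; exact: cvg_cst|exists 0].
by under eq_fun do rewrite big_cons; apply: ccfD.
Qed.

Lemma IntD F G : ccf F -> ccf G -> Int (fun x => F x + G x) = Int F + Int G.
Proof. by move=> hF hG; rewrite /Int RintegralD//; exact: ccf_integrable. Qed.

Lemma IntB F G : ccf F -> ccf G -> Int (fun x => F x - G x) = Int F - Int G.
Proof. by move=> hF hG; rewrite /Int RintegralB//; exact: ccf_integrable. Qed.

Lemma IntZ a F : ccf F -> Int (fun x => a * F x) = a * Int F.
Proof. by move=> hF; rewrite /Int RintegralZl//; exact: ccf_integrable. Qed.

Lemma Int_sum (I : Type) (r : seq I) (F : I -> R -> R) :
  (forall i, ccf (F i)) -> Int (fun x => \sum_(i <- r) F i x) = \sum_(i <- r) Int (F i).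
Proof.
move=> h; elim: r => [|i r IH].
  under eq_fun do rewrite big_nil.
  by rewrite big_nil /Int Rintegral_cst// mul0r.
under eq_fun do rewrite big_cons.
by rewrite IntD// ?IH ?big_cons//; exact: ccf_sum.
Qed.

Lemma le_Int F G : ccf F -> ccf G -> (forall x, F x <= G x) -> Int F <= Int G.
Proof. by move=> hF hG h; apply: le_Rintegral => //; exact: ccf_integrable. Qed.

Lemma le_normr_Int F G : ccf F -> ccf G -> (forall x, `|F x| <= G x) -> `|Int F| <= Int G.
Proof.
move=> hF hG h; apply: (@le_trans _ _ (Int (fun x => `|F x|))).
  by apply: le_normr_Rintegral => //; exact: ccf_integrable.
by apply: le_Int => //; exact: ccf_abs.
Qed.

(** The translated measure has the right values on half-open intervals, and these determine Lebesgue
    measure. *)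
Lemma lebesgue_measure_shift (a : R) (A : set R) : measurable A ->
  pushforward mu (fun x => x + a : measurableTypeR R) A = mu A.
Proof.
have mphi : measurable_fun setT (fun x : R => x + a : measurableTypeR R).
  by apply: continuous_measurable_fun => x; apply: cvgD; [exact: cvg_id|exact: cvg_cst].
move=> mA; apply/esym/lebesgue_measure_unique => //= _ [[b c]] _ <-.
rewrite /pushforward (_ : _ @^-1` _ = `]b - a, c - a]%classic); last first.
  by apply/seteqP; split => x /=; rewrite !in_itv/= ltrBlDr lerBrDr.
rewrite !lebesgue_measure_itv/= !lte_fin ltrD2r -!EFinB.
by rewrite opprB addrA subrK.
Qed.

Lemma Int_shift F a : ccf F -> Int (fun x => F (x + a)) = Int F.
Proof.
move=> hF; rewrite /Int /Rintegral; congr fine.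
have mF : measurable_fun setT (EFin \o F).
  by apply: measurableT_comp => //; apply: continuous_measurable_fun; exact: (proj1 hF).
have mphi : measurable_fun setT (fun x : measurableTypeR R => x + a : measurableTypeR R).
  by apply: continuous_measurable_fun => x; apply: cvgD; [exact: cvg_id|exact: cvg_cst].
have hs : mu.-integrable ((fun x : measurableTypeR R => x + a : measurableTypeR R) @^-1` setT)
    ((EFin \o F) \o (fun x : measurableTypeR R => x + a : measurableTypeR R)).
  by rewrite preimage_setT; exact: (ccf_integrable (ccf_shift a hF)).
have := integral_pushforward mphi mF hs measurableT; rewrite preimage_setT => <-.
by apply: eq_measure_integral => //= A mA AS; exact: lebesgue_measure_shift.
Qed.

Lemma le_Int_supp F B K c : ccf F -> 0 <= K -> (forall x, `|F x| <= B) ->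
  (forall x, K < `|x - c| -> F x = 0) -> `|Int F| <= B * (K + K).
Proof.
move=> hF K0 hB hK.
rewrite -(Int_shift c hF).
have hF' := ccf_shift c hF.
have := le_normr_Rintegral (mu := mu) measurableT (ccf_integrable hF').
move=> /le_trans; apply.
have -> : (fun x => `|F (x + c)|) = (fun x => `|F (x + c)|) \_ `[- K, K].
  apply/funext => x; rewrite patchE; case: ifPn => //= /negP h.
  rewrite hK ?normr0// addrK; apply/contra_notT : h; rewrite -leNgt ler_norml => h.
  by rewrite inE/= in_itv.
rewrite -Rintegral_mkcond.
have : \int[mu]_(x in `[-K, K]) `|F (x + c)| <= \int[mu]_(x in `[-K, K]) B.
  apply: le_Rintegral => //.
  - apply: (@integrableS _ _ _ _ setT) => //; exact: ccf_integrable (ccf_abs hF').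
  - apply: continuous_compact_integrable; first exact: segment_compact.
    by apply: continuous_subspaceT => x; exact: cvg_cst.
move=> /le_trans; apply.
rewrite Rintegral_cst//.
have B0 : 0 <= B by apply: le_trans (hB 0).
rewrite [fine _](_ : _ = K + K)//.
transitivity (fine (@lebesgue_measure R `[- K, K]%classic)); first by [].
rewrite lebesgue_measure_itv/= lte_fin; case: ifPn => h /=; first by rewrite opprK.
lra.
Qed.

End Int.

(** * Divergence of the sum of reciprocals of primes *)

Section PrimeReciprocals.
Local Open Scope set_scope.
Local Open Scope nat_scope.

(** Distinct primes are coprime, so their product divides [n] as soon as each of them does. This
    limits how many large primes can divide one integer. *)
Lemma prod_primes_leq (l : seq nat) (n : nat) : 0 < n -> uniq l ->
  (forall q, q \in l -> prime q /\ q %| n) -> \prod_(q <- l) q <= n.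
Proof.
move=> n0 ul hl; apply: dvdn_leq => //.
elim: l ul hl => [|q l IH] /=; first by rewrite big_nil dvd1n.
move=> /andP[ql ul] hl; rewrite big_cons.
have [pq qn] := hl q (mem_head _ _).
have hl' : forall p, p \in l -> prime p /\ p %| n.
  by move=> p pl; apply: hl; rewrite inE pl orbT.
rewrite Gauss_dvd ?qn ?IH// prime_coprime//; apply/negP => h.
suff : q \in l by rewrite (negPf ql).
elim: l {IH ul hl ql} h hl' => [|p l IH]; first by rewrite big_nil Euclid_dvd1.
rewrite big_cons Euclid_dvdM// => /orP[qp|ql] hl'.
  have [pp _] := hl' p (mem_head _ _).
  by move: qp; rewrite dvdn_prime2// => /eqP ->; rewrite mem_head.
by rewrite inE IH ?orbT// => z zl; apply: hl'; rewrite inE zl orbT.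
Qed.

Lemma exp_beats_poly (M : nat) : exists L, L.+1 ^ M < 2 ^ L.-1.
Proof.
(* With [L + 1 = 2 ^ j] the claim reads [j * M < 2 ^ j - 2], and
   [2 ^ j = (2 ^ m) ^ 2 >= (m + 1) ^ 2] is enough. *)
pose m := 2 * M + 2; pose j := 2 * m.
exists (2 ^ j).-1; rewrite prednK ?expn_gt0// -expnM ltn_exp2l//.
have h : m.+1 * m.+1 <= 2 ^ j.
  rewrite /j mulnC expnM expnS expn1; apply: leq_mul; exact: ltn_expl.
by apply: leq_trans (_ : m.+1 * m.+1 - 2 <= _); rewrite /j /m in h *; nia.
Qed.

(** The index [i] stands for the integer [i + 1 <= 2 ^ L]. Without prime factors from [M] on, it is
    determined by its exponents at the primes below [M], and each exponent is at most [L]. *)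
Lemma card_smooth (M L : nat) (A : {set 'I_(2 ^ L)}) :
  (forall i q, i \in A -> prime q -> q %| i.+1 -> q < M) -> #|A| <= L.+1 ^ M.
Proof.
move=> hA.
have logL p (i : 'I_(2 ^ L)) : logn p i.+1 < L.+1.
  have [pp|np] := boolP (prime p); last by rewrite lognE (negPf np).
  rewrite ltnS -(@leq_exp2l 2)//; apply: leq_trans (ltn_ord i).
  apply: leq_trans (_ : p ^ logn p i.+1 <= _).
    by case: (logn p i.+1) => // k; rewrite leq_exp2r// prime_gt1.
  by apply: dvdn_leq => //; exact: pfactor_dvdnn.
pose f (i : 'I_(2 ^ L)) := [ffun p : 'I_M => Ordinal (logL p i)].
have -> : L.+1 ^ M = #|{: {ffun 'I_M -> 'I_L.+1}}| by rewrite card_ffun !card_ord.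
apply: (@leq_card_in _ _ f) => i j iA jA fij.
apply/val_inj/succn_inj/eqn_from_log => // p.
have [pM|Mp] := ltnP p M.
  by move/ffunP: fij => /(_ (Ordinal pM)); rewrite !ffunE => /(congr1 val).
have h (k : 'I_(2 ^ L)) : k \in A -> logn p k.+1 = 0.
  move=> kA; rewrite lognE; case: ifPn => // /and3P[pp _ pk].
  by have := hA k p kA pp pk; rewrite ltnNge Mp.
by rewrite !h.
Qed.

Lemma sum_dvdn (q x : nat) : \sum_(i < x) (q %| i.+1) = x %/ q.
Proof.
elim: x => [|x IH]; first by rewrite big_ord0 div0n.
case: q IH => [|q] IH; first by rewrite big_ord_recr/= IH !divn0.
by rewrite big_ord_recr/= IH divnS// addnC.
Qed.

(** Fewer than half of the integers up to [x = 2 ^ L] have all prime factors below [M]; the others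
    are counted at least once by the multiples of the primes from [M] on. Dividing by [x], the
    reciprocals of these primes sum to more than 1/2. *)
Lemma primes_div_count (M : nat) : exists2 x, 0 < x &
  x < 2 * \sum_(q < x.+1 | prime q && (M <= q)) x %/ q.
Proof.
have [L hL] := exp_beats_poly M; exists (2 ^ L); first by rewrite expn_gt0.
set x := 2 ^ L.
pose A := [set i : 'I_x | [exists q : 'I_x.+1, [&& prime q, M <= q & q %| i.+1]]].
have hC : #|~: A| <= L.+1 ^ M.
  apply: card_smooth => i q; rewrite !inE => /existsPn h pq qi.
  rewrite ltnNge; apply/negP => Mq.
  have qx : q < x.+1 by rewrite ltnS; apply: leq_trans (dvdn_leq _ qi) (ltn_ord i).
  by have := h (Ordinal qx); rewrite /= pq Mq qi.
have hA : #|A| <= \sum_(q < x.+1 | prime q && (M <= q)) x %/ q.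
  under eq_bigr do rewrite -sum_dvdn.
  rewrite exchange_big/= -sum1_card big_mkcond/=; apply: leq_sum => i _.
  case: ifPn => //; rewrite inE => /existsP[q /and3P[pq Mq qi]].
  by rewrite (bigD1 q)/= ?pq// qi.
have := cardsC A; rewrite card_ord => hAC.
have : 2 * L.+1 ^ M < x.
  rewrite /x; case: L hL {A hC hA hAC x} => [|L] hL; last by rewrite expnS ltn_mul2l.
  by move: hL; rewrite exp1n.
lia.
Qed.

End PrimeReciprocals.

(** Primes from [M] on are collected until the sum first reaches [s], which happens because the full
    tail exceeds 1/2. The last prime adds at most [1/M <= s], whence the upper bound. *)
Lemma primes_reciprocal_sum (R : realType) (M : nat) (s : R) :
  0 < s -> s <= 2^-1 -> M%:R^-1 <= s -> (0 < M)%N ->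
  exists P : seq nat, [/\ uniq P, forall q, q \in P -> prime q /\ (M <= q)%N,
    s <= \sum_(q <- P) (q%:R^-1 : R) & \sum_(q <- P) (q%:R^-1 : R) <= s + s].
Proof.
move=> s0 s1 Ms M0.
pose P N := [seq q <- iota 0 N | prime q && (M <= q)%N].
pose S N : R := \sum_(q <- P N) q%:R^-1.
have SE N : S N = \sum_(q < N | prime q && (M <= q)%N) q%:R^-1.
  by rewrite /S /P big_filter -{1}(subn0 N) -/(index_iota _ _) big_mkord.
have hex : exists N, s <= S N.
  have [x x0 hx] := primes_div_count M; exists x.+1; apply: (le_trans s1).
  rewrite SE -(@ler_pM2l _ x%:R) ?ltr0n// mulr_sumr.
  apply: (@le_trans _ _ (\sum_(q < x.+1 | prime q && (M <= q)%N) (x %/ q)%:R)).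
    rewrite -natr_sum ler_pdivrMr// mulrC -natrM ler_nat; exact: ltnW.
  apply: ler_sum => q /andP[pq _]; rewrite ler_pdivlMr ?ltr0n ?prime_gt0//.
  by rewrite -natrM ler_nat leq_trunc_div.
have SS N : S N.+1 <= S N + s.
  rewrite !SE [in leLHS]big_mkcond [in leRHS]big_mkcond big_ord_recr/= lerD2l.
  case: ifPn => [/andP[_ MN]|_]; last exact: ltW.
  apply: le_trans Ms; rewrite lef_pV2 ?ler_nat// posrE ltr0n//.
  exact: leq_trans MN.
pose N := ex_minn hex; exists (P N); split.
- by rewrite filter_uniq// iota_uniq.
- by move=> q; rewrite mem_filter => /andP[/andP[]].
- by rewrite /N; case: ex_minnP.
- rewrite -/(S N) /N; case: ex_minnP => -[|m] _ hm.
    by rewrite /S /P/= big_nil addr_ge0// ltW.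
  apply: (le_trans (SS m)); rewrite lerD2r leNgt; apply/negP => /ltW /hm.
  by rewrite ltnn.
Qed.

(** * Elementary bounds for sine and cosine, and smoothness expressed by differences *)

Section Lipschitz.
Context {R : realType}.
Implicit Types f g : R -> R.

Lemma lipschitz_continuous f (L : R) :
  (forall x y, `|f x - f y| <= L * `|x - y|) -> continuous f.
Proof.
move=> h x; apply/(@cvgrPdist_le _ R^o) => /= e e0.
have L0 : 0 <= L by have := h 1 0; rewrite subr0 normr1 mulr1; apply: le_trans.
near=> y; apply: (le_trans (h x y)).
apply: (@le_trans _ _ ((L + 1) * `|x - y|)).
  by rewrite ler_wpM2r// lerDl.
rewrite mulrC -ler_pdivlMr ?ltr_wpDl//.
near: y; apply: (@cvgr_dist_le _ R^o _ (nbhs x) _ id x); first exact: cvg_id.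
by rewrite divr_gt0// ltr_wpDl.
Unshelve. all: by end_near. Qed.

Lemma cos_lipschitz (x y : R) : `|cos x - cos y| <= `|x - y|.
Proof.
wlog xy : x y / x <= y => [hw|].
  have [|/ltW] := leP x y; first exact: hw.
  by move=> yx; rewrite distrC (distrC x); exact: hw.
have cc : {within `[x, y], continuous (@cos R)}.
  by apply: continuous_subspaceT; exact: continuous_cos.
have [c _] := MVT_segment xy (fun z _ => is_derive_cos z) cc.
rewrite (distrC (cos x)) (distrC x) => ->; rewrite normrM normrN.
by rewrite -[leRHS]mul1r ler_wpM2r// sin_max.
Qed.

Lemma cos_pi4_ge : (2^-1 : R) <= cos (pi / 4).
Proof.
have h0 : 0 <= cos (pi / 4 : R).
  by apply: cos_ge0_pihalf; have := @pi_ge0 R; lra.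
have := @cos_mulr2n R (pi / 4).
have -> : pi / 4 *+ 2 = pi / 2 :> R by rewrite mulr2n; lra.
rewrite cos_pihalf mulr2n => h.
rewrite leNgt; apply/negP => h1; nra.
Qed.

(** A crude Jordan inequality. Cosine is at least 1/2 only up to [pi / 4], so the mean value theorem
    is applied on [[0, t / 2]] and the doubling formula does the rest. *)
Lemma sin_lower (t : R) : 0 <= t <= pi / 2 -> t / 4 <= sin t.
Proof.
move=> /andP[t0 tpi].
have hc (c : R) : 0 <= c <= pi / 4 -> 2^-1 <= cos c.
  move=> /andP[c0 c1]; apply: (le_trans cos_pi4_ge).
  have := @pi_ge0 R => pi0.
  have i1 : c \in `[0, pi]%R by rewrite in_itv/=; lra.
  have i2 : (pi / 4 : R) \in `[0, pi : R]%R by rewrite in_itv/=; lra.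
  by rewrite leNgt ltr_cos// -leNgt.
have cc : {within `[0, t / 2], continuous (@sin R)}.
  by apply: continuous_subspaceT; exact: continuous_sin.
have t2 : 0 <= t / 2 by lra.
have [c] := MVT_segment t2 (fun z _ => is_derive_sin z) cc.
rewrite in_itv/= => /andP[c0 c1]; rewrite sin0 !subr0 => hs.
have h1 : 2^-1 <= cos c by apply: hc; lra.
have h2 : 2^-1 <= cos (t / 2) by apply: hc; lra.
have -> : sin t = (cos (t / 2) * sin (t / 2)) *+ 2.
  by rewrite -sin_mulr2n; congr sin; rewrite mulr2n; lra.
have h3 : 4^-1 <= cos (t / 2) * cos c by nra.
rewrite hs (_ : _ *+ 2 = cos (t / 2) * cos c * t); last by rewrite mulr2n; field.
by rewrite mulrC ler_wpM2r.
Qed.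

Lemma abs_sin_lower (t : R) : `|t| <= pi / 2 -> `|t| / 4 <= `|sin t|.
Proof.
move=> ht.
have [t0|t0] := leP 0 t.
  move: ht; rewrite ger0_norm// => ht; apply: le_trans (ler_norm _).
  by apply: sin_lower; rewrite t0 ht.
move: ht; rewrite ltr0_norm// -normrN -sinN => ht; apply: le_trans (ler_norm _).
by apply: sin_lower; lra.
Qed.

End Lipschitz.

(* The second difference with two independent increments is the derivative-free
   form of "the derivative of f is C-Lipschitz". *)
Definition C11 (R : realType) (C : R) (f : R -> R) : Prop :=
  [/\ forall x, `|f x| <= C,
      forall x h, `|f (x + h) - f x| <= C * `|h|
    & forall x h k, `|f (x + h + k) - f (x + h) - f (x + k) + f x|
                      <= C * `|h| * `|k|].

Section C11.
Context {R : realType}.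
Implicit Types (f g : R -> R) (C D : R).

Lemma C11_ge0 C f : C11 C f -> 0 <= C.
Proof. by move=> [h _ _]; exact: le_trans (h 0). Qed.

Lemma C11_continuous C f : C11 C f -> continuous f.
Proof.
move=> [_ h _]; apply: (@lipschitz_continuous _ _ C) => x y.
by have := h y (x - y); rewrite (_ : y + (x - y) = x); last by ring.
Qed.

(** The discrete Leibniz rule splits the second difference of a product into four terms, each with
    constant [C * D]. *)
Lemma C11M C D f g : C11 C f -> C11 D g -> C11 (4 * (C * D)) (fun x => f x * g x).
Proof.
move=> hf hg; have C0 := C11_ge0 hf; have D0 := C11_ge0 hg.
case: hf => f0 f1 f2; case: hg => g0 g1 g2; split.
- move=> x; rewrite normrM; apply: (@le_trans _ _ (C * D)).
    by apply: ler_pM.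
  by rewrite ler_peMl ?mulr_ge0// ler1n.
- move=> x h.
  have -> : f (x + h) * g (x + h) - f x * g x =
    (f (x + h) - f x) * g (x + h) + f x * (g (x + h) - g x) by ring.
  apply: (le_trans (ler_normD _ _)); rewrite !normrM.
  have := ler_pM (normr_ge0 _) (normr_ge0 _) (f1 x h) (g0 (x + h)).
  have := ler_pM (normr_ge0 _) (normr_ge0 _) (f0 x) (g1 x h).
  have := mulr_ge0 (mulr_ge0 C0 D0) (normr_ge0 h).
  lra.
- move=> x h k.
  have -> : f (x + h + k) * g (x + h + k) - f (x + h) * g (x + h)
      - f (x + k) * g (x + k) + f x * g x =
    (f (x + h + k) - f (x + h) - f (x + k) + f x) * g (x + h + k) +
    (f (x + h) - f x) * (g (x + h + k) - g (x + h)) +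
    (f (x + k) - f x) * (g (x + k + h) - g (x + k)) +
    f x * (g (x + h + k) - g (x + h) - g (x + k) + g x).
    by rewrite (addrAC x k h); ring.
  have e1 := ler_pM (normr_ge0 _) (normr_ge0 _) (f2 x h k) (g0 (x + h + k)).
  have e2 := ler_pM (normr_ge0 _) (normr_ge0 _) (f1 x h) (g1 (x + h) k).
  have e3 := ler_pM (normr_ge0 _) (normr_ge0 _) (f1 x k) (g1 (x + k) h).
  have e4 := ler_pM (normr_ge0 _) (normr_ge0 _) (f0 x) (g2 x h k).
  rewrite -!normrM in e1 e2 e3 e4.
  apply: (le_trans (ler_normD _ _)).
  apply: (le_trans (lerD (ler_normD _ _) e4)).
  apply: (le_trans (lerD (lerD (ler_normD _ _) e3) (lexx _))).
  apply: (le_trans (lerD (lerD (lerD e1 e2) (lexx _)) (lexx _))).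
  lra.
Qed.

Lemma C11D C D f g : C11 C f -> C11 D g -> C11 (C + D) (fun x => f x + g x).
Proof.
move=> [f0 f1 f2] [g0 g1 g2]; split.
- by move=> x; apply: (le_trans (ler_normD _ _)); exact: lerD.
- move=> x h; rewrite opprD addrACA; apply: (le_trans (ler_normD _ _)).
  by rewrite mulrDl lerD.
- move=> x h k.
  rewrite [X in `|X|](_ : _ = (f (x + h + k) - f (x + h) - f (x + k) + f x) +
    (g (x + h + k) - g (x + h) - g (x + k) + g x)); last by ring.
  by apply: (le_trans (ler_normD _ _)); rewrite !mulrDl lerD.
Qed.

Lemma C11Z a C f : C11 C f -> C11 (`|a| * C) (fun x => a * f x).
Proof.
move=> [f0 f1 f2]; split.
- by move=> x; rewrite normrM ler_wpM2l.
- by move=> x h; rewrite -mulrBr normrM -mulrA ler_wpM2l.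
- move=> x h k; rewrite [X in `|X|](_ : _ = a * (f (x + h + k) - f (x + h) - f (x + k) + f x)); last by ring.
  by rewrite normrM -!mulrA ler_wpM2l// mulrA.
Qed.

Lemma C11_sum (I : Type) (s : seq I) (F : I -> R -> R) :
  (forall i, exists C, C11 C (F i)) -> exists C, C11 C (fun x => \sum_(i <- s) F i x).
Proof.
move=> h; elim: s => [|i s [D hD]].
  exists 0; split => *; rewrite !big_nil ?subrr ?addr0 ?subr0 ?normr0 ?mul0r//.
have [C hC] := h i; exists (C + D).
by under eq_fun do rewrite big_cons; exact: C11D.
Qed.

Lemma C11_affine (a b : R) C f : C11 C f ->
  C11 (C * ((1 + `|a|) * (1 + `|a|))) (fun x => f (a * x + b)).
Proof.
move=> hf; have C0 := C11_ge0 hf; case: hf => f0 f1 f2.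
have a0 := normr_ge0 a.
split.
- by move=> x; apply: (le_trans (f0 _)); nra.
- move=> x h; rewrite mulrDr addrAC; apply: (le_trans (f1 _ _)).
  rewrite normrM -mulrA; apply: ler_wpM2l => //; apply: ler_wpM2r => //; nra.
- move=> x h k; rewrite !mulrDr.
  have := f2 (a * x + b) (a * h) (a * k).
  rewrite (_ : a * x + b + a * h + a * k = a * x + a * h + a * k + b); last by ring.
  rewrite (_ : a * x + b + a * h = a * x + a * h + b); last by ring.
  rewrite (_ : a * x + b + a * k = a * x + a * k + b); last by ring.
  move=> /le_trans; apply; rewrite !normrM.
  rewrite [leLHS](_ : _ = C * (`|a| * `|a|) * `|h| * `|k|); last by ring.
  do 2 (apply: ler_wpM2r => //); rewrite -mulrDr; apply: ler_wpM2l => //; nra.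
Qed.

(** Here [f1] plays the derivative. The second difference is two Taylor remainders in [h] plus the
    change of [f1] over [k] times [h]. The remainders are quadratic in [h], so taking [h] as the
    smaller increment bounds them by the product of [h] and [k]. *)
Lemma taylor_C11 C f (f1 : R -> R) : (forall x, `|f x| <= C) ->
  (forall x h, `|f (x + h) - f x| <= C * `|h|) ->
  (forall x h, `|f1 (x + h) - f1 x| <= C * `|h|) ->
  (forall x h, `|f (x + h) - f x - f1 x * h| <= C * `|h| * `|h|) ->
  C11 (3 * C) f.
Proof.
move=> f0 fL f1L ft.
have C0 : 0 <= C by exact: le_trans (f0 0).
split.
- by move=> x; apply: (le_trans (f0 x)); lra.
- move=> x h; apply: (le_trans (fL x h)); rewrite ler_wpM2r//; lra.
move=> x h k.
wlog hk : h k / `|h| <= `|k| => [hw|].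
  have [|/ltW kh] := leP `|h| `|k|; first exact: hw.
  have := hw _ _ kh; rewrite (addrAC x k h) -mulrA (mulrC `|k|) mulrA.
  by rewrite (addrAC (f (x + h + k))).
rewrite [X in `|X|](_ : _ = (f (x + k + h) - f (x + k) - f1 (x + k) * h)
  - (f (x + h) - f x - f1 x * h) + (f1 (x + k) - f1 x) * h); last first.
  by rewrite (addrAC x k h); ring.
apply: (le_trans (ler_normD _ _)).
apply: (le_trans (lerD (ler_normB _ _) (lexx _))).
have e1 := ft (x + k) h; have e2 := ft x h.
have e3 := ler_wpM2r (normr_ge0 h) (f1L x k); rewrite -normrM in e3.
have e4 : C * `|h| * `|h| <= C * `|h| * `|k| by rewrite ler_wpM2l// mulr_ge0.
lra.
Qed.

End C11.

(** * A compactly supported bump with Lipschitz derivative *)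

Section Phi.
Context {R : realType}.
Implicit Types x y h : R.

Definition clamp y : R := Num.max (-1) (Num.min 1 y).

(** This is [(1 - y ^ 2) ^ 2] on [[-1, 1]] and 0 outside. The outer square makes the derivative
    vanish at both ends, which is all the smoothness [C11] asks for; clamping reduces most estimates
    to a single polynomial. *)
Definition phi y : R := (1 - clamp y ^+ 2) ^+ 2.

Lemma clamp_cases y : [\/ y <= -1 /\ clamp y = -1, 1 <= y /\ clamp y = 1
  | -1 <= y <= 1 /\ clamp y = y].
Proof.
rewrite /clamp; have [h|h] := leP 1 y.
  by constructor 2; split => //; rewrite max_r//; lra.
have [h1|h1] := leP (-1) y; last by constructor 1; split => //; lra.
by constructor 3; split => //; lra.
Qed.

Lemma clamp_bound y : -1 <= clamp y <= 1.
Proof. by case: (clamp_cases y) => -[h ->]; lra. Qed.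

Lemma clamp_lip x h : `|clamp (x + h) - clamp x| <= `|h|.
Proof.
have hh := real_ler_norm (num_real h); have hn := real_ler_norm (num_real (- h)).
rewrite normrN in hn; rewrite ler_norml.
by case: (clamp_cases x) => -[h1 ->]; case: (clamp_cases (x + h)) => -[h2 ->]; lra.
Qed.

Lemma phi_ge0 y : 0 <= phi y. Proof. exact: sqr_ge0. Qed.

Lemma phi_le1 y : phi y <= 1.
Proof. by rewrite /phi; have /andP[h1 h2] := clamp_bound y; apply: exprn_ile1; nra. Qed.

Lemma phi_out y : 1 <= `|y| -> phi y = 0.
Proof.
rewrite /phi ler_normr => /orP h.
suff -> : clamp y ^+ 2 = 1 by rewrite subrr expr0n.
case: (clamp_cases y) => -[h1 ->]; rewrite ?sqrrN ?expr1n//.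
by case: h => h; [have -> : y = 1 by lra | have -> : y = -1 by lra];
  rewrite ?sqrrN ?expr1n.
Qed.

Lemma phi_mid y : `|y| <= 2^-1 -> 2^-1 <= phi y.
Proof.
rewrite ler_norml => /andP[h1 h2]; rewrite /phi.
case: (clamp_cases y) => -[h3 ->]; try lra; nra.
Qed.

Lemma phi_C11 : exists C, C11 C phi.
Proof.
exists (3 * 12).
(* The derivative of [phi], again written through [clamp]. *)
pose f1 y := - 4 * clamp y * (1 - clamp y ^+ 2).
apply: (@taylor_C11 R 12 phi f1).
- by move=> x; rewrite ger0_norm ?phi_ge0//; have := phi_le1 x; lra.
- move=> x h; have := clamp_lip x h; rewrite /phi.
  have := clamp_bound x; have := clamp_bound (x + h).
  move: (clamp x) (clamp (x + h)) => c d /andP[d1 d2] /andP[c1 c2] hcd.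
  rewrite [X in `|X|](_ : _ = (d - c) * ((d + c) * (d ^+ 2 + c ^+ 2 - 2))); last by ring.
  rewrite normrM mulrC; apply: ler_pM => //.
  rewrite ler_norml; apply/andP; split; nra.
- move=> x h; have := clamp_lip x h; rewrite /f1.
  have := clamp_bound x; have := clamp_bound (x + h).
  move: (clamp x) (clamp (x + h)) => c d /andP[d1 d2] /andP[c1 c2] hcd.
  rewrite [X in `|X|](_ : _ = (d - c) * (4 * (d ^+ 2 + d * c + c ^+ 2 - 1))); last by ring.
  rewrite normrM mulrC; apply: ler_pM => //.
  rewrite ler_norml; apply/andP; split; nra.
- move=> x h; rewrite /phi /f1.
  pose c := clamp x; pose d := clamp (x + h).
  rewrite -/c -/d [X in `|X|](_ : _ = (d - c) * (d - c) * (3 * c ^+ 2 + 2 * c * d + d ^+ 2 - 2)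
    + - 4 * c * (1 - c ^+ 2) * (d - c - h)); last by ring.
  have hc := clamp_bound x; have hd := clamp_bound (x + h).
  have hl := clamp_lip x h; rewrite -/c -/d in hc hd hl.
  apply: (le_trans (ler_normD _ _)).
  have -> : 12 * `|h| * `|h| = `|h| * `|h| * 4 + (8 * `|h|) * `|h| by ring.
  apply: lerD.
    rewrite 2!normrM; apply: ler_pM; [exact: mulr_ge0|by []|by apply: ler_pM|].
    move: hc hd => /andP[c1 c2] /andP[d1 d2].
    rewrite ler_norml; apply/andP; split; nra.
  have hh := real_ler_norm (num_real h); have hn := real_ler_norm (num_real (- h)).
  rewrite normrN in hn.
  have h0 := normr_ge0 h.
  (* The defect [d - c - h] measures the effect of clamping. If [x] is clamped, the factor
     [1 - c ^ 2] vanishes; if only [x + h] is clamped, then [x] lies within [|h|] of an endpoint and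
     this factor is at most [2 |h|]. *)
  have : [\/ c = -1 \/ c = 1, d - c - h = 0 | `|d - c - h| <= `|h| /\ `|1 - c ^+ 2| <= 2 * `|h|].
    rewrite /c /d; case: (clamp_cases x) => -[h1 ->]; [by constructor 1; left|by constructor 1; right|].
    case: (clamp_cases (x + h)) => -[h2 ->]; [constructor 3|constructor 3|constructor 2; lra].
      split; first by rewrite ler_norml; lra.
      by rewrite ler_norml; apply/andP; split; nra.
    split; first by rewrite ler_norml; lra.
    by rewrite ler_norml; apply/andP; split; nra.
  case=> [[->|->]|->|[h1 h2]].
  + by rewrite sqrrN expr1n subrr mulr0 mul0r normr0; nra.
  + by rewrite expr1n subrr mulr0 mul0r normr0; nra.
  + by rewrite mulr0 normr0; nra.
  + rewrite normrM; apply: ler_pM => //; rewrite normrM.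
    have -> : 8 * `|h| = 4 * (2 * `|h|) by ring.
    by apply: ler_pM => //; rewrite ler_norml; lra.
Qed.

End Phi.

(** * Normalised bumps and combs of bumps *)

Section Hump.
Context {R : realType}.
Implicit Types (F : R -> R) (r x u h : R).

Lemma ge_Int_supp F B K : ccf F -> 0 <= K -> (forall x, 0 <= F x) ->
  (forall x, `|x| <= K -> B <= F x) -> B * (K + K) <= Int F.
Proof.
move=> hF K0 F0 hB.
pose mu := @lebesgue_measure R.
apply: (@le_trans _ _ (\int[mu]_(x in `[- K, K]) F x)).
  have -> : B * (K + K) = \int[mu]_(x in `[-K, K]) B.
    rewrite Rintegral_cst//; congr (_ * _).
    transitivity (fine (@lebesgue_measure R `[- K, K]%classic)); last by [].
    rewrite lebesgue_measure_itv/= lte_fin; case: ifPn => h /=; first by rewrite opprK.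
    lra.
  apply: le_Rintegral => //.
  - apply: continuous_compact_integrable; first exact: segment_compact.
    by apply: continuous_subspaceT => x; exact: cvg_cst.
  - by apply: (@integrableS _ _ _ _ setT) => //; exact: ccf_integrable.
  - by move=> x /=; rewrite in_itv/= -ler_norml => /hB.
rewrite Rintegral_mkcond /Int; apply: le_Rintegral => //.
- rewrite -restrict_EFin -integrable_mkcond//.
  by apply: (@integrableS _ _ _ _ setT) => //; exact: ccf_integrable.
- exact: ccf_integrable.
- by move=> x _; rewrite patchE; case: ifP.
Qed.

Lemma phi_scale_C11 r b : exists C, C11 C (fun u => phi (r^-1 * u + b)).
Proof. by have [C hC] := @phi_C11 R; eexists; exact: C11_affine hC. Qed.

Definition Zhump r : R := Int (fun u => phi (r^-1 * u)).

Definition hump r u : R := (Zhump r)^-1 * phi (r^-1 * u).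

Lemma phi_scale_out r u : 0 < r -> r <= `|u| -> phi (r^-1 * u) = 0.
Proof.
move=> r0 ru; apply: phi_out; rewrite normrM gtr0_norm ?invr_gt0//.
by rewrite mulrC ler_pdivlMr// mul1r.
Qed.

Lemma phi_scale_ccf r : 0 < r -> ccf (fun u => phi (r^-1 * u)).
Proof.
move=> r0; split.
  have [C] := phi_scale_C11 r 0; under eq_fun do rewrite addr0.
  exact: C11_continuous.
by exists r => x /ltW; exact: phi_scale_out.
Qed.

Lemma Zhump_ge r : 0 < r -> r / 2 <= Zhump r.
Proof.
move=> r0; have -> : r / 2 = 2^-1 * (r / 2 + r / 2) by field.
apply: ge_Int_supp; first exact: phi_scale_ccf.
- by rewrite divr_ge0// ltW.
- by move=> x; exact: phi_ge0.
- move=> x hx; apply: phi_mid; rewrite normrM gtr0_norm ?invr_gt0//.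
  by rewrite mulrC ler_pdivrMr// mulrC.
Qed.

Lemma Zhump_gt0 r : 0 < r -> 0 < Zhump r.
Proof. by move=> r0; apply: lt_le_trans (Zhump_ge r0); rewrite divr_gt0. Qed.

Lemma Zhump_inv_le r : 0 < r -> (Zhump r)^-1 <= 2 / r.
Proof.
move=> r0; have -> : 2 / r = (r / 2)^-1 by rewrite invf_div.
by rewrite lef_pV2 ?posrE ?Zhump_gt0 ?divr_gt0// Zhump_ge.
Qed.

Lemma hump_ge0 r u : 0 < r -> 0 <= hump r u.
Proof. by move=> r0; rewrite mulr_ge0 ?phi_ge0// invr_ge0 ltW// Zhump_gt0. Qed.

Lemma hump_out r u : 0 < r -> r <= `|u| -> hump r u = 0.
Proof. by move=> r0 ru; rewrite /hump phi_scale_out// mulr0. Qed.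

Lemma hump_ccf r : 0 < r -> ccf (hump r).
Proof. by move=> r0; apply: ccfZ; exact: phi_scale_ccf. Qed.

Lemma Int_hump r : 0 < r -> Int (hump r) = 1.
Proof.
move=> r0; rewrite /hump IntZ; last exact: phi_scale_ccf.
by rewrite mulVf// gt_eqF// Zhump_gt0.
Qed.

Lemma hump_shift_C11 r b : exists C, C11 C (fun u => hump r (u + b)).
Proof.
have [C hC] := phi_scale_C11 r (r^-1 * b).
exists (`|(Zhump r)^-1| * C); rewrite /hump.
by under eq_fun do rewrite mulrDr; exact: C11Z.
Qed.

(** The L1 form of a derivative of total size O(1/r). For [|h| < r] the difference has height at
    most [(2 / r) C |h| / r] on an interval of length [4 r], which gives [8 C]; for [|h| >= r] the
    trivial bound 2 is at most [2 |h| / r]. *)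
Lemma hump_variation : exists2 K : R, 0 < K & forall r h, 0 < r ->
  Int (fun x => `|hump r (x + h) - hump r x|) <= K * `|h| / r.
Proof.
have [C hC] := @phi_C11 R; have C0 := C11_ge0 hC; have [_ hL _] := hC.
exists (8 * C + 2); first by rewrite ltr_wpDl// mulr_ge0.
move=> r h r0.
have cb := hump_ccf r0; have cbh := ccf_shift h cb.
have cc := ccf_abs (ccfB cbh cb).
have [hr|rh] := ltP `|h| r.
  apply: le_trans (ler_norm _) _.
  apply: (@le_trans _ _ (2 / r * (C * (r^-1 * `|h|)) * (2 * r + 2 * r))).
    apply: (le_Int_supp (c := 0) cc); first by rewrite mulr_ge0// ltW.
      move=> x; rewrite normr_id /hump -mulrBr normrM.
      apply: ler_pM => //.
        by rewrite ger0_norm ?Zhump_inv_le// invr_ge0 ltW// Zhump_gt0.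
      rewrite mulrDr; apply: le_trans (hL _ _) _.
      by rewrite normrM [`|r^-1|]gtr0_norm ?invr_gt0.
    move=> x; rewrite subr0 => hx.
    have h1 := ler_normB (x + h) h; rewrite addrK in h1.
    by rewrite !hump_out ?subrr ?normr0//; lra.
  rewrite [leLHS](_ : _ = 8 * C * `|h| / r); last by field; rewrite gt_eqF.
  rewrite -[leLHS]mulrA -[leRHS]mulrA; apply: ler_wpM2r; last by rewrite lerDl.
  by rewrite divr_ge0// ltW.
apply: (@le_trans _ _ (Int (fun x => hump r (x + h) + hump r x))).
  apply: le_Int => //; first exact: ccfD.
  move=> x; apply: (le_trans (ler_normB _ _)).
  by rewrite !ger0_norm ?hump_ge0.
rewrite IntD// (Int_shift h cb) Int_hump//.
have : 1 <= `|h| / r by rewrite ler_pdivlMr// mul1r.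
move=> h1; rewrite -mulrA; nra.
Qed.

(** The centres [i / q - 5] fill the window [[-5, 5]] instead of the whole line, which keeps the
    comb compactly supported while it stays periodic on [[-4, 4]], far beyond the densities living
    on [[0, 1]]. The total mass is [(10 q + 1) / q <= 11], the origin of the constant 11 below. *)
Definition comb (q : nat) r x : R :=
  q%:R^-1 * \sum_(i < (10 * q).+1) hump r (x + (5 - i%:R / q%:R)).

Lemma comb_C11 q r : exists C, C11 C (comb q r).
Proof.
have [C hC] := @C11_sum R _ (index_enum 'I_(10 * q).+1)
  (fun i x => hump r (x + (5 - i%:R / q%:R))) (fun i => hump_shift_C11 r _).
by eexists; exact: C11Z hC.
Qed.

Lemma comb_ccf q r : 0 < r -> ccf (comb q r).
Proof.
by move=> r0; apply/ccfZ/ccf_sum => i; apply: ccf_shift; exact: hump_ccf.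
Qed.

Lemma comb_ge0 q r x : 0 < r -> 0 <= comb q r x.
Proof. by move=> r0; rewrite mulr_ge0// sumr_ge0// => i _; exact: hump_ge0. Qed.

Lemma count_le (q : nat) : (0 < q)%N -> q%:R^-1 * (10 * q).+1%:R <= (11 : R).
Proof.
move=> q0; rewrite mulrC ler_pdivrMr ?ltr0n// -natrM ler_nat; lia.
Qed.

Lemma Int_comb_le q r : (0 < q)%N -> 0 < r -> Int (comb q r) <= 11.
Proof.
move=> q0 r0; rewrite IntZ; last first.
  by apply: ccf_sum => i; apply: ccf_shift; exact: hump_ccf.
rewrite Int_sum; last by move=> i; apply: ccf_shift; exact: hump_ccf.
under eq_bigr do rewrite (Int_shift _ (hump_ccf r0)) Int_hump//.
by rewrite sumr_const card_ord; exact: count_le.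
Qed.

Lemma comb_variation : exists2 K : R, 0 < K & forall q r h, (0 < q)%N -> 0 < r ->
  Int (fun x => `|comb q r (x + h) - comb q r x|) <= K * `|h| / r.
Proof.
have [K K0 hK] := hump_variation; exists (11 * K); first by rewrite mulr_gt0.
move=> q r h q0 r0.
have cb := hump_ccf r0.
have cs b : ccf (fun x => `|hump r (x + b + h) - hump r (x + b)|).
  by apply/ccf_abs/ccfB; [apply: (ccf_shift b (F := fun x => hump r (x + h))); exact: ccf_shift|exact: ccf_shift].
have cc : ccf (fun x => q%:R^-1 * \sum_(i < (10 * q).+1)
   `|hump r (x + (5 - i%:R / q%:R) + h) - hump r (x + (5 - i%:R / q%:R))|).
  by apply/ccfZ/ccf_sum => i; exact: cs.
apply: (@le_trans _ _ (Int (fun x => q%:R^-1 * \sum_(i < (10 * q).+1)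
   `|hump r (x + (5 - i%:R / q%:R) + h) - hump r (x + (5 - i%:R / q%:R))|))).
  apply: le_Int => //.
    apply/ccf_abs/ccfB; last exact: comb_ccf.
    by apply: ccf_shift; exact: comb_ccf.
  move=> x; rewrite /comb -mulrBr normrM ger0_norm ?invr_ge0// ler_wpM2l ?invr_ge0//.
  rewrite -sumrB; apply: (le_trans (ler_norm_sum _ _ _)).
  by apply: ler_sum => i _; rewrite (addrAC x h).
rewrite IntZ; last by apply: ccf_sum => i; exact: cs.
rewrite Int_sum//.
have hi (i : 'I_(10 * q).+1) :
    Int (fun x => `|hump r (x + (5 - i%:R / q%:R) + h) - hump r (x + (5 - i%:R / q%:R))|)
    <= K * `|h| / r.
  rewrite (Int_shift (5 - i%:R / q%:R) (F := fun x => `|hump r (x + h) - hump r x|)).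
    exact: hK.
  by apply/ccf_abs/ccfB => //; exact: ccf_shift.
apply: (@le_trans _ _ (q%:R^-1 * \sum_(i < (10 * q).+1) (K * `|h| / r))).
  by rewrite ler_wpM2l ?invr_ge0// ler_sum.
rewrite sumr_const card_ord -[X in _ * X]mulr_natl.
rewrite (_ : 11 * K * `|h| / r = 11 * (K * `|h| / r)); last by ring.
rewrite [leLHS]mulrA; apply: ler_wpM2r; last exact: count_le.
by rewrite divr_ge0// ?mulr_ge0// ltW.
Qed.

(** Translation by [1/q] shifts the index by one. The two bumps left over sit at the ends of the
    window, at distance at least 1 from the points considered, and vanish there. *)
Lemma comb_periodic q r x : (0 < q)%N -> 0 < r -> r <= 2^-1 -> `|x| <= 4 ->
  comb q r (x + q%:R^-1) = comb q r x.
Proof.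
move=> q0 r0 r1 hx; rewrite /comb; congr (_ * _).
have q1 : q%:R^-1 <= 1 :> R by rewrite invf_le1 ?ltr0n// ler1n.
have q2 : 0 <= q%:R^-1 :> R by rewrite invr_ge0.
move: hx; rewrite ler_norml => /andP[x1 x2].
rewrite big_ord_recl [RHS]big_ord_recr/= [in LHS]hump_out//; last first.
  by rewrite mul0r subr0 ler_normr; apply/orP; left; lra.
rewrite [hump r (x + _)]hump_out//; last first.
  rewrite natrM mulfK ?pnatr_eq0 -?lt0n// ler_normr; apply/orP; right; lra.
rewrite add0r addr0; apply: eq_bigr => i _; congr hump.
by rewrite /= /bump/= add1n -natr1; field; rewrite pnatr_eq0 -lt0n.
Qed.

Lemma comb_support q r x : (0 < q)%N -> 0 < r -> comb q r x != 0 ->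
  exists2 i, (i < (10 * q).+1)%N & `|x - (i%:R / q%:R - 5)| <= r.
Proof.
move=> q0 r0 hx.
have [[i hi]|h] := pselect (exists i : 'I_(10 * q).+1, `|x - (i%:R / q%:R - 5)| <= r).
  by exists i.
move: hx; rewrite /comb big1 ?mulr0 ?eqxx// => i _; apply: hump_out => //.
rewrite leNgt; apply/negP => hi; apply: h; exists i.
by rewrite opprB ltW.
Qed.

End Hump.

(** * Fourier transform of a smooth function times a comb *)

Section Waves.
Context {R : realType}.
Implicit Types (f F : R -> R) (r xi th x h B C D : R).

Definition wave xi th x : R := cos (2 * pi * xi * x + th).

Lemma wave_le1 xi th x : `|wave xi th x| <= 1.
Proof. exact: cos_max. Qed.

Lemma wave_lipschitz xi th x y :
  `|wave xi th x - wave xi th y| <= 2 * pi * `|xi| * `|x - y|.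
Proof.
apply: (le_trans (cos_lipschitz _ _)).
rewrite (_ : _ - _ = 2 * pi * xi * (x - y)); last by ring.
by rewrite !normrM (ger0_norm (pi_ge0 _)) ger0_norm.
Qed.

Lemma wave_continuous xi th : continuous (wave xi th).
Proof. exact/lipschitz_continuous/wave_lipschitz. Qed.

Lemma waveD xi th x h : wave xi th (x + h) = wave xi (th + 2 * pi * xi * h) x.
Proof. by rewrite /wave; congr cos; ring. Qed.

Lemma wave_half xi th x : xi != 0 -> wave xi th (x + (2 * xi)^-1) = - wave xi th x.
Proof.
move=> xi0; rewrite /wave -cosDpi; congr cos.
by field.
Qed.

(** A product-to-sum formula: up to the factor [2 sin b], a wave is a difference of two waves with
    phases [2 b] apart. For [b = pi xi / q] that change of phase is a translation by [1/q]. *)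
Lemma wave_diff xi th b x :
  wave xi th x * (2 * sin b) =
  wave xi (th + pi / 2 - b) x - wave xi (th + pi / 2 - b + 2 * b) x.
Proof.
rewrite /wave.
set A := 2 * pi * xi * x + th.
rewrite (_ : 2 * pi * xi * x + (th + pi / 2 - b) = A + pi / 2 - b); last by rewrite /A; ring.
rewrite (_ : 2 * pi * xi * x + (th + pi / 2 - b + 2 * b) = A + pi / 2 + b); last by rewrite /A; ring.
by rewrite -(sinDpihalf A); move: (A + pi / 2) => a; rewrite cosB cosD; ring.
Qed.

Lemma ccf_wave F (G : R -> R) xi th : ccf F -> continuous G ->
  ccf (fun x => F x * G x * wave xi th x).
Proof. by move=> cF cG; apply: ccfM; [exact: ccfM|exact: wave_continuous]. Qed.

(* [oscb q r xi F B]: the Fourier transform at [xi] of [F] times the comb is at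
   most [B]; quantifying over the phase replaces the complex modulus. *)
Definition oscb (q : nat) r xi F B : Prop :=
  forall th, `|Int (fun x => comb q r x * F x * wave xi th x)| <= B.

Lemma oscb_sup q r xi F B : (0 < q)%N -> 0 < r -> continuous F ->
  (forall x, `|F x| <= B) -> oscb q r xi F (11 * B).
Proof.
move=> q0 r0 cF hB th.
have cc := comb_ccf q r0.
have B0 : 0 <= B by exact: le_trans (hB 0).
apply: (@le_trans _ _ (Int (fun x => B * comb q r x))).
  apply: le_normr_Int; [exact: ccf_wave|exact: ccfZ|].
  move=> x; rewrite (normrM (_ * _)) (normrM (comb q r x)) (ger0_norm (comb_ge0 _ _ r0)).
  rewrite (mulrC B) -mulrA.
  apply: ler_wpM2l; first exact: comb_ge0.
  by rewrite -[leRHS]mulr1; apply: ler_pM => //; exact: wave_le1.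
by rewrite IntZ// mulrC; apply: ler_wpM2r => //; exact: Int_comb_le.
Qed.

(** Translation by half a period changes the sign of the wave, so twice the integral equals the
    integral against the difference of the product [comb * F] and its translate. That difference
    falls either on the comb, which gains [1 / (r xi)], or on [F]; the 6 dominates half of the mass
    bound 11. *)
Lemma oscb_half : exists2 K : R, 0 < K & forall q r xi F B D,
  (0 < q)%N -> 0 < r -> 0 < xi -> continuous F -> (forall x, `|F x| <= B) ->
  (forall x, `|F (x + (2 * xi)^-1) - F x| <= D) ->
  oscb q r xi F (K * B / (r * xi) + 6 * D).
Proof.
have [K K0 hK] := @comb_variation R; exists K => // q r xi F B D q0 r0 xi0 cF hB hD th.
have B0 : 0 <= B by exact: le_trans (hB 0).
have D0 : 0 <= D by exact: le_trans (hD 0).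
set h := (2 * xi)^-1 in hD.
have h0 : 0 <= h by rewrite invr_ge0 mulr_ge0// ltW.
pose G x := comb q r x * F x.
have cc := comb_ccf q r0; have cch := ccf_shift h cc.
have cG : ccf G by exact: ccfM.
have cGh : ccf (fun x => G (x + h)) by exact: ccf_shift.
have cGw : ccf (fun x => G x * wave xi th x) by apply: ccfM => //; exact: wave_continuous.
have e1 : Int (fun x => G x * wave xi th x) = - Int (fun x => G (x + h) * wave xi th x).
  rewrite -(Int_shift h cGw) -mulN1r -IntZ; last by apply: ccfM => //; exact: wave_continuous.
  by congr Int; apply/funext => x; rewrite wave_half ?gt_eqF//; ring.
have e2 : 2 * Int (fun x => G x * wave xi th x) =
    Int (fun x => (G x - G (x + h)) * wave xi th x).
  rewrite (_ : (fun x => (G x - _) * _) = (fun x => G x * wave xi th x - G (x + h) * wave xi th x)).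
    rewrite IntB//; last by apply: ccfM => //; exact: wave_continuous.
    by rewrite mulr_natl mulr2n; congr (_ + _); exact: e1.
  by apply/funext => x; rewrite mulrBl.
have cv : ccf (fun x => `|comb q r (x + h) - comb q r x|) by exact/ccf_abs/ccfB.
have : `|Int (fun x => (G x - G (x + h)) * wave xi th x)| <=
    Int (fun x => B * `|comb q r (x + h) - comb q r x| + D * comb q r (x + h)).
  apply: le_normr_Int.
  - by apply: ccfM; [exact: ccfB|exact: wave_continuous].
  - exact: (ccfD (ccfZ B cv) (ccfZ D cch)).
  - move=> x; rewrite normrM; apply: (@le_trans _ _ (`|G x - G (x + h)| * 1)).
      by apply: ler_wpM2l => //; exact: wave_le1.
    rewrite mulr1 /G (_ : _ - _ = - (F x * (comb q r (x + h) - comb q r x))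
      - (F (x + h) - F x) * comb q r (x + h)); last by ring.
    apply: (le_trans (ler_normB _ _)); rewrite normrN.
    rewrite (normrM (F x)) (normrM (F _ - _)).
    rewrite (ger0_norm (comb_ge0 _ (x + h) r0)).
    apply: lerD; apply: ler_wpM2r => //; exact: comb_ge0.
rewrite -e2 (IntD (ccfZ B cv) (ccfZ D cch)) (IntZ B cv) (IntZ D cch).
rewrite (Int_shift h cc) normrM ger0_norm// => hle.
have := hK q r h q0 r0; rewrite ger0_norm// => /(ler_wpM2l B0) hv.
have hI := ler_wpM2l D0 (Int_comb_le q0 r0).
have e3 : B * (K * h / r) = 2^-1 * (K * B / (r * xi)).
  by rewrite /h; field; rewrite !gt_eqF.
have : 0 <= K * B / (r * xi) by rewrite divr_ge0 ?mulr_ge0// ltW.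
rewrite -/(G _); lra.
Qed.

(** The comb does not notice a translation by [1/q], so the wave difference of [wave_diff] can be
    moved entirely onto [F]. This is integration by parts along the period of the comb, the sine
    playing the part of the frequency. *)
Lemma oscb_shift q r xi F B : (0 < q)%N -> 0 < r -> r <= 2^-1 ->
  continuous F -> (forall x, 3 < `|x| -> F x = 0) ->
  sin (pi * xi / q%:R) != 0 ->
  oscb q r xi (fun x => F (x + q%:R^-1) - F x) B ->
  oscb q r xi F (B / (2 * `|sin (pi * xi / q%:R)|)).
Proof.
move=> q0 r0 r1 cF sF s0 hB th.
set b := pi * xi / q%:R in s0 *.
have cc := comb_ccf q r0.
have cFs : continuous (fun x => F (x + q%:R^-1)).
  move=> x; apply: (@continuous_comp _ _ _ (fun x => x + q%:R^-1) F); last exact: cF.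
  by apply: cvgD; [exact: cvg_id|exact: cvg_cst].
have cw t : ccf (fun x => comb q r x * F x * wave xi t x).
  exact: ccf_wave.
have cws t : ccf (fun x => comb q r x * F (x + q%:R^-1) * wave xi t x).
  exact: ccf_wave.
set t1 := th + pi / 2 - b.
have e1 : Int (fun x => comb q r x * F x * wave xi th x) * (2 * sin b) =
    Int (fun x => comb q r x * F x * wave xi t1 x)
    - Int (fun x => comb q r x * F x * wave xi (t1 + 2 * b) x).
  rewrite -IntB// mulrC -IntZ//; congr Int; apply/funext => x.
  by rewrite -mulrBr -wave_diff; ring.
have e2 : Int (fun x => comb q r x * F x * wave xi t1 x) =
    Int (fun x => comb q r x * F (x + q%:R^-1) * wave xi (t1 + 2 * b) x).
  rewrite -(Int_shift q%:R^-1 (cw t1)); congr Int; apply/funext => x.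
  (* Beyond 4 the truncated comb need not be periodic, but there [F (x + 1/q)] vanishes since
     [1/q <= 1]. *)
  have [hx|hx] := leP `|x| 4.
    rewrite comb_periodic// waveD; congr (_ * wave _ _ _).
    by rewrite /b; field; rewrite pnatr_eq0 -lt0n.
  rewrite sF ?mulr0 ?mul0r//.
  have q1 : q%:R^-1 <= 1 :> R by rewrite invf_le1 ?ltr0n// ler1n.
  have qi : 0 <= q%:R^-1 :> R by rewrite invr_ge0.
  have := ler_normB (x + q%:R^-1) q%:R^-1; rewrite addrK (ger0_norm qi).
  lra.
rewrite ler_pdivlMr ?mulr_gt0 ?normr_gt0//.
have -> : 2 * `|sin b| = `|2 * sin b| by rewrite normrM ger0_norm.
rewrite -normrM e1 e2 -IntB//.
rewrite (_ : (fun x => _ - _) = (fun x => comb q r x * (F (x + q%:R^-1) - F x) * wave xi (t1 + 2 * b) x)) //.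
by apply/funext => x; ring.
Qed.

(** Up to sign the sine has period [pi], so [xi] may be replaced by [xi - n]; the angle is then at
    most [pi / 2], and [t / 4 <= sin t] with [pi >= 2] gives the bound. *)
Lemma sin_dist_lower (q n : nat) xi : (0 < q)%N -> (q %| n)%N ->
  `|xi - n%:R| <= q%:R / 2 -> `|xi - n%:R| / q%:R <= 2 * `|sin (pi * xi / q%:R)|.
Proof.
move=> q0 /dvdnP[m ->] hd.
have qR : 0 < q%:R :> R by rewrite ltr0n.
set d := xi - _ in hd *.
have -> : `|sin (pi * xi / q%:R)| = `|sin (pi * d / q%:R)|.
  have -> : pi * xi / q%:R = pi * d / q%:R + m%:R * pi.
    by rewrite /d natrM; field; rewrite gt_eqF.
  move: (pi * d / q%:R) => u; elim: m {hd d} => [|m IH]; first by rewrite mul0r addr0.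
  by rewrite mulrSr mulrDl mul1r addrA sinDpi normrN.
have e : `|pi * d / q%:R| = pi * `|d| / q%:R.
  by rewrite !normrM normfV (ger0_norm (pi_ge0 _)) (gtr0_norm qR).
have h : `|pi * d / q%:R| <= pi / 2.
  rewrite e ler_pdivrMr// -mulrA ler_wpM2l ?pi_ge0// (le_trans hd)//; lra.
have := abs_sin_lower h; rewrite e => h1.
have p2 := @pi_ge2 R.
have dq : 0 <= `|d| / q%:R by rewrite divr_ge0// ltW.
by have := ler_wpM2r dq p2; lra.
Qed.

(** Four bounds are combined, with [t = r xi]: the trivial one ([N1]), one half-period translation
    for [1/t] ([N2]), a translation by [1/q] followed by a half period for [1/(d t)] ([N4]), and two
    translations by [1/q] for [1/d^2] ([N5]). The last two consume a second difference of [f], which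
    is why [C11] is required. The 14 covers the mass 11 and the 3 coming from the variation of
    [f]. *)
Lemma comb_fourier_bound : exists2 K : R, 0 < K & forall C f q r xi (n : nat),
  C11 C f -> (forall x, 1 < `|x| -> f x = 0) ->
  (0 < q)%N -> 0 < r -> r <= 2^-1 -> 0 < xi -> (q %| n)%N ->
  `|xi - n%:R| <= q%:R / 2 ->
  oscb q r xi f (K * C / (Num.max 1 `|xi - n%:R| *
                          Num.max (Num.max 1 `|xi - n%:R|) (r * xi))).
Proof.
have [K K0 hK] := oscb_half; exists (K + 14); first by rewrite addr_gt0.
move=> C f q r xi n hf sf q0 r0 r1 xi0 qn; set d := `|xi - n%:R| => hd.
have C0 := C11_ge0 hf; have cf := C11_continuous hf.
have [f0 f1 f2] := hf.
have d0 : 0 <= d by exact: normr_ge0.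
have qR : 0 < q%:R :> R by rewrite ltr0n.
have q1 : q%:R^-1 <= 1 :> R by rewrite invf_le1 ?ltr0n// ler1n.
have qi : 0 <= q%:R^-1 :> R by rewrite invr_ge0.
set t := r * xi; have t0 : 0 < t by exact: mulr_gt0.
have h0 : 0 <= (2 * xi)^-1 by rewrite invr_ge0 mulr_ge0// ltW.
have ht : 6 * (2 * xi)^-1 <= 3 / t.
  have -> : 6 * (2 * xi)^-1 = (3 * r) / t by rewrite /t; field; rewrite !gt_eqF.
  rewrite ler_wpM2r ?invr_ge0 ?(ltW t0)//; lra.
have weaken (F : R -> R) B B' : B <= B' -> oscb q r xi F B -> oscb q r xi F B'.
  by move=> BB h th; exact: le_trans (h th) BB.
have KC0 : 0 <= K * C by rewrite mulr_ge0// ltW.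
have N1 : oscb q r xi f ((K + 14) * C).
  apply: weaken (oscb_sup _ q0 r0 cf f0); nra.
have N2 : oscb q r xi f ((K + 14) * C / t).
  have := @hK q r xi f C (C * (2 * xi)^-1) q0 r0 xi0 cf f0.
  move=> /(_ _)/weaken; apply.
    have := ler_wpM2l C0 ht; rewrite -/t.
    have : 0 <= C / t by rewrite divr_ge0// ltW.
    lra.
  by move=> x; apply: le_trans (f1 _ _) _; rewrite ger0_norm.
have [d1|d1] := leP d 1.
  rewrite mul1r; have [tt|tt] := leP t 1; first by rewrite divr1.
  exact: N2.
have dp : 0 < d by apply: lt_trans d1.
have sl := sin_dist_lower q0 qn hd; rewrite -/d in sl.
have s0 : sin (pi * xi / q%:R) != 0.
  rewrite -normr_gt0 -(@pmulr_rgt0 _ 2)//; apply: lt_le_trans sl.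
  exact: divr_gt0.
have hshift (F : R -> R) (B : R) : continuous F -> (forall x, 3 < `|x| -> F x = 0) -> 0 <= B ->
    oscb q r xi (fun x => F (x + q%:R^-1) - F x) (B / q%:R) -> oscb q r xi F (B / d).
  move=> cF sF B0 /(oscb_shift q0 r0 r1 cF sF s0); apply: weaken.
  rewrite ler_pdivrMr; last by rewrite mulr_gt0// normr_gt0.
  have -> : B / q%:R = B / d * (d / q%:R) by field; rewrite !gt_eqF.
  by rewrite ler_wpM2l// divr_ge0.
have cD (F : R -> R) : continuous F -> continuous (fun x => F (x + q%:R^-1) - F x).
  move=> cF x; apply: cvgB; last exact: cF.
  apply: (@continuous_comp _ _ _ (fun x => x + q%:R^-1) F); last exact: cF.
  by apply: cvgD; [exact: cvg_id|exact: cvg_cst].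
have sD (F : R -> R) k : (forall x, k < `|x| -> F x = 0) ->
    (forall x, k + 1 < `|x| -> F (x + q%:R^-1) - F x = 0).
  move=> sF x hx.
  have hx' : k < `|x + q%:R^-1|.
    by have := ler_normB (x + q%:R^-1) q%:R^-1; rewrite addrK (ger0_norm qi); lra.
  by rewrite (sF _ hx') sF ?subrr//; lra.
have sf3 x : 3 < `|x| -> f x = 0 by move=> hx; apply: sf; lra.
have sdf x : 3 < `|x| -> f (x + q%:R^-1) - f x = 0.
  by move=> hx; apply: (sD f 1) => //; lra.
have df x : `|f (x + q%:R^-1) - f x| <= C / q%:R.
  by have := f1 x q%:R^-1; rewrite (ger0_norm qi).
have N4 : oscb q r xi f ((K + 14) * C / t / d).
  apply: hshift => //; first by rewrite divr_ge0 ?mulr_ge0 ?addr_ge0// ltW.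
  have := @hK q r xi _ (C / q%:R) (C / q%:R * (2 * xi)^-1) q0 r0 xi0 (cD _ cf) df.
  move=> /(_ _)/weaken; apply.
    have Cq : 0 <= C / q%:R by rewrite divr_ge0// ltW.
    have := ler_wpM2l Cq ht; rewrite -/t.
    have : 0 <= C / q%:R / t by rewrite divr_ge0// ltW.
    have -> : (K + 14) * C / t / q%:R = (K + 14) * (C / q%:R / t).
      by field; rewrite !gt_eqF.
    have -> : K * (C / q%:R) / t = K * (C / q%:R / t) by ring.
    lra.
  move=> x; have := f2 x (2 * xi)^-1 q%:R^-1.
  rewrite (ger0_norm h0) (ger0_norm qi).
  rewrite (_ : _ - _ - _ + _ = f (x + (2 * xi)^-1 + q%:R^-1) - f (x + (2 * xi)^-1) -
      (f (x + q%:R^-1) - f x)); last by ring.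
  by move=> /le_trans; apply; rewrite mulrAC.
have N5 : oscb q r xi f ((K + 14) * C / d / d).
  apply: (hshift f ((K + 14) * C / d)) => //; first by rewrite divr_ge0 ?mulr_ge0 ?addr_ge0// ltW.
  rewrite (_ : _ / d / q%:R = (K + 14) * C / q%:R / d); last by field; rewrite !gt_eqF.
  apply: (hshift (fun x => f (x + q%:R^-1) - f x) ((K + 14) * C / q%:R)); [exact: cD|by []|by rewrite divr_ge0 ?mulr_ge0 ?addr_ge0// ltW|].
  apply: (@weaken _ (11 * (C / q%:R / q%:R))).
    rewrite (_ : (K + 14) * C / q%:R / q%:R = (K + 14) * (C / q%:R / q%:R)); last by ring.
    by apply: ler_wpM2r; [rewrite !divr_ge0// ltW|lra].
  apply: oscb_sup => //; first exact/cD/cD.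
  move=> x; have := f2 x q%:R^-1 q%:R^-1; rewrite (ger0_norm qi) => h.
  by apply: le_trans h; rewrite le_eqVlt; apply/orP; left; apply/eqP; congr (`|_|); ring.
have [tt|tt] := leP t d; rewrite invfM.
  by move: N5; rewrite -!mulrA.
by move: N4; rewrite -!mulrA (mulrC t^-1).
Qed.

End Waves.

(** * The weighted sum over primes at a fixed frequency *)

Section ArithmeticSum.
Context {R : realType}.
Implicit Types (xi A t d : R) (q n : nat) (P : seq nat).

(** Rounding as the floor of [xi / q + 1/2]. For positive [q] and [xi] the value is 0 exactly when
    [xi < q / 2], a case that is treated separately below. *)
Definition nearest_multiple q xi : nat := (q * Num.truncn (xi / q%:R + 2^-1))%N.

Lemma nearest_multipleP q xi : (0 < q)%N -> 0 < xi ->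
  `|xi - (nearest_multiple q xi)%:R| <= q%:R / 2.
Proof.
move=> q0 xi0; have qR : 0 < q%:R :> R by rewrite ltr0n.
have h0 : 0 <= xi / q%:R + 2^-1 by rewrite addr_ge0// divr_ge0// ltW.
have := truncn_itv h0; rewrite /nearest_multiple; set m := Num.truncn _.
move=> /andP[h1 h2]; rewrite natrM.
have e : xi = (xi / q%:R) * q%:R by rewrite divfK// gt_eqF.
rewrite -[m.+1%:R]natr1 in h2; set y := xi / q%:R in h1 h2 e.
have h1' := ler_wpM2r (ltW qR) h1; have h2' := ler_wpM2r (ltW qR) (ltW h2).
rewrite e ler_norml; apply/andP; split; lra.
Qed.

(** The power d^(-3/2): of the available decay d^(-2), half a power is given away and the rest is
    still summable. *)
Definition decay d : R := (d * Num.sqrt d)^-1.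

Lemma decay_le d d' : 1 <= d -> d <= d' -> decay d' <= decay d.
Proof.
move=> d1 dd; have d0 : 0 < d by apply: lt_le_trans d1.
have d0' : 0 < d' by apply: lt_le_trans dd.
rewrite /decay lef_pV2 ?posrE ?mulr_gt0 ?sqrtr_gt0//.
by apply: ler_pM => //; [exact: ltW|rewrite ler_sqrt// ltW].
Qed.

Lemma decay_ge0 d : 0 <= d -> 0 <= decay d.
Proof. by move=> d0; rewrite invr_ge0 mulr_ge0// sqrtr_ge0. Qed.

Lemma decay_sum n : \sum_(j < n) decay (Num.max 1 j%:R) <= 4.
Proof.
have d1 : decay 1 = 1 by rewrite /decay sqrtr1 mulr1 invr1.
have d01 : Num.max 1 0%:R = 1 :> R by rewrite max_l.
(* The integral test in telescoping form, -2/sqrt(x) being a primitive of x^(-3/2). The terms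
   [j = 0] and [j = 1] are both 1, so equality holds at the start. *)
have key m : \sum_(j < m.+2) decay (Num.max 1 j%:R) <= 4 - 2 / Num.sqrt m.+1%:R.
  elim: m => [|m IH].
    by rewrite !big_ord_recr big_ord0/= d01 sqrtr1 maxxx d1; lra.
  rewrite big_ord_recr/=; have -> : Num.max 1 m.+2%:R = m.+2%:R :> R.
    by apply: max_r; rewrite ler1n.
  apply: (le_trans (lerD IH (lexx _))).
  set a := Num.sqrt m.+1%:R; set b := Num.sqrt m.+2%:R.
  have a0 : 0 < a by rewrite sqrtr_gt0 ltr0n.
  have b0 : 0 < b by rewrite sqrtr_gt0 ltr0n.
  have aE : a ^+ 2 = m.+1%:R by rewrite sqr_sqrtr// ler0n.
  have bE : b ^+ 2 = m.+2%:R by rewrite sqr_sqrtr// ler0n.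
  have ab : b ^+ 2 = a ^+ 2 + 1 by rewrite aE bE natr1.
  have le_ab : a <= b by rewrite /a /b ler_sqrt ?ler_nat// ler0n.
  rewrite /decay -/b -bE.
  suff : (b ^+ 2 * b)^-1 <= 2 / a - 2 / b by lra.
  have -> : 2 / a - 2 / b = 2 / (a * b * (a + b)).
    have h : b - a = (a + b)^-1.
      apply: (@mulIf _ (a + b)); first by rewrite gt_eqF// addr_gt0.
      by rewrite mulVf ?gt_eqF ?addr_gt0//; nra.
    have -> : 2 / a - 2 / b = 2 * (b - a) / (a * b) by field; rewrite !gt_eqF.
    by rewrite h; field; rewrite !gt_eqF// addr_gt0.
  have -> : 2 / (a * b * (a + b)) = (a * b * (a + b) / 2)^-1 by rewrite invf_div.
  rewrite lef_pV2 ?posrE ?divr_gt0 ?mulr_gt0 ?addr_gt0 ?exprn_gt0//.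
  have : a * b <= b ^+ 2 by rewrite expr2 ler_wpM2r// ltW.
  have : a + b <= 2 * b by lra.
  move=> h1 h2; have := ler_pM (ltW (mulr_gt0 a0 b0)) (ltW (addr_gt0 a0 b0)) h2 h1.
  lra.
case: n => [|[|n]]; first by rewrite big_ord0.
  by rewrite big_ord_recr big_ord0/= d01 d1; lra.
apply: (le_trans (key n)); rewrite gerBl divr_ge0// sqrtr_ge0.
Qed.

Lemma decay_dist_sum n xi : 0 <= xi ->
  \sum_(j < n) decay (Num.max 1 `|xi - j%:R|) <= 8.
Proof.
move=> xi0; pose m := Num.truncn xi.
have /andP[m1 m2] := truncn_itv xi0; rewrite -/m -[m.+1%:R]natr1 in m1 m2.
have ge1 (x : R) : 1 <= Num.max 1 x by rewrite le_max lexx.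
have pos (x : R) : 0 <= decay (Num.max 1 x).
  by apply: decay_ge0; apply: le_trans (ge1 x).
pose F j := decay (Num.max 1 `|xi - j%:R|).
have ext : \sum_(j < n) F j <= \sum_(j < m.+1 + n) F j.
  rewrite addnC big_split_ord/= lerDl; apply: sumr_ge0 => i _; exact: pos.
apply: (le_trans ext); rewrite big_split_ord/=.
have -> : 8 = 4 + 4 :> R by ring.
apply: lerD.
  rewrite (reindex_inj rev_ord_inj)/=; apply: le_trans (decay_sum m.+1).
  apply: ler_sum => i _; apply: decay_le => //.
  rewrite ge_max ge1/= le_max; apply/orP; right.
  have im : (i <= m)%N by have := ltn_ord i; rewrite ltnS.
  apply: le_trans (ler_norm _); rewrite subSS (natrB _ im); lra.
apply: le_trans (decay_sum n); apply: ler_sum => i _; apply: decay_le => //.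
rewrite ge_max ge1/= le_max; apply/orP; right.
by rewrite natrD -natr1 distrC; apply: le_trans (ler_norm _); lra.
Qed.

(** Otherwise [4 kap] such primes have a product [p <= n <= 2 xi], and multiplying their
    inequalities gives [1 <= p ^ 4 * A ^ (4 kap)]. But the right side is less than 1, because
    [A ^ (4 kap) < (2 xi) ^ -4]. *)
Lemma few_prime_divisors P n xi A kap : uniq P -> (forall q, q \in P -> prime q) ->
  0 < A -> A ^+ kap < (2 * xi)^-1 -> 0 < xi -> (0 < n)%N -> n%:R <= 2 * xi ->
  (forall q, q \in P -> 1 <= q%:R ^+ 4 * A) ->
  (count (fun q => q %| n) P <= 4 * kap)%N.
Proof.
move=> uP pP A0 hA xi0 n0 nxi hP; rewrite leqNgt; apply/negP => hc.
pose l := take (4 * kap) [seq q <- P | (q %| n)%N].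
have sl : size l = (4 * kap)%N by rewrite size_takel// size_filter ltnW.
have lP q : q \in l -> q \in P /\ (q %| n)%N.
  by move=> /mem_take; rewrite mem_filter => /andP[].
have ul : uniq l by rewrite take_uniq// filter_uniq.
have hprod : (\prod_(q <- l) q <= n)%N.
  by apply: prod_primes_leq => // q /lP[/pP].
have h1 : 1 <= (\prod_(q <- l) (q%:R : R)) ^+ 4 * A ^+ size l.
  elim: l {sl ul hprod} lP => [|q l IH] lP; first by rewrite big_nil expr1n mul1r.
  rewrite big_cons exprMn /= (exprS A).
  have [qP _] := lP q (mem_head _ _).
  have : 1 <= (\prod_(q <- l) (q%:R : R)) ^+ 4 * A ^+ size l.
    by apply: IH => z zl; apply: lP; rewrite inE zl orbT.
  have := hP q qP; move: (\prod_(j <- l) _) => p a1 b1.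
  rewrite [leRHS](_ : _ = (q%:R ^+ 4 * A) * (p ^+ 4 * A ^+ size l)); last by ring.
  exact: mulr_ege1.
have h2 : \prod_(q <- l) (q%:R : R) <= 2 * xi.
  by rewrite -natr_prod; apply: le_trans nxi; rewrite ler_nat.
have p0 : 0 <= \prod_(q <- l) (q%:R : R) by rewrite prodr_ge0.
have xx : 0 < 2 * xi by rewrite mulr_gt0.
have h3 : (\prod_(q <- l) (q%:R : R)) ^+ 4 <= (2 * xi) ^+ 4 by rewrite lerXn2r ?nnegrE ?(ltW xx).
have h4 : A ^+ size l < (2 * xi) ^- 4.
  by rewrite sl mulnC exprM -exprVn ltrXn2r ?nnegrE ?exprn_ge0 ?invr_ge0 ?(ltW xx) ?(ltW A0).
have h5 : 0 < A ^+ size l by rewrite exprn_gt0.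
have h6 : (2 * xi) ^+ 4 * A ^+ size l < 1.
  have := h4; rewrite -(ltr_pM2l (exprn_gt0 4 xx)) divff// gt_eqF// exprn_gt0//.
have := ler_wpM2r (ltW h5) h3.
lra.
Qed.

(** With [u] the fourth root of [A], there are at most [1/u] such [q] and each term is at most
    [u ^ 3], for a total of [u ^ 2]. *)
Lemma sum_small_q P A : uniq P -> (forall q, q \in P -> (0 < q)%N) -> 0 < A ->
  \sum_(q <- P | q%:R ^+ 4 * A < 1) (q%:R * A) <= Num.sqrt A.
Proof.
move=> uP P0 A0.
pose s := Num.sqrt A; pose u := Num.sqrt s.
have s0 : 0 < s by rewrite sqrtr_gt0.
have u0 : 0 < u by rewrite sqrtr_gt0.
have sE : u ^+ 2 = s by rewrite sqr_sqrtr// ltW.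
have AE : A = u ^+ 4.
  by rewrite (_ : 4%N = (2 * 2)%N)// exprM sE sqr_sqrtr// ltW.
have hq q : q%:R ^+ 4 * A < 1 -> q%:R * u < 1.
  move=> h; rewrite ltNge; apply/negP => h1.
  have : 1 <= (q%:R * u) ^+ 4 by rewrite exprn_ege1.
  by rewrite exprMn -AE leNgt h.
rewrite -big_filter; set l := [seq q <- P | q%:R ^+ 4 * A < 1].
have ul : uniq l by rewrite filter_uniq.
have hl q : q \in l -> (0 < q)%N /\ q%:R * u < 1.
  by rewrite mem_filter => /andP[/hq h /P0].
have sz : (size l)%:R * u <= 1.
  pose N := Num.truncn u^-1.
  have ui : 0 <= u^-1 by rewrite invr_ge0 ltW.
  have /andP[N1 _] := truncn_itv ui; rewrite -/N in N1.
  have : (size l <= N)%N.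
    rewrite -(size_iota 1 N); apply: uniq_leq_size => // q /hl[q0 qu].
    rewrite mem_iota q0 add1n ltnS /N truncn_ge_nat//.
    by rewrite -[leRHS]mul1r ler_pdivlMr// ltW.
  rewrite -(ler_nat R) => h; apply: (@le_trans _ _ (u^-1 * u)).
    by rewrite ler_wpM2r ?(ltW u0)// (le_trans h).
  by rewrite mulVf// gt_eqF.
apply: (@le_trans _ _ (\sum_(q <- l) u ^+ 3)).
  rewrite big_seq [leRHS]big_seq; apply: ler_sum => q /hl[_ qu].
  rewrite AE (_ : q%:R * u ^+ 4 = (q%:R * u) * u ^+ 3); last by ring.
  by rewrite -[leRHS]mul1r ler_wpM2r ?exprn_ge0 ?(ltW u0)// ltW.
rewrite big_const_seq count_predT iter_addr_0 -mulr_natl -/s -sE.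
rewrite (_ : _ * _ = (size l)%:R * u * u ^+ 2); last by ring.
by rewrite -[leRHS]mul1r ler_wpM2r// exprn_ge0// ltW.
Qed.

Definition mdist q xi : R := Num.max 1 `|xi - (nearest_multiple q xi)%:R|.

(** Three classes of primes: those with nearest multiple 0, where [mdist >= xi] gives the first
    term; those with [q ^ 4 * A < 1], which give the 8; and the rest, which give
    [96 kap = 3 * (4 kap) * 8], from the factor 3 below, the prime divisor count and the decay sum.
    The conditional will matter: the square root term appears only once [2 xi] reaches some prime of
    [P]. *)
Lemma arithmetic_sum P (r : nat -> R) xi A kap : uniq P ->
  (forall q, q \in P -> prime q) -> 0 < A -> A ^+ kap < (2 * xi)^-1 -> 0 < xi ->
  (forall q, q \in P -> 1 <= 8 * (q%:R ^+ 2 * A) * Num.max 1 (r q * xi)) ->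
  \sum_(q <- P) (q%:R^-1 * (mdist q xi * Num.max (mdist q xi) (r q * xi))^-1) <=
  (\sum_(q <- P) q%:R^-1) / xi +
  (if has (fun q => q%:R <= 2 * xi) P then (8 + 96 * kap%:R) * Num.sqrt A else 0).
Proof.
move=> uP pP A0 hA xi0 hr.
pose T q := q%:R^-1 * ((mdist q xi) * Num.max ((mdist q xi)) (r q * xi))^-1.
have d1 q : 1 <= mdist q xi by rewrite le_max lexx.
have d0 q : 0 < (mdist q xi) by apply: lt_le_trans (d1 q).
have m1 q : 1 <= Num.max ((mdist q xi)) (r q * xi) by rewrite le_max d1.
have m0 q : 0 < Num.max ((mdist q xi)) (r q * xi) by apply: lt_le_trans (m1 q).
have T0 q : 0 <= T q by rewrite mulr_ge0// ?invr_ge0// mulr_ge0// ltW.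
have s0 : 0 <= Num.sqrt A by exact: sqrtr_ge0.
have P0 q : q \in P -> (0 < q)%N by move=> /pP/prime_gt0.
(* A non-zero nearest multiple lies between [q] and [2 xi], so this class is empty when all primes
   exceed [2 xi]. *)
pose nz q := nearest_multiple q xi != 0%N.
have nzq q : (0 < q)%N -> nz q ->
    [/\ (0 < nearest_multiple q xi)%N, (nearest_multiple q xi)%:R <= 2 * xi & q%:R <= 2 * xi].
  move=> q0 hn; have n0 : (0 < nearest_multiple q xi)%N by rewrite lt0n.
  have := nearest_multipleP q0 xi0; rewrite ler_norml => /andP[h1 h2].
  have h3 : q%:R <= (nearest_multiple q xi)%:R :> R.
    rewrite ler_nat; apply: dvdn_leq => //; exact: dvdn_mulr.
  by split => //; lra.
rewrite (bigID nz)/= addrC; apply: lerD.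
  rewrite mulr_suml [leLHS]big_mkcond/= big_seq [leRHS]big_seq.
  apply: ler_sum => q qP; have q0 : 0 < q%:R :> R by rewrite ltr0n P0.
  case: ifPn => [|_]; last by rewrite mulr_ge0 ?invr_ge0 ?(ltW q0)// ltW.
  rewrite negbK => /eqP n0.
  rewrite ler_wpM2l ?invr_ge0 ?(ltW q0)//.
  rewrite lef_pV2 ?posrE ?mulr_gt0//.
  apply: (@le_trans _ _ ((mdist q xi))); last by rewrite ler_peMr// ltW.
  by rewrite /mdist n0 subr0 (gtr0_norm xi0) le_max lexx orbT.
have [hh|/hasPn hh] := ifPn; last first.
  rewrite big_seq_cond big_pred0// => q; apply/negP => /andP[qP hn].
  by have [_ _] := nzq q (P0 q qP) hn; apply/negP; exact: hh.
pose small q := q%:R ^+ 4 * A < 1.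
rewrite (bigID small)/= mulrDl; apply: lerD.
  apply: (@le_trans _ _ (8 * \sum_(q <- P | q%:R ^+ 4 * A < 1) (q%:R * A))).
    rewrite mulr_sumr [leLHS]big_mkcond [leRHS]big_mkcond big_seq [leRHS]big_seq.
    apply: ler_sum => q qP; have q0 : 0 < q%:R :> R by rewrite ltr0n P0.
    rewrite -/(small q); case: (small q); rewrite ?andbF// andbT.
    have h0 : 0 <= 8 * (q%:R * A) by rewrite !mulr_ge0// ltW.
    case: ifP => // _.
    have t1 : 1 <= Num.max 1 (r q * xi) by rewrite le_max lexx.
    have t0 : 0 < Num.max 1 (r q * xi) by apply: lt_le_trans t1.
    apply: (@le_trans _ _ (q%:R^-1 * (Num.max 1 (r q * xi))^-1)).
      rewrite ler_wpM2l ?invr_ge0 ?(ltW q0)// lef_pV2 ?posrE ?mulr_gt0//.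
      apply: (@le_trans _ _ (Num.max ((mdist q xi)) (r q * xi))); last by rewrite ler_peMl// ltW.
      by rewrite ge_max m1/= le_max lexx orbT.
    rewrite -invfM -[leLHS]mul1r ler_pdivrMr ?mulr_gt0//.
    apply: le_trans (hr q qP) _; rewrite le_eqVlt; apply/orP; left; apply/eqP.
    by ring.
  by rewrite ler_wpM2l//; exact: sum_small_q.
pose N := (Num.truncn (2 * xi)).+1.
pose L := [seq q <- P | nz q && ~~ small q].
apply: (@le_trans _ _ (\sum_(q <- L) (3 * Num.sqrt A * decay ((mdist q xi))))).
  rewrite -big_filter -/L big_seq [leRHS]big_seq; apply: ler_sum => q.
  rewrite mem_filter => /andP[/andP[hn hs] qP].
  have q0 : 0 < q%:R :> R by rewrite ltr0n P0.
  set t := Num.max 1 (r q * xi).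
  have t1 : 1 <= t by rewrite le_max lexx.
  have t0 : 0 < t by apply: lt_le_trans t1.
  set m := Num.max ((mdist q xi)) (r q * xi); have mp : 0 < m by exact: m0.
  have mt : t <= m by rewrite ge_max m1/= le_max lexx orbT.
  have md : (mdist q xi) <= m by rewrite le_max lexx.
  (* A maximum dominates the geometric mean: the root of [mdist] completes the power 3/2 of [decay],
     and the root of [t] pays for the square root of [A]. *)
  have ms : Num.sqrt ((mdist q xi)) * Num.sqrt t <= m.
    rewrite -(sqr_sqrtr (ltW mp)) expr2; apply: ler_pM; rewrite ?sqrtr_ge0//.
      by rewrite ler_sqrt// ltW.
    by rewrite ler_sqrt// ltW.
  have st0 : 0 < Num.sqrt t by rewrite sqrtr_gt0.
  have sd0 : 0 < Num.sqrt ((mdist q xi)) by rewrite sqrtr_gt0.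
  apply: (@le_trans _ _ (q%:R^-1 * ((mdist q xi) * (Num.sqrt ((mdist q xi)) * Num.sqrt t))^-1)).
    rewrite ler_wpM2l ?invr_ge0 ?(ltW q0)// lef_pV2 ?posrE ?mulr_gt0//.
    by rewrite ler_wpM2l// ltW.
  (* The square root of the hypothesis [hr], with 3 in place of the root of 8. *)
  have h : 1 <= 3 * (q%:R * Num.sqrt A) * Num.sqrt t.
    rewrite leNgt; apply/negP => h1.
    have := hr q qP; rewrite -/t => h2.
    set z := 3 * (q%:R * Num.sqrt A) * Num.sqrt t in h1.
    have z0 : 0 <= z by rewrite !mulr_ge0// ltW.
    have zE : z ^+ 2 = 9 * (q%:R ^+ 2 * A) * t.
      rewrite /z !exprMn (sqr_sqrtr (ltW t0)) (sqr_sqrtr (ltW A0)); ring.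
    have h3 : 0 <= q%:R ^+ 2 * A * t by rewrite !mulr_ge0 ?exprn_ge0// ltW.
    have h4 : z ^+ 2 < 1 by rewrite expr_lt1.
    lra.
  rewrite /decay mulrA !invfM [leLHS](_ : _ = (q%:R * Num.sqrt t)^-1 * (((mdist q xi))^-1 * (Num.sqrt ((mdist q xi)))^-1)); last first.
    by rewrite invfM; ring.
  rewrite ler_wpM2r ?mulr_ge0 ?invr_ge0 ?(ltW sd0) ?(ltW (d0 q))//.
  rewrite -[leLHS]mul1r ler_pdivrMr ?mulr_gt0//; lra.
rewrite -mulr_sumr.
(* Each prime is charged to its nearest multiple [n]. After exchanging the sums, every [n <= 2 xi]
   is charged at most [4 kap] times, and the decay over all [n] sums to at most 8. *)
have : \sum_(q <- L) decay ((mdist q xi)) <= 32 * kap%:R.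
  pose cost n : R := decay (Num.max 1 `|xi - n%:R|).
  have cost0 n : 0 <= cost n by apply: decay_ge0; rewrite le_max ler01.
  apply: (@le_trans _ _ (\sum_(q <- L) \sum_(n < N | (0 < n)%N && (q %| n)%N) cost n)).
    rewrite big_seq [leRHS]big_seq; apply: ler_sum => q.
    rewrite mem_filter => /andP[/andP[hn hs] qP].
    have [n0 nxi _] := nzq q (P0 q qP) hn.
    have nN : (nearest_multiple q xi < N)%N.
      by rewrite /N ltnS truncn_ge_nat// mulr_ge0// ltW.
    rewrite (bigD1 (Ordinal nN))/= ?n0 ?dvdn_mulr// lerDl sumr_ge0//.
  rewrite (exchange_big_dep (fun n : 'I_N => (0 < n)%N))/=; last by move=> q n _ /andP[].
  apply: (@le_trans _ _ (\sum_(n < N) 4 * kap%:R * cost n)).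
    rewrite [leLHS]big_mkcond/=; apply: ler_sum => n _.
    case: ifPn => n0; last by rewrite !mulr_ge0.
    rewrite -big_filter big_const_seq count_predT iter_addr_0 -[leLHS]mulr_natl.
    rewrite ler_wpM2r// -natrM ler_nat size_filter.
    have nxi : n%:R <= 2 * xi.
      have := ltn_ord n; rewrite /N ltnS truncn_ge_nat//.
      by rewrite mulr_ge0// ltW.
    apply: (@leq_trans (count (fun q => q %| n)%N L)).
      by apply: sub_count => q /andP[].
    apply: (few_prime_divisors _ _ A0 hA xi0 n0 nxi).
    - by rewrite filter_uniq.
    - by move=> q; rewrite mem_filter => /andP[_ /pP].
    - by move=> q; rewrite mem_filter => /andP[/andP[_]]; rewrite /small -leNgt.
  rewrite -mulr_sumr; have := decay_dist_sum N (ltW xi0).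
  have k0 : 0 <= 4 * kap%:R :> R by rewrite mulr_ge0.
  move=> /(ler_wpM2l k0) /le_trans; apply; lra.
have := s0; nra.
Qed.

End ArithmeticSum.

(** * The dimension function and its generalized inverse *)

Section DimensionFunction.
Context {R : realType}.
Implicit Types (alpha : R -> R) (psi : nat -> R).

(** A ratio at most 1 raised to a power below 1 is at least the ratio itself. So alpha(x)/x is
    non-increasing near 0, the form in which the condition on [rho] is used. *)
Lemma alpha_ratio alpha (rho : R) : dimension_function alpha -> rho < 1 ->
  (exists2 x0 : R, 0 < x0 & forall x1 x2 : R, 0 < x1 -> x1 < x2 -> x2 < x0 ->
     (x1 / x2) `^ rho <= alpha x1 / alpha x2) ->
  exists2 x0 : R, 0 < x0 & forall x1 x2 : R, 0 < x1 -> x1 <= x2 -> x2 < x0 ->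
     x1 * alpha x2 <= x2 * alpha x1.
Proof.
move=> [apos _ _] rho1 [x0 x00 h]; exists x0 => // x1 x2 x1p.
rewrite le_eqVlt => /predU1P[->//|x12] x2x.
have x2p : 0 < x2 by exact: lt_trans x12.
have hx : 0 < x1 / x2 <= 1 by rewrite divr_gt0//= ler_pdivrMr// mul1r ltW.
have := h x1 x2 x1p x12 x2x.
have := ger_powR hx (ltW rho1); rewrite powRr1; last by case/andP: hx => /ltW.
move=> h1 h2; have := le_trans h1 h2.
by rewrite ler_pdivlMr ?apos// mulrAC ler_pdivrMr// (mulrC x2).
Qed.

(** The limit gives alpha(x) < x^(nu/2) for small [x]; with [kap > 4 / nu] the power is at most x^2,
    which is less than x/2 once [x <= 1/3]. *)
Lemma alpha_power alpha (nu : R) : dimension_function alpha ->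
  ln (alpha x) / ln x @[x --> 0^'+] --> nu -> 0 < nu ->
  exists (kap : nat) (X : R), 0 < X /\ forall xi, X <= xi ->
    alpha xi^-1 ^+ kap < (2 * xi)^-1.
Proof.
move=> [apos _ _] hnu nu0.
have nu2 : nu / 2 < nu by lra.
have [d /= d0 hd] := @cvgr_gt _ _ _ _ _ _ hnu _ nu2.
pose kap := (Num.truncn (4 / nu)).+1.
have hk : 2 <= kap%:R * (nu / 2).
  have h0 : 0 <= 4 / nu by rewrite divr_ge0// ltW.
  have /andP[_ h1] := truncn_itv h0.
  have := ltW h1; rewrite -/kap ler_pdivrMr//; lra.
exists kap, (Num.max 3 (2 / d)); split; first by rewrite lt_max ltr0n.
move=> xi; rewrite ge_max => /andP[xi3 xid].
have xi0 : 0 < xi by lra.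
have xd : xi^-1 < d.
  rewrite invf_plt ?posrE//; apply: lt_le_trans xid.
  by rewrite ltr_pdivlMr// mulVf ?gt_eqF//; lra.
set x := xi^-1 in xd *; have x0 : 0 < x by rewrite invr_gt0.
have x3 : x <= 3^-1 by rewrite lef_pV2 ?posrE.
have lnx : ln x < 0 by rewrite ln_lt0// x0/=; lra.
have : nu / 2 < ln (alpha x) / ln x.
  by apply: hd => //=; rewrite sub0r normrN gtr0_norm.
rewrite ltr_ndivlMr// => h1.
have -> : (2 * xi)^-1 = x / 2 by rewrite invfM mulrC.
have A0 : 0 < alpha x by exact: apos.
apply: (@le_lt_trans _ _ (x ^+ 2)); last by nra.
rewrite -ler_ln ?posrE ?exprn_gt0// !lnXn//.
rewrite -[leLHS]mulr_natl -[leRHS]mulr_natl.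
have k0 : 0 < kap%:R :> R by rewrite ltr0n.
apply: (@le_trans _ _ (kap%:R * (nu / 2 * ln x))).
  by rewrite ler_wpM2l ?(ltW k0)// ltW.
by rewrite mulrA ler_wnM2r// ltW.
Qed.

(** As [alpha] may jump, nothing is said about its value at [psi q]: it is below [q ^- 2] strictly
    to the left, and reaches that level at some point closer than [2 psi q]. The infimum is positive
    because [alpha] tends to 0. *)
Lemma ginv_facts alpha psi : dimension_function alpha ->
  (\forall q \near \oo, psi q = ginv alpha (q%:R ^- 2)) ->
  forall d : R, 0 < d -> exists2 Q, (0 < Q)%N & forall q, (Q <= q)%N ->
  [/\ 0 < psi q, psi q <= d, forall y, 0 < y -> y < psi q -> alpha y < q%:R ^- 2 &
      exists x, [/\ psi q <= x, x < 2 * psi q & q%:R ^- 2 <= alpha x] ].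
Proof.
move=> [apos amono acvg] [N _ hN] d d0.
have ad := apos d d0.
pose Q := maxn N (Num.truncn (alpha d)^-1).+1.
exists Q => [|q Qq]; first by rewrite /Q leq_max orbT.
have Nq : (N <= q)%N by apply: leq_trans Qq; rewrite leq_maxl.
have q0 : (0 < q)%N by apply: leq_trans Qq; rewrite leq_max orbT.
have qR : 0 < q%:R :> R by rewrite ltr0n.
have q1 : 1 <= q%:R :> R by rewrite ler1n.
set t := q%:R ^- 2; have t0 : 0 < t by rewrite invr_gt0 exprn_gt0.
have td : t <= alpha d.
  rewrite /t invf_ple ?posrE ?exprn_gt0//.
  apply: (@le_trans _ _ q%:R); last by rewrite expr2 ler_peMr// ltW.
  have h0 : 0 <= (alpha d)^-1 by rewrite invr_ge0 ltW.
  have /andP[_ /ltW h1] := truncn_itv h0.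
  apply: (le_trans h1); rewrite ler_nat; apply: leq_trans Qq; exact: leq_maxr.
rewrite hN// -/t /ginv; set S := [set x | _].
have Sd : S d by split.
have [e /= e0 he] := @cvgr_lt _ _ _ _ _ _ acvg _ t0.
have lbS : lbound S (e / 2).
  move=> x [x0 tx]; rewrite leNgt; apply/negP => xe.
  have : alpha x < t.
    by apply: he => //=; rewrite sub0r normrN gtr0_norm//; lra.
  by rewrite ltNge tx.
have hS : has_inf S by split; [exists d|exists (e / 2)].
have i0 : 0 < inf S.
  by apply: (@lt_le_trans _ _ (e / 2)); [lra|apply: lb_le_inf => //; exists d].
split => //.
- by apply: ge_inf => //; case: hS.
- move=> y y0 yi; rewrite ltNge; apply/negP => ty.
  have : inf S <= y by apply: ge_inf; [by case: hS|split].
  by rewrite leNgt yi.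
- have [x [x0 tx] xi] := inf_adherent i0 hS.
  exists x; split => //; last by lra.
  by apply: ge_inf; [by case: hS|split].
Qed.

(** If [x <= 1/xi], monotonicity of [alpha] gives alpha(1/xi) >= q^-2. Otherwise monotonicity of
    alpha(x)/x gives alpha(1/xi) >= alpha(x)/(x xi), and [x < 2 pq = 8 (pq / 4)] produces the
    constant 8. *)
Lemma radius_bound alpha (x0 xi pq x : R) (q : nat) : dimension_function alpha ->
  (forall x1 x2 : R, 0 < x1 -> x1 <= x2 -> x2 < x0 -> x1 * alpha x2 <= x2 * alpha x1) ->
  (0 < q)%N -> 0 < xi -> 0 < pq -> 2 * pq <= x0 ->
  pq <= x -> x < 2 * pq -> q%:R ^- 2 <= alpha x ->
  1 <= 8 * (q%:R ^+ 2 * alpha xi^-1) * Num.max 1 (pq / 4 * xi).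
Proof.
move=> [apos amono _] ar q0 xi0 p0 px0 px x2 qx.
have qR : 0 < q%:R :> R by rewrite ltr0n.
have xp : 0 < x by exact: lt_le_trans px.
have xip : 0 < xi^-1 by rewrite invr_gt0.
have A0 := apos _ xip.
have q2 : 0 < q%:R ^+ 2 :> R by rewrite exprn_gt0.
have h1 : 1 <= q%:R ^+ 2 * alpha x by rewrite mulrC -ler_pdivrMr// mul1r.
set A := alpha xi^-1 in A0 *.
have qA : 0 < q%:R ^+ 2 * A by exact: mulr_gt0.
have [h|h] := leP x xi^-1.
  have h2 : 1 <= q%:R ^+ 2 * A.
    by apply: (le_trans h1); rewrite ler_wpM2l ?(ltW q2)//; exact: amono.
  have : 1 <= Num.max 1 (pq / 4 * xi) by rewrite le_max lexx.
  nra.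
have := ar _ _ xip (ltW h) (lt_le_trans x2 px0); rewrite -/A.
rewrite mulrC ler_pdivrMr// => h2.
apply: (@le_trans _ _ (8 * (q%:R ^+ 2 * A) * (pq / 4 * xi))); last first.
  by rewrite ler_wpM2l// ?mulr_ge0 ?(ltW q2) ?(ltW A0)// le_max lexx orbT.
apply: (le_trans h1).
rewrite [leRHS](_ : _ = q%:R ^+ 2 * (2 * pq * A * xi)); last by field.
rewrite ler_wpM2l ?(ltW q2)//; apply: (le_trans h2).
apply: ler_wpM2r; first exact: ltW.
by apply: ler_wpM2r; exact: ltW.
Qed.

(** The radius [psi q / 4] confines each bump to an interval of length [psi q / 2]. This is strictly
    below [psi q], hence in the range where [alpha] is less than [q ^- 2]. *)
Definition gcomb P psi (x : R) : R :=
  (\sum_(q <- P) q%:R^-1)^-1 * \sum_(q <- P) q%:R^-1 * comb q (psi q / 4) x.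

(** Dividing [arithmetic_sum] by the total weight frees the [1/xi] term of it. Only the square root
    term keeps the large factor one over that weight, and it is confined to frequencies beyond half
    the smallest prime. *)
Lemma high_frequency alpha psi nu rho : dimension_function alpha ->
  ln (alpha x) / ln x @[x --> 0^'+] --> nu -> 0 < nu -> rho < 1 ->
  (exists2 x0 : R, 0 < x0 & forall x1 x2 : R, 0 < x1 -> x1 < x2 -> x2 < x0 ->
     (x1 / x2) `^ rho <= alpha x1 / alpha x2) ->
  (\forall q \near \oo, psi q = ginv alpha (q%:R ^- 2)) ->
  exists (K X : R) (Q : nat), [/\ 0 < K, 0 < X, (0 < Q)%N &
  forall C f (P : seq nat) (xi th : R), C11 C f -> (forall x, 1 < `|x| -> f x = 0) ->
  uniq P -> P != [::] -> (forall q, q \in P -> prime q /\ (Q <= q)%N) -> X <= xi ->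
  `|Int (fun x => gcomb P psi x * f x * wave xi th x)| <=
   K * C / xi + (if has (fun q => q%:R <= 2 * xi) P then
      K * C / (\sum_(q <- P) q%:R^-1) * Num.sqrt (alpha xi^-1) else 0)].
Proof.
move=> adim hnu nu0 rho1 hrho hpsi.
have [x0 x00 ar] := alpha_ratio adim rho1 hrho.
have [kap [X [X0 hX]]] := alpha_power adim hnu nu0.
(* This bound on [psi q] ensures [2 psi q <= x0] for [radius_bound] and a radius at most 1/2 for
   [comb_fourier_bound]. *)
have d0 : 0 < Num.min (x0 / 2) 2 by rewrite lt_min divr_gt0//=.
have [Q Q0 hQ] := ginv_facts adim hpsi d0.
have [K0 K00 hK] := @comb_fourier_bound R.
have c1 : 1 <= 8 + 96 * kap%:R :> R by have := ler0n R kap; lra.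
exists (K0 * (8 + 96 * kap%:R)), X, Q; split => //.
  by rewrite mulr_gt0//; lra.
move=> C f P xi th hf sf uP Pn0 hP Xxi.
have xi0 : 0 < xi by exact: lt_le_trans Xxi.
have C0 := C11_ge0 hf.
have cf := C11_continuous hf.
set A := alpha xi^-1; have A0 : 0 < A by case: adim => h _ _; rewrite h// invr_gt0.
set S := \sum_(q <- P) q%:R^-1.
have S0 : 0 < S.
  case: P Pn0 {uP} hP @S => // q P _ hP; rewrite /= big_cons.
  have [pq _] := hP q (mem_head _ _).
  by rewrite ltr_pwDl ?sumr_ge0// invr_gt0 ltr0n prime_gt0.
pose r q := psi q / 4.
have psiP q : q \in P -> [/\ 0 < r q, r q <= 2^-1, (0 < q)%N &
    1 <= 8 * (q%:R ^+ 2 * A) * Num.max 1 (r q * xi)].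
  move=> qP; have [pq Qq] := hP q qP.
  have [p0] := hQ q Qq; rewrite le_min => /andP[p1 p2] _ [x [h1 h2 h3]].
  split; rewrite ?prime_gt0// /r; try lra.
  apply: (radius_bound adim ar) h1 h2 h3 => //; rewrite ?prime_gt0//; lra.
have cF q : q \in P -> ccf (fun x => comb q (r q) x * f x * wave xi th x).
  by move=> /psiP[r0 _ _ _]; apply: ccf_wave => //; exact: comb_ccf.
have -> : Int (fun x => gcomb P psi x * f x * wave xi th x) =
    S^-1 * \sum_(q <- P) q%:R^-1 * Int (fun x => comb q (r q) x * f x * wave xi th x).
  rewrite /gcomb -/S.
  (* Linearity is proved over sublists because [psi q > 0], hence [ccf] of the terms, is known only
     for [q] in [P]. *)
  have cS (l : seq nat) : {subset l <= P} ->
     ccf (fun x => \sum_(q <- l) q%:R^-1 * (comb q (r q) x * f x * wave xi th x)) /\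
     Int (fun x => \sum_(q <- l) q%:R^-1 * (comb q (r q) x * f x * wave xi th x)) =
     \sum_(q <- l) q%:R^-1 * Int (fun x => comb q (r q) x * f x * wave xi th x).
    elim: l => [|q l IH] lP.
      under eq_fun do rewrite big_nil.
      split; last by rewrite big_nil /Int Rintegral_cst// mul0r.
      by split; [move=> x; exact: cvg_cst|exists 0].
    have [|c e] := IH; first by move=> z zl; apply: lP; rewrite inE zl orbT.
    have cq := cF q (lP _ (mem_head _ _)).
    under eq_fun do rewrite big_cons.
    split; first exact: (ccfD (ccfZ _ cq) c).
    by rewrite (IntD (ccfZ _ cq) c) e big_cons (IntZ _ cq).
  have [c <-] := cS P (fun q h => h).
  rewrite -(IntZ _ c); congr Int; apply/funext => x.
  rewrite -!mulrA; congr (_ * _); rewrite mulr_suml; apply: eq_bigr => q _.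
  by rewrite /r; ring.
rewrite normrM gtr0_norm ?invr_gt0//.
have hs := arithmetic_sum uP (fun q qP => (hP q qP).1) A0 (hX xi Xxi) xi0
  (fun q qP => let: And4 _ _ _ h := psiP q qP in h).
rewrite -/S in hs.
apply: (@le_trans _ _ (S^-1 * (K0 * C * (\sum_(q <- P)
    (q%:R^-1 * (mdist q xi * Num.max (mdist q xi) (r q * xi))^-1))))).
  rewrite ler_wpM2l ?invr_ge0 ?(ltW S0)//.
  apply: (le_trans (ler_norm_sum _ _ _)); rewrite mulr_sumr.
  rewrite big_seq [leRHS]big_seq; apply: ler_sum => q qP.
  have [r0 r1 q0 _] := psiP q qP.
  rewrite normrM ger0_norm ?invr_ge0// mulrCA ler_wpM2l ?invr_ge0//.
  apply: (hK C f q (r q) xi (nearest_multiple q xi) hf sf q0 r0 r1 xi0) => //.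
    exact: dvdn_mulr.
  exact: nearest_multipleP.
have KC : 0 <= K0 * C by rewrite mulr_ge0// ltW.
have s0 : 0 <= Num.sqrt A by exact: sqrtr_ge0.
apply: (@le_trans _ _ (S^-1 * (K0 * C * (S / xi +
  (if has (fun q => q%:R <= 2 * xi) P then (8 + 96 * kap%:R) * Num.sqrt A else 0))))).
  by rewrite ler_wpM2l ?invr_ge0 ?(ltW S0)// ler_wpM2l.
have -> : forall T, S^-1 * (K0 * C * (S / xi + T)) = K0 * C / xi + K0 * C / S * T.
  by move=> T; field; rewrite !gt_eqF.
apply: lerD.
  rewrite ler_wpM2r ?invr_ge0 ?(ltW xi0)//; nra.
case: ifP => _; last by rewrite mulr0.
by rewrite le_eqVlt; apply/orP; left; apply/eqP; ring.
Qed.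

End DimensionFunction.

(** * Stieltjes sums and equidistribution of combs *)

Section StieltjesSum.
Context {R : realType}.
Implicit Types (H w F : R -> R) (a h eps b : R).

Lemma itv_oc_split (a b c : R) : a <= b -> b <= c ->
  `]a, c]%classic = `]a, b] `|` `]b, c].
Proof.
move=> ab bc; apply/seteqP; split => x /=; rewrite !in_itv/=.
  by move=> /andP[ax xc]; have [xb|bx] := leP x b; [left|right]; apply/andP.
by move=> [/andP[h1 h2]|/andP[h1 h2]]; apply/andP; split => //; [exact: le_trans bc|exact: le_lt_trans h1].
Qed.

Lemma disj_itv_oc (a b c : R) : [disjoint `]a, b]%classic & `]b, c]%classic].
Proof.
apply/disj_setPS => x /= [] /=; rewrite !in_itv/= => /andP[_ h1] /andP[h2 _].
by have := le_lt_trans h1 h2; rewrite ltxx.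
Qed.

(** The arbitrary measure and weight let one statement serve Lebesgue measure, the densities and the
    limit measure. Half-open cells are disjoint, so no endpoint is counted twice. *)
Lemma stieltjes_sum (m : {measure set (measurableTypeR R) -> \bar R}) H w a h eps (n : nat) :
  0 <= h -> m.-integrable `]a, a + n%:R * h] (EFin \o w) ->
  m.-integrable `]a, a + n%:R * h] (EFin \o (fun x => H x * w x)) ->
  (forall x, 0 <= w x) ->
  (forall (i : nat) x, (i < n)%N -> a + i%:R * h < x -> x <= a + i.+1%:R * h ->
     `|H x - H (a + i%:R * h)| <= eps) ->
  `|\int[m]_(x in `]a, a + n%:R * h]) (H x * w x) -
    \sum_(i < n) H (a + i%:R * h) * \int[m]_(x in `]a + i%:R * h, a + i.+1%:R * h]) w x|
  <= eps * \int[m]_(x in `]a, a + n%:R * h]) w x.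
Proof.
move=> h0; elim: n => [|n IH] iw iH w0 hH.
  rewrite big_ord0 mul0r addr0 set_itvoc0 !Rintegral_set0 subr0 normr0 mulr0//.
have ab : a <= a + n%:R * h by rewrite lerDl mulr_ge0.
have bc : a + n%:R * h <= a + n.+1%:R * h by rewrite lerD2l ler_wpM2r// ler_nat.
pose D1 := `]a, a + n%:R * h]%classic; pose D2 := `]a + n%:R * h, a + n.+1%:R * h]%classic.
have s1 : D1 `<=` `]a, a + n.+1%:R * h] by rewrite (itv_oc_split ab bc).
have s2 : D2 `<=` `]a, a + n.+1%:R * h] by rewrite (itv_oc_split ab bc).
have m0 : measurable (`]a, a + n.+1%:R * h]%classic : set (measurableTypeR R)) by exact: measurable_itv.
have m1 : measurable (D1 : set (measurableTypeR R)) by exact: measurable_itv.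
have m2 : measurable (D2 : set (measurableTypeR R)) by exact: measurable_itv.
have iw1 : m.-integrable D1 (EFin \o w) := integrableS m0 m1 s1 iw.
have iw2 : m.-integrable D2 (EFin \o w) := integrableS m0 m2 s2 iw.
have iH1 : m.-integrable D1 (EFin \o (fun x => H x * w x)) := integrableS m0 m1 s1 iH.
have iH2 : m.-integrable D2 (EFin \o (fun x => H x * w x)) := integrableS m0 m2 s2 iH.
have split F : m.-integrable `]a, a + n.+1%:R * h] (EFin \o F) ->
    \int[m]_(x in `]a, a + n.+1%:R * h]) F x = \int[m]_(x in D1) F x + \int[m]_(x in D2) F x.
  rewrite (itv_oc_split ab bc) => hF; rewrite Rintegral_setU//; exact: disj_itv_oc.
rewrite (split _ iw) (split _ iH) big_ord_recr/= -/D2 mulrDr.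
set c := H (a + n%:R * h).
have e1 := IH iw1 iH1 w0 (fun i x hi => hH i x (ltnW hi)).
have e2 : `|\int[m]_(x in D2) (H x * w x) - c * \int[m]_(x in D2) w x| <=
    eps * \int[m]_(x in D2) w x.
  have icw : m.-integrable D2 (EFin \o (fun x => c * w x)).
    have := integrableZl m2 c iw2; congr (_.-integrable _ _).
  have iew : m.-integrable D2 (EFin \o (fun x => eps * w x)).
    have := integrableZl m2 eps iw2; congr (_.-integrable _ _).
  have idw : m.-integrable D2 (EFin \o (fun x => H x * w x - c * w x)).
    have := integrableB m2 iH2 icw; congr (_.-integrable _ _).
  rewrite -RintegralZl// -RintegralZl// -RintegralB//.
  apply: (le_trans (le_normr_Rintegral m2 idw)).
  apply: le_Rintegral => //; first exact: (integrable_norm idw).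
  move=> x; rewrite /D2/= in_itv/= => /andP[x1 x2].
  rewrite -mulrBl normrM (ger0_norm (w0 x)) ler_wpM2r//.
  exact: (hH n x (ltnSn n)).
apply: le_trans (lerD e1 e2); apply: le_trans (ler_normD _ _).
by rewrite opprD addrACA.
Qed.

Let mu := @lebesgue_measure R.

Lemma fine_lebesgue_oc (a b : R) : a <= b -> fine (@lebesgue_measure R `]a, b]) = b - a.
Proof.
move=> ab; rewrite lebesgue_measure_itv/= lte_fin; case: ltP => h /=; first by [].
lra.
Qed.

Lemma Int_itv F a b : ccf F -> (forall x, x <= a -> F x = 0) -> (forall x, b < x -> F x = 0) ->
  Int F = \int[mu]_(x in `]a, b]) F x.
Proof.
move=> cF h1 h2; rewrite Rintegral_mkcond /Int; congr Rintegral.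
apply/funext => x; rewrite patchE; case: ifPn => // /negP hx.
have [xa|ax] := leP x a; first exact: h1.
have [xb|bx] := leP x b; last exact: h2.
by exfalso; apply: hx; rewrite inE/= in_itv/= ax.
Qed.

Lemma riemann_sum F L a h (n : nat) : ccf F -> 0 <= h -> 0 <= L ->
  (forall x y, `|F x - F y| <= L * `|x - y|) ->
  (forall x, x <= a -> F x = 0) -> (forall x, a + n%:R * h < x -> F x = 0) ->
  `|Int F - h * \sum_(i < n) F (a + i%:R * h)| <= L * h * (n%:R * h).
Proof.
move=> cF h0 L0 hL s1 s2.
have i1 : mu.-integrable `]a, a + n%:R * h] (EFin \o (fun x => 1)).
  have ic : mu.-integrable `[a, a + n%:R * h] (EFin \o (fun x => 1)).
    apply: continuous_compact_integrable; first exact: segment_compact.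
    by apply: continuous_subspaceT => x; exact: cvg_cst.
  apply: integrableS ic => //; apply: subset_itv; rewrite bnd_simp//.
have iF : mu.-integrable `]a, a + n%:R * h] (EFin \o (fun x => F x * 1)).
  under [X in EFin \o X]eq_fun do rewrite mulr1.
  by apply: (@integrableS _ _ _ _ setT) => //; exact: ccf_integrable.
have hF (i : nat) x : (i < n)%N -> a + i%:R * h < x -> x <= a + i.+1%:R * h ->
    `|F x - F (a + i%:R * h)| <= L * h.
  move=> _ x1 x2; apply: (le_trans (hL _ _)); rewrite ler_wpM2l// ger0_norm; last by lra.
  by move: x2; rewrite -[i.+1%:R]natr1 mulrDl mul1r; lra.
have := stieltjes_sum h0 i1 iF (fun=> ler01) hF.
have -> : \int[mu]_(x in `]a, a + n%:R * h]) (F x * 1) = Int F.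
  by rewrite (Int_itv cF s1 s2); apply: eq_Rintegral => x _; rewrite mulr1.
have one (b c : R) : b <= c -> \int[mu]_(x in `]b, c]) (1 : R) = c - b.
  by move=> bc; rewrite Rintegral_cst// mul1r; exact: fine_lebesgue_oc.
rewrite one; last by rewrite lerDl mulr_ge0.
rewrite (addrAC a) subrr add0r mulr_sumr; congr (`|_ - _| <= _).
apply: eq_bigr => i _; rewrite one; last by rewrite lerD2l ler_wpM2r// ler_nat.
by rewrite -[i.+1%:R]natr1; ring.
Qed.

(** Translating each bump back to the origin turns the integral into that of [hump r] against [A],
    where [A u] is the Riemann sum of [F] with mesh [1/q] starting at [u - 5]. Uniformly for
    [|u| <= 1] it differs from the integral of [F] by at most [11 L / q]. *)
Lemma comb_equidistribution F L (q : nat) (r : R) : ccf F -> (0 < q)%N -> 0 < r -> r <= 1 ->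
  (forall x y, `|F x - F y| <= L * `|x - y|) -> (forall x, 2 < `|x| -> F x = 0) ->
  `|Int (fun x => comb q r x * F x) - Int F| <= 11 * L / q%:R.
Proof.
move=> cF q0 r0 r1 hL sF.
have L0 : 0 <= L by have := hL 1 0; rewrite subr0 normr1 mulr1; apply: le_trans.
have qR : 0 < q%:R :> R by rewrite ltr0n.
have q1 : 1 <= q%:R :> R by rewrite ler1n.
set N := (10 * q).+1.
pose A u := q%:R^-1 * \sum_(i < N) F (u - 5 + i%:R * q%:R^-1).
have cFs b : ccf (fun x => F (x + b)) by exact: ccf_shift.
have cA : ccf A.
  apply/ccfZ/ccf_sum => i.
  rewrite (_ : (fun x => F _) = (fun x => F (x + (- 5 + i%:R * q%:R^-1)))); first exact: cFs.
  by apply/funext => x; rewrite addrA.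
have ch := hump_ccf r0.
have cterm b : ccf (fun x => hump r (x + b) * F x).
  by apply: ccfM; [exact: ccf_shift|exact: (proj1 cF)].
have e1 : Int (fun x => comb q r x * F x) = Int (fun x => hump r x * A x).
  have -> : (fun x => comb q r x * F x) = (fun x => q%:R^-1 *
      \sum_(i < N) (hump r (x + (5 - i%:R / q%:R)) * F x)).
    by apply/funext => x; rewrite /comb -mulrA mulr_suml.
  rewrite IntZ; last by apply: ccf_sum => i; exact: cterm.
  rewrite Int_sum; last by move=> i; exact: cterm.
  have -> : (fun x => hump r x * A x) = (fun x => q%:R^-1 *
      \sum_(i < N) (hump r x * F (x + (i%:R / q%:R - 5)))).
    apply/funext => x; rewrite /A mulrCA mulr_sumr; congr (_ * _).
    by apply: eq_bigr => i _; congr (_ * F _); ring.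
  have ct2 b : ccf (fun x => hump r x * F (x + b)).
    by apply: ccfM => //; exact: (proj1 (cFs b)).
  rewrite IntZ; last by apply: ccf_sum => i; exact: ct2.
  rewrite Int_sum; last by move=> i; exact: ct2.
  congr (_ * _); apply: eq_bigr => i _.
  rewrite -(Int_shift (i%:R / q%:R - 5) (cterm _)); congr Int; apply/funext => x.
  by congr (hump r _ * _); ring.
have hA u : `|u| <= 1 -> `|A u - Int F| <= 11 * L / q%:R.
  rewrite ler_norml => /andP[u1 u2]; rewrite distrC.
  have hq : 0 <= q%:R^-1 :> R by rewrite invr_ge0 ltW.
  have Nq : N%:R * q%:R^-1 = 10 + q%:R^-1 :> R.
    by rewrite /N -[X in X * _]natr1 natrM; field; rewrite gt_eqF.
  have := @riemann_sum F L (u - 5) q%:R^-1 N cF hq L0 hL.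
  move=> /(_ _ _)/le_trans; apply.
  - move=> x hx; apply: sF; rewrite lter_normr; apply/orP; right; lra.
  - move=> x; rewrite Nq => hx; apply: sF; rewrite lter_normr; apply/orP; left; lra.
  - rewrite Nq mulrAC ler_wpM2r//.
    have : q%:R^-1 <= 1 :> R by rewrite invf_le1.
    nra.
rewrite e1.
have -> : Int F = Int (fun x => Int F * hump r x) by rewrite IntZ// Int_hump// mulr1.
have cd : ccf (fun x => hump r x * A x) by apply: ccfM => //; exact: (proj1 cA).
rewrite -(IntB cd (ccfZ _ ch)).
have -> : 11 * L / q%:R = Int (fun x => 11 * L / q%:R * hump r x).
  by rewrite IntZ// Int_hump// mulr1.
apply: le_normr_Int; [exact: (ccfB cd (ccfZ _ ch))|exact: ccfZ|].
move=> x; rewrite (mulrC (Int F)) -mulrBr (mulrC _ (hump r x)).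
rewrite normrM (ger0_norm (hump_ge0 _ r0)).
have [xr|rx] := ltP `|x| r.
  by rewrite ler_wpM2l ?hump_ge0//; apply: hA; lra.
by rewrite hump_out// !mul0r.
Qed.

End StieltjesSum.

(** * Densities on the unit interval and their distribution functions *)

Section Density.
Context {R : realType}.
Implicit Types (f : R -> R) (a b eta C xi th : R).
Let mu := @lebesgue_measure R.

(** No total mass is prescribed, because multiplication by a comb does not preserve it exactly. *)
Definition density f : Prop :=
  [/\ exists C, C11 C f, forall x, 0 <= f x & forall x, f x != 0 -> 0 <= x <= 1].

Lemma density_out f x : density f -> 1 < `|x| -> f x = 0.
Proof.
move=> [_ _ h] hx; apply/eqP; apply: contraTT isT => /h /andP[x0 x1].
by move: hx; rewrite ger0_norm// ltNge x1.
Qed.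

Lemma density_ccf f : density f -> ccf f.
Proof.
move=> df; split; last by exists 1 => x; exact: density_out.
by case: df => -[C hC] _ _; exact: C11_continuous hC.
Qed.

Definition cdf f b : R := \int[mu]_(x in `]-oo, b]) f x.

Lemma cdf_integrable f (D : set R) : density f -> measurable D ->
  mu.-integrable D (EFin \o f).
Proof.
move=> df mD; apply: (@integrableS _ _ _ _ setT) => //.
exact/ccf_integrable/density_ccf.
Qed.

Lemma cdfB f a b : density f -> a <= b ->
  cdf f b - cdf f a = \int[mu]_(x in `]a, b]) f x.
Proof.
move=> df ab; rewrite /cdf.
have e : `]-oo, b]%classic = `]-oo, a] `|` `]a, b].
  apply/seteqP; split => x /=; rewrite !in_itv/=.
    by move=> xb; have [xa|ax] := leP x a; [left|right].
  by move=> [xa|/andP[_ xb]] //; exact: le_trans ab.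
rewrite e Rintegral_setU//; first by rewrite addrC addKr.
  by rewrite -e; exact: cdf_integrable.
apply/disj_setPS => x /= [] /=; rewrite !in_itv/= => h1 /andP[h2 _].
by have := le_lt_trans h1 h2; rewrite ltxx.
Qed.

Lemma le_cdf f a b : density f -> a <= b -> cdf f a <= cdf f b.
Proof.
move=> df ab; rewrite -subr_ge0 cdfB//; apply: Rintegral_ge0 => x _.
by case: df.
Qed.

Lemma cdf_lipschitz f C a b : density f -> C11 C f -> a <= b ->
  cdf f b - cdf f a <= C * (b - a).
Proof.
move=> df hC ab; rewrite cdfB//.
apply: (@le_trans _ _ (\int[mu]_(x in `]a, b]) C)).
  apply: le_Rintegral => //; first exact: cdf_integrable.
    have ic : mu.-integrable `[a, b] (EFin \o (fun x => C)).
      apply: continuous_compact_integrable; first exact: segment_compact.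
      by apply: continuous_subspaceT => x; exact: cvg_cst.
    by apply: integrableS ic => //; apply: subset_itv; rewrite bnd_simp.
  by move=> x _; case: hC => h _ _; exact: le_trans (ler_norm _) (h x).
rewrite Rintegral_cst//.
by rewrite [X in _ * X](_ : _ = b - a)//; exact: fine_lebesgue_oc.
Qed.

Lemma cdf_low f b : density f -> b < 0 -> cdf f b = 0.
Proof.
move=> [_ _ h] b0.
rewrite /cdf (@eq_Rintegral _ _ _ mu _ (fun=> 0)).
  by rewrite Rintegral_cst// mul0r.
move=> x; rewrite inE/= in_itv/= => xb; apply/eqP.
apply: contraTT isT => /h /andP[x0 _]; have := le_lt_trans xb b0.
by rewrite ltNge x0.
Qed.

Lemma cdf_high f b : density f -> 1 <= b -> cdf f b = Int f.
Proof.
move=> [_ _ h] b1; rewrite /cdf Rintegral_mkcond; congr Rintegral.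
apply/funext => x; rewrite patchE; case: ifPn => // /negP hx.
apply/esym/eqP; apply: contraTT isT => /h /andP[x0 x1]; exfalso; apply: hx.
by rewrite inE/= in_itv/= (le_trans x1).
Qed.

(** A Lipschitz substitute for the indicator of []-oo, b]]: equidistribution is available only
    against Lipschitz functions. *)
Definition cutoff b eta x : R := Num.max 0 (Num.min 1 ((b + eta - x) / eta)).

Lemma cutoff_bound b eta x : 0 <= cutoff b eta x <= 1.
Proof. by rewrite /cutoff le_max lexx/= ge_max ler01 ge_min lexx. Qed.

Lemma cutoff_one b eta x : 0 < eta -> x <= b -> cutoff b eta x = 1.
Proof.
move=> e0 xb; rewrite /cutoff min_l ?max_r//.
by rewrite ler_pdivlMr// mul1r; lra.
Qed.

Lemma cutoff_zero b eta x : 0 < eta -> b + eta < x -> cutoff b eta x = 0.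
Proof.
move=> e0 xb; rewrite /cutoff max_l// ge_min; apply/orP; right.
by rewrite ler_pdivrMr// mul0r; lra.
Qed.

Lemma cutoff_lipschitz b eta x y : 0 < eta ->
  `|cutoff b eta x - cutoff b eta y| <= eta^-1 * `|x - y|.
Proof.
move=> e0; rewrite /cutoff.
set u := (b + eta - x) / eta; set v := (b + eta - y) / eta.
apply: (@le_trans _ _ `|u - v|); last first.
  rewrite (_ : u - v = - (eta^-1 * (x - y))); last by rewrite /u /v; ring.
  by rewrite normrN normrM gtr0_norm ?invr_gt0.
have h1 := real_ler_norm (num_real (u - v)); have h2 := real_ler_norm (num_real (- (u - v))).
rewrite normrN in h2; rewrite ler_norml.
have [hu|hu] := leP 1 u; have [hv|hv] := leP 1 v;
  rewrite ?(max_r ler01); try (have [hu'|hu'] := leP 0 u); try (have [hv'|hv'] := leP 0 v); lra.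
Qed.

Lemma cdf_cutoff f b eta : density f -> 0 < eta ->
  cdf f b <= Int (fun x => f x * cutoff b eta x) <= cdf f (b + eta).
Proof.
move=> df e0; have cf := density_ccf df; have [_ f0 _] := df.
have cc : ccf (fun x => f x * cutoff b eta x).
  by apply: ccfM => //; apply: lipschitz_continuous => x y; exact: cutoff_lipschitz.
have ip c : mu.-integrable setT (EFin \o (f \_ `]-oo, c])).
  by rewrite -restrict_EFin -integrable_mkcond//; exact: cdf_integrable.
apply/andP; split; rewrite /cdf Rintegral_mkcond; apply: le_Rintegral => //;
  try exact: ip; try exact: ccf_integrable.
- move=> x _; rewrite patchE; case: ifPn => [|_].
    by rewrite inE/= in_itv/= => xb; rewrite cutoff_one// mulr1.
  by rewrite mulr_ge0//; have /andP[] := cutoff_bound b eta x.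
- move=> x _; rewrite patchE; case: ifPn => [_|/negP hx].
    by have /andP[_ h] := cutoff_bound b eta x; rewrite -[leRHS]mulr1 ler_wpM2l.
  rewrite cutoff_zero ?mulr0// ltNge; apply/negP => h; apply: hx.
  by rewrite inE/= in_itv.
Qed.

(** The half-period translation again, with the difference falling on [f]; after a translation by at
    most 1/2 everything lives in [|x| <= 2]. *)
Lemma density_wave_decay f C xi th : density f -> C11 C f -> 1 <= xi ->
  `|Int (fun x => f x * wave xi th x)| <= C / xi.
Proof.
move=> df hC xi1; have xi0 : 0 < xi by lra.
have cf := density_ccf df; have C0 := C11_ge0 hC; have [_ f1 _] := hC.
pose h := (2 * xi)^-1.
have h0 : 0 < h by rewrite invr_gt0 mulr_gt0.
have h1 : h <= 2^-1 by rewrite lef_pV2 ?posrE ?mulr_gt0//; lra.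
have cfh : ccf (fun x => f (x + h)) by exact: ccf_shift.
have cw := @wave_continuous R xi th.
have e1 : Int (fun x => f x * wave xi th x) = - Int (fun x => f (x + h) * wave xi th x).
  rewrite -(Int_shift h (ccfM cf cw)) -mulN1r -IntZ; last exact: ccfM.
  by congr Int; apply/funext => x; rewrite wave_half ?gt_eqF//; ring.
have e2 : 2 * Int (fun x => f x * wave xi th x) =
    Int (fun x => (f x - f (x + h)) * wave xi th x).
  rewrite (_ : (fun x => (f x - _) * _) = (fun x => f x * wave xi th x - f (x + h) * wave xi th x)).
    rewrite IntB; [|exact: ccfM|exact: ccfM].
    by rewrite mulr_natl mulr2n; congr (_ + _); exact: e1.
  by apply/funext => x; rewrite mulrBl.
have : `|Int (fun x => (f x - f (x + h)) * wave xi th x)| <= C * h * (2 + 2).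
  apply: (le_Int_supp (c := 0)) => //.
  - by apply: ccfM => //; exact: ccfB.
  - move=> x; rewrite normrM -[leRHS]mulr1; apply: ler_pM => //; last exact: wave_le1.
    by rewrite distrC; apply: le_trans (f1 _ _) _; rewrite (gtr0_norm h0).
  - move=> x; rewrite subr0 => hx; rewrite (density_out (x := x) df); last by lra.
    rewrite (density_out df) ?subr0 ?mul0r//.
    by have := ler_normB (x + h) h; rewrite addrK (gtr0_norm h0); lra.
rewrite -e2 normrM ger0_norm// => H.
have -> : C / xi = C * h * 2 by rewrite /h; field; rewrite gt_eqF.
lra.
Qed.

End Density.

(** * One step of the construction *)

Section Stage.
Context {R : realType}.
Implicit Types (f : R -> R) (alpha omega : R -> R) (psi : nat -> R) (P : seq nat).

Lemma wave_opp (xi th x : R) : wave (- xi) th x = wave xi (- th) x.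
Proof. by rewrite /wave -cosN; congr cos; ring. Qed.

(** As alpha(x)/x is non-increasing near 0, alpha(1/xi) is at least a constant times 1/xi; its
    square root therefore dominates any multiple of 1/xi at infinity. *)
Lemma alpha_beats alpha (x0 D e : R) : dimension_function alpha -> 0 < x0 ->
  (forall x1 x2 : R, 0 < x1 -> x1 <= x2 -> x2 < x0 -> x1 * alpha x2 <= x2 * alpha x1) ->
  0 <= D -> 0 < e ->
  exists2 X : R, 0 < X & forall xi, X <= xi -> D / xi <= e * Num.sqrt (alpha xi^-1).
Proof.
move=> [apos _ _] x00 ar D0 e0.
pose x2 := x0 / 2; have x2p : 0 < x2 by rewrite divr_gt0.
have x2x : x2 < x0 by rewrite /x2; lra.
have c0 := apos x2 x2p; set c := alpha x2 in c0.
exists (Num.max x2^-1 (x2 * D ^+ 2 / (e ^+ 2 * c))).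
  by rewrite lt_max invr_gt0 x2p.
move=> xi; rewrite ge_max => /andP[h1 h2].
have xi0 : 0 < xi by apply: lt_le_trans h1; rewrite invr_gt0.
have xi2 : xi^-1 <= x2 by rewrite invf_ple ?posrE.
have xip : 0 < xi^-1 by rewrite invr_gt0.
have A0 := apos _ xip; have := ar _ _ xip xi2 x2x; rewrite -/c => h3.
have -> : e * Num.sqrt (alpha xi^-1) = Num.sqrt (e ^+ 2 * alpha xi^-1).
  by rewrite sqrtrM ?sqr_ge0// sqrtr_sqr gtr0_norm.
have d0 : 0 <= D / xi by rewrite divr_ge0// ltW.
rewrite -(ger0_norm d0) -sqrtr_sqr ler_sqrt; last by rewrite mulr_ge0 ?sqr_ge0// ltW.
move: h2; rewrite ler_pdivrMr; last by rewrite mulr_gt0 ?exprn_gt0.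
move=> h2.
have h4 : e ^+ 2 * (xi^-1 * c) <= e ^+ 2 * (x2 * alpha xi^-1).
  by rewrite ler_wpM2l ?sqr_ge0.
rewrite -(ler_pM2l x2p).
apply: (@le_trans _ _ (e ^+ 2 * (xi^-1 * c))); last by apply: le_trans h4 _; rewrite mulrCA.
rewrite -(ler_pM2r (exprn_gt0 2 xi0)).
have -> : x2 * (D / xi) ^+ 2 * xi ^+ 2 = x2 * D ^+ 2 by field; rewrite gt_eqF.
by have -> : e ^+ 2 * (xi^-1 * c) * xi ^+ 2 = xi * (e ^+ 2 * c) by field; rewrite gt_eqF.
Qed.

Lemma gcomb_equidistribution P psi F (L M : R) : ccf F -> P != [::] ->
  (forall q, q \in P -> [/\ (0 < q)%N, M <= q%:R, 0 < psi q & psi q <= 1]) -> 0 < M ->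
  (forall x y, `|F x - F y| <= L * `|x - y|) -> (forall x, 2 < `|x| -> F x = 0) ->
  `|Int (fun x => gcomb P psi x * F x) - Int F| <= 11 * L / M.
Proof.
move=> cF Pn0 hP M0 hL sF.
have L0 : 0 <= L by have := hL 1 0; rewrite subr0 normr1 mulr1; apply: le_trans.
pose S : R := \sum_(q <- P) q%:R^-1.
have S0 : 0 < S.
  case: P Pn0 hP @S => // q P _ hP; rewrite /= big_cons.
  have [q0 _ _ _] := hP q (mem_head _ _).
  by rewrite ltr_pwDl ?sumr_ge0// invr_gt0 ltr0n.
set E := 11 * L / M.
have cS (l : seq nat) : {subset l <= P} ->
   ccf (fun x => \sum_(q <- l) q%:R^-1 * (comb q (psi q / 4) x * F x)) /\
   `|Int (fun x => \sum_(q <- l) q%:R^-1 * (comb q (psi q / 4) x * F x))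
      - (\sum_(q <- l) q%:R^-1) * Int F| <= (\sum_(q <- l) q%:R^-1) * E.
  elim: l => [|q l IH] lP.
    under eq_fun do rewrite big_nil.
    split; first by split; [move=> x; exact: cvg_cst|exists 0].
    by rewrite big_nil /Int Rintegral_cst// !mul0r subr0 normr0.
  have [|c e] := IH; first by move=> z zl; apply: lP; rewrite inE zl orbT.
  have [q0 Mq p0 p1] := hP q (lP _ (mem_head _ _)).
  have r0 : 0 < psi q / 4 by lra.
  have r1 : psi q / 4 <= 1 by lra.
  have cq : ccf (fun x => comb q (psi q / 4) x * F x).
    by apply: ccfM; [exact: comb_ccf|exact: (proj1 cF)].
  under eq_fun do rewrite big_cons.
  split; first exact: (ccfD (ccfZ _ cq) c).
  rewrite (IntD (ccfZ _ cq) c) (IntZ _ cq) !big_cons 2!mulrDl.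
  rewrite opprD addrACA; apply: (le_trans (ler_normD _ _)); apply: lerD => //.
  rewrite -mulrBr normrM ger0_norm ?invr_ge0// ler_wpM2l ?invr_ge0//.
  apply: le_trans (comb_equidistribution cF q0 r0 r1 hL sF) _.
  apply: ler_wpM2l; first exact: mulr_ge0.
  by rewrite lef_pV2 ?posrE ?ltr0n//.
have [c e] := cS P (fun q h => h).
have -> : (fun x => gcomb P psi x * F x) =
    (fun x => S^-1 * \sum_(q <- P) q%:R^-1 * (comb q (psi q / 4) x * F x)).
  apply/funext => x; rewrite /gcomb -mulrA; congr (_ * _).
  by rewrite mulr_suml; apply: eq_bigr => q _; exact/esym/mulrA.
rewrite (IntZ _ c); set I := Int _ in e *.
have -> : S^-1 * I - Int F = S^-1 * (I - S * Int F) by field; rewrite gt_eqF.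
rewrite normrM gtr0_norm ?invr_gt0// -(ler_pM2l S0).
by rewrite mulrA divff ?gt_eqF// mul1r.
Qed.

Lemma gcomb_C11 P psi : exists C, C11 C (gcomb P psi).
Proof.
have hq q : exists C, C11 C (fun x : R => q%:R^-1 * comb q (psi q / 4) x).
  by have [C hC] := comb_C11 q (psi q / 4); eexists; exact: C11Z hC.
have [C hC] := C11_sum P hq.
by eexists; exact: C11Z hC.
Qed.

Lemma gcomb_ge0 P psi x : (forall q, q \in P -> 0 < psi q) -> 0 <= gcomb P psi x.
Proof.
move=> hP; apply: mulr_ge0; first by rewrite invr_ge0 sumr_ge0.
rewrite big_seq sumr_ge0// => q /hP p0; rewrite mulr_ge0 ?invr_ge0//.
by apply: comb_ge0; rewrite divr_gt0.
Qed.

Definition near_fraction P psi : set R :=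
  [set x | exists q i : nat, [/\ q \in P, (i < (10 * q).+1)%N &
     `|x - (i%:R / q%:R - 5)| <= psi q / 4] ].

Lemma gcomb_support P psi x : (forall q, q \in P -> (0 < q)%N /\ 0 < psi q) ->
  gcomb P psi x != 0 -> near_fraction P psi x.
Proof.
move=> hP; have [//|hn] := pselect (near_fraction P psi x).
rewrite /gcomb [X in _ * X]big1_seq ?mulr0 ?eqxx// => q /andP[_ qP].
have [q0 p0] := hP q qP.
apply/eqP; apply: contraPT isT; rewrite mulf_eq0 negb_or => /andP[_ h].
have r0 : 0 < psi q / 4 by rewrite divr_gt0.
have [i i1 i2] := comb_support q0 r0 h.
by exfalso; apply: hn; exists q, i.
Qed.

Lemma leq_sum6 (a b c d e g : nat) :
  [/\ (a <= a + b + c + d + e + g)%N, (b <= a + b + c + d + e + g)%N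
    & (c <= a + b + c + d + e + g)%N].
Proof. by split; lia. Qed.

Lemma stage alpha omega (nu rho : R) psi : dimension_function alpha ->
  ln (alpha x) / ln x @[x --> 0^'+] --> nu -> 0 < nu -> rho < 1 ->
  (exists2 x0 : R, 0 < x0 & forall x1 x2 : R, 0 < x1 -> x1 < x2 -> x2 < x0 ->
     (x1 / x2) `^ rho <= alpha x1 / alpha x2) ->
  (forall xi : R, 0 <= xi -> 0 < omega xi) ->
  (forall x y : R, 0 <= x -> x <= y -> omega x <= omega y) ->
  omega xi @[xi --> +oo] --> +oo ->
  (\forall q \near \oo, psi q = ginv alpha (q%:R ^- 2)) ->
  forall f (eps s : R) (M0 : nat), density f -> 0 < eps -> 0 < s -> s <= 2^-1 ->
  exists P f',
    [/\ forall q, q \in P -> (M0 <= q)%N, \sum_(q <- P) (q%:R^-1 : R) <= s + s,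
        density f', forall x, f' x != 0 -> f x != 0 /\ near_fraction P psi x &
        (forall b, `|cdf f' b - cdf f b| <= eps) /\
        (forall xi th, xi != 0 ->
          `|Int (fun x => f' x * wave xi th x) - Int (fun x => f x * wave xi th x)|
            <= eps * (Num.sqrt (alpha `|xi|^-1) * omega `|xi|))].
Proof.
move=> adim hnu nu0 rho1 hrho opos omono oinf hpsi f eps s M0 df e0 s0 s1.
have [x0 x00 ar] := alpha_ratio adim rho1 hrho.
have apos : forall x : R, 0 < x -> 0 < alpha x by case: adim.
have [K [X [Q1 [K0 X0 Q10 HF]]]] := high_frequency adim hnu nu0 rho1 hrho hpsi.
have [C hC] : exists C, C11 C f by case: df.
have C0 := C11_ge0 hC; have cf := density_ccf df.
have [f0 f1 _] := hC; have fge0 : forall x, 0 <= f x by case: df.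
have w0 := opos 0 (lexx 0).
have D0 : 0 <= (K + 1) * C by rewrite mulr_ge0//; lra.
have e40 : 0 < eps * omega 0 / 4 by rewrite divr_gt0// mulr_gt0.
(* The multiple [(K + 1) C] of [1/xi] collects the contribution of the new density and that of
   [f]. *)
have [X1 X10 hX1] := alpha_beats adim x00 ar D0 e40.
pose X2 := Num.max (Num.max X X1) 1.
have X2p : 0 < X2 by rewrite lt_max ltr01 orbT.
(* A lower bound for the target sqrt(alpha(1/xi)) omega(xi) over all [0 < xi <= X2], by monotonicity
   of both factors. *)
pose m0 := Num.sqrt (alpha X2^-1) * omega 0.
have m00 : 0 < m0 by rewrite mulr_gt0// sqrtr_gt0 apos// invr_gt0.
pose L1 := C * (2 * pi * X2) + C.
have L10 : 0 <= L1 by rewrite addr_ge0// !mulr_ge0 ?pi_ge0// ltW.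
pose eta := eps / (2 * (C + 1)).
have C1 : 0 < C + 1 by lra.
have eta0 : 0 < eta by rewrite divr_gt0// mulr_gt0.
have Ceta : C * eta <= eps / 2.
  have -> : eps / 2 = (C + 1) * eta by rewrite /eta; field; rewrite gt_eqF.
  by rewrite ler_wpM2r ?(ltW eta0)//; lra.
pose L2 := C * eta^-1 + C.
have L20 : 0 <= L2 by rewrite addr_ge0// mulr_ge0 ?invr_ge0// ltW.
(* From [W] on, [omega] outweighs the loss [1/s]. Since [M >= 2 W], any [xi] with a prime of [P] up
   to [2 xi] is at least [W]. *)
have [W W0 hW] : exists2 W : R, 0 < W & forall xi : R, W <= xi -> 4 * (K * C / s) / eps <= omega xi.
  move/cvgryPge : oinf => /(_ (4 * (K * C / s) / eps)) [W0 [W0r hW]].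
  exists (Num.max 1 (W0 + 1)); first by rewrite lt_max ltr01.
  move=> xi; rewrite ge_max => /andP[_ h]; apply: hW => /=; lra.
have [Q2 Q20 hQ2] := ginv_facts adim hpsi ltr01.
pose y1 := 11 * L1 / (eps * m0); pose y2 := 11 * L2 / (eps / 2).
have y10 : 0 <= y1 by rewrite divr_ge0 ?mulr_ge0// ltW.
have y20 : 0 <= y2 by rewrite divr_ge0 ?mulr_ge0// ltW.
have [M [MM0 MQ1 MQ2 [Ms My1 My2 MW]]] : exists M : nat, [/\ (M0 <= M)%N, (Q1 <= M)%N, (Q2 <= M)%N &
   [/\ s^-1 <= M%:R, y1 <= M%:R, y2 <= M%:R & 2 * W <= M%:R] ].
  pose T (z : R) := (Num.truncn z).+1.
  have hT z : 0 <= z -> z <= (T z)%:R by move=> z0; have /andP[_ /ltW] := truncn_itv z0.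
  exists (M0 + Q1 + Q2 + T s^-1 + T y1 + T y2 + T (2 * W)%R)%N.
  have a1 := hT s^-1; have a2 := hT y1 y10; have a3 := hT y2 y20; have a4 := hT (2 * W).
  have [n1 n2 n3] := leq_sum6 M0 Q1 Q2 (T s^-1) (T y1 + T y2) (T (2 * W)).
  rewrite addnA in n1 n2 n3; split => //.
  rewrite !natrD; have a5 := ler0n R M0; have a6 := ler0n R Q1; have a7 := ler0n R Q2.
  have a8 := ler0n R (T s^-1); have a9 := ler0n R (T y1).
  have a10 := ler0n R (T y2); have a11 := ler0n R (T (2 * W)).
  have b1 : s^-1 <= (T s^-1)%:R by apply: a1; rewrite invr_ge0 ltW.
  have b2 : 2 * W <= (T (2 * W))%:R by apply: a4; rewrite mulr_ge0// ltW.
  by split; lra.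
have MN : (0 < M)%N by exact: leq_trans MQ1.
have MR : 0 < M%:R :> R by rewrite ltr0n.
have Ms' : M%:R^-1 <= s by rewrite invf_ple ?posrE.
have [P [uP hP Ps1 Ps2]] := primes_reciprocal_sum s0 s1 Ms' MN.
have Pn0 : P != [::].
  by apply/eqP => P0; move: Ps1; rewrite P0 big_nil; lra.
have hP' q : q \in P -> [/\ (0 < q)%N, M%:R <= q%:R :> R, 0 < psi q & psi q <= 1].
  move=> qP; have [pq Mq] := hP q qP.
  have [p0 p1 _ _] := hQ2 q (leq_trans MQ2 Mq).
  by rewrite prime_gt0// ler_nat.
have gpos q : q \in P -> 0 < psi q by case/hP'.
have g0 x : 0 <= gcomb P psi x by exact: gcomb_ge0.
have [Cg hCg] := gcomb_C11 P psi.
pose f' x := gcomb P psi x * f x.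
have df' : density f'.
  split; first by eexists; exact: C11M hCg hC.
    by move=> x; rewrite mulr_ge0.
  by move=> x; rewrite mulf_eq0 negb_or => /andP[_]; case: df => _ _; exact.
exists P, f'; split => //.
- by move=> q qP; have [_ h] := hP q qP; exact: leq_trans h.
- move=> x; rewrite mulf_eq0 negb_or => /andP[h1 h2]; split => //.
  by apply: gcomb_support h1 => q /hP'[].
split.
  move=> b.
  have cc c : `|Int (fun x => f' x * cutoff c eta x) - Int (fun x => f x * cutoff c eta x)| <= eps / 2.
    have ccc : ccf (fun x => f x * cutoff c eta x).
      by apply: ccfM => //; apply: lipschitz_continuous => x y; exact: cutoff_lipschitz.
    have lip x y : `|f x * cutoff c eta x - f y * cutoff c eta y| <= L2 * `|x - y|.
      rewrite (_ : _ - _ = f x * (cutoff c eta x - cutoff c eta y) + (f x - f y) * cutoff c eta y); last by ring.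
      apply: (le_trans (ler_normD _ _)); rewrite !normrM /L2 mulrDl; apply: lerD.
        by rewrite -mulrA; apply: ler_pM => //; exact: cutoff_lipschitz.
      have /andP[c0 c1] := cutoff_bound c eta y.
      rewrite -[leRHS]mulr1 (ger0_norm c0); apply: ler_pM => //.
      by have := f1 y (x - y); rewrite (_ : y + (x - y) = x); last by ring.
    have out x : 2 < `|x| -> f x * cutoff c eta x = 0.
      by move=> hx; rewrite (density_out df) ?mul0r//; lra.
    have := gcomb_equidistribution ccc Pn0 hP' MR lip out.
    rewrite (_ : (fun x => gcomb P psi x * _) = (fun x => f' x * cutoff c eta x)); last first.
      by apply/funext => x; rewrite /f' mulrA.
    move=> /le_trans; apply; rewrite ler_pdivrMr//.
    by move: My2; rewrite /y2 ler_pdivrMr ?divr_gt0// (mulrC M%:R).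
  (* The cutoffs at [b] and [b - eta] bracket the new distribution function: equidistribution costs
     [eps / 2], and moving the old one by [eta] costs [C * eta <= eps / 2]. Only the Lipschitz
     constant of the old density enters. *)
  have be : b <= b + eta by rewrite lerDl ltW.
  have be' : b - eta <= b by rewrite gerBl ltW.
  have /andP[u1 _] := cdf_cutoff b df' eta0.
  have /andP[_ u2] := cdf_cutoff b df eta0.
  have /andP[_ v1] := cdf_cutoff (b - eta) df' eta0.
  have /andP[v2 _] := cdf_cutoff (b - eta) df eta0.
  rewrite subrK in v1.
  have l1 := cdf_lipschitz df hC be; have l2 := cdf_lipschitz df hC be'.
  have e1 : b + eta - b = eta by ring.
  have e2 : b - (b - eta) = eta by ring.
  rewrite e1 in l1; rewrite e2 in l2.
  have := cc b; have := cc (b - eta); rewrite !ler_norml => /andP[p1 p2] /andP[p3 p4].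
  by apply/andP; split; lra.
move=> xi th; wlog xi0 : xi th / 0 < xi => [hw xin0|].
  have [xi0|xi0|xi0] := ltgtP 0 xi; first exact: hw.
    have := hw (- xi) (- th); rewrite oppr_gt0 normrN oppr_eq0 => /(_ xi0 xin0).
    by under eq_fun do rewrite wave_opp opprK; under [in X in _ - X]eq_fun do rewrite wave_opp opprK.
  by rewrite xi0 eqxx in xin0.
move=> xin0; rewrite (gtr0_norm xi0).
have A0 : 0 < Num.sqrt (alpha xi^-1) by rewrite sqrtr_gt0 apos// invr_gt0.
set A := Num.sqrt _ in A0 *.
have wxi : omega 0 <= omega xi by rewrite omono// ltW.
(* Low frequencies by equidistribution, high ones by bounding both transforms separately. *)
have [xiX|Xxi] := leP xi X2.
  have ccw : ccf (fun x => f x * wave xi th x) by apply: ccfM => //; exact: wave_continuous.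
  have lip x y : `|f x * wave xi th x - f y * wave xi th y| <= L1 * `|x - y|.
    rewrite (_ : _ - _ = f x * (wave xi th x - wave xi th y) + (f x - f y) * wave xi th y); last by ring.
    apply: (le_trans (ler_normD _ _)); rewrite !normrM /L1 mulrDl; apply: lerD.
      rewrite -mulrA; apply: ler_pM => //; apply: (le_trans (wave_lipschitz _ _ _ _)).
      rewrite (gtr0_norm xi0) ler_wpM2r// ler_wpM2l// mulr_ge0// pi_ge0//.
    rewrite -[leRHS]mulr1; apply: ler_pM => //; last exact: wave_le1.
    by have := f1 y (x - y); rewrite (_ : y + (x - y) = x); last by ring.
  have out x : 2 < `|x| -> f x * wave xi th x = 0.
    by move=> hx; rewrite (density_out df) ?mul0r//; lra.
  have := gcomb_equidistribution ccw Pn0 hP' MR lip out.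
  rewrite (_ : (fun x => gcomb P psi x * _) = (fun x => f' x * wave xi th x)); last first.
    by apply/funext => x; rewrite /f' mulrA.
  move=> /le_trans; apply; apply: (@le_trans _ _ (eps * m0)).
    rewrite ler_pdivrMr//; move: My1; rewrite /y1 ler_pdivrMr; last by rewrite mulr_gt0.
    by rewrite (mulrC M%:R).
  rewrite ler_wpM2l ?(ltW e0)//; apply: ler_pM => //; first exact: ltW.
  rewrite /A ler_sqrt; last by rewrite ltW// apos// invr_gt0.
  by case: adim => _ am _; apply: am; rewrite ?invr_gt0// lef_pV2 ?posrE.
have XX : X <= xi by apply: le_trans (ltW Xxi); rewrite !le_max lexx.
have XX1 : X1 <= xi by apply: le_trans (ltW Xxi); rewrite !le_max lexx orbT.
have X11 : 1 <= xi by apply: le_trans (ltW Xxi); rewrite !le_max lexx orbT.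
have sf x : 1 < `|x| -> f x = 0 by exact: density_out.
have h1 := HF C f P xi th hC sf uP Pn0 (fun q qP => let: conj a b := hP q qP in conj a (leq_trans MQ1 b)) XX.
have h2 := density_wave_decay th df hC X11.
have h3 := hX1 xi XX1; rewrite -/A in h1 h3.
apply: (le_trans (ler_normB _ _)); apply: (le_trans (lerD h1 h2)).
have h4 : eps * omega 0 / 4 * A <= eps / 4 * (A * omega xi).
  rewrite (_ : eps * omega 0 / 4 * A = eps / 4 * (A * omega 0)); last by ring.
  by rewrite ler_wpM2l ?divr_ge0 ?(ltW e0)// ler_wpM2l ?(ltW A0).
have h5 : K * C / xi + C / xi = (K + 1) * C / xi by ring.
have Aw : 0 <= eps / 4 * (A * omega xi).
  by rewrite mulr_ge0 ?divr_ge0 ?mulr_ge0 ?(ltW e0) ?(ltW A0)// ltW// (lt_le_trans w0).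
case: ifPn => [/hasP[q qP /= qxi]|_]; last by lra.
have [_ Mq _ _] := hP' q qP.
have h6 : 4 * (K * C / s) / eps <= omega xi by apply: hW; lra.
have h7 : K * C / (\sum_(q <- P) q%:R^-1) * A <= eps / 4 * (A * omega xi).
  rewrite mulrA (mulrAC _ A) ler_wpM2r ?(ltW A0)//.
  apply: (@le_trans _ _ (K * C / s)).
    rewrite ler_wpM2l ?mulr_ge0 ?(ltW K0)// lef_pV2 ?posrE//.
    exact: lt_le_trans Ps1.
  move: h6; rewrite ler_pdivrMr//; lra.
lra.
Qed.

End Stage.

(** * The limit of the densities as a probability measure *)

Section LimitMeasure.
Context {R : realType}.

Lemma cdf_probability (F : R -> R) : {homo F : x y / x <= y} -> continuous F ->
  (forall b, b < 0 -> F b = 0) -> (forall b, 1 <= b -> F b = 1) ->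
  exists mu : probability (measurableTypeR R) R,
    forall a b, a <= b -> mu `]a, b]%classic = (F b - F a)%:E.
Proof.
move=> Fnd Fc F0 F1.
have Frc : right_continuous F by apply: right_continuousW.
have Fny : F @ -oo --> (0 : R).
  by apply: cvg_near_cst; near=> x; apply: F0; near: x; exact: nbhs_ninfty_lt.
have Fpy : F @ +oo --> (1 : R).
  by apply: cvg_near_cst; near=> x; apply: F1; near: x; exact: nbhs_pinfty_ge.
pose G : cumulativeBounded (0 : R) (1 : R) :=
  HB.pack F (isCumulative.Build _ _ _ F Fnd Frc) (isCumulativeBounded.Build _ _ _ F Fny Fpy).
exists (lebesgue_stieltjes_measure G) => a b ab.
transitivity (lebesgue_stieltjes_measure G `]a, b]%classic); first by [].
rewrite /lebesgue_stieltjes_measure /measure_extension measurable_mu_extE/=; last exact: is_ocitv.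
by rewrite wlength_itv_bnd.
Unshelve. all: by end_near. Qed.

(** Equal to the sum of all later gaps, so it serves both as step size and as bound for the
    remaining distance to the limit. *)
Definition gap (k : nat) : R := 2^-1 ^+ k.+1.

Lemma gap_gt0 k : 0 < gap k.
Proof. by rewrite exprn_gt0. Qed.

Lemma gapS k : gap k - gap k.+1 = gap k.+1.
Proof. by rewrite /gap [2^-1 ^+ k.+2]exprS; lra. Qed.

Lemma gap2 k : gap k.+1 + gap k.+1 = gap k.
Proof. by rewrite -{1}gapS subrK. Qed.

Lemma gap_le k : gap k <= 2^-1.
Proof.
elim: k => [|k IH]; first by rewrite /gap expr1.
by apply: le_trans IH; rewrite -(gap2 k) lerDl ltW// gap_gt0.
Qed.

Lemma gap_small (e : R) : 0 < e -> exists k, gap k < e.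
Proof.
move=> e0; exists (Num.truncn e^-1).+1.
have h0 : 0 <= e^-1 by rewrite invr_ge0 ltW.
have /andP[_ h1] := truncn_itv h0.
rewrite /gap exprVn invf_plt ?posrE ?exprn_gt0//; apply: (lt_trans h1).
rewrite -natrX ltr_nat; apply: ltn_trans (ltn_expl _ (isT : (1 < 2)%N)) _.
by rewrite ltn_exp2l.
Qed.

Lemma le_gap (a b : R) : (forall k, a <= b + gap k) -> a <= b.
Proof.
move=> h; rewrite leNgt; apply/negP => ba.
have : 0 < a - b by lra.
by move=> /gap_small[k hk]; have := h k; lra.
Qed.

(** The intervals of radius [gap k] around [u k] are nested, and the supremum of their left ends
    lies in all of them. *)
Lemma squeeze_limit (u : nat -> R) : (forall k, `|u k.+1 - u k| <= gap k.+1) ->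
  forall k, `|sup [set u k - gap k | k in setT] - u k| <= gap k.
Proof.
move=> hu; set S := [set _ | _ in _].
have up k n : u (k + n)%N - gap (k + n) <= u k + gap k - gap (k + n) - gap (k + n)
   /\ u k - gap k + gap (k + n) + gap (k + n) <= u (k + n)%N + gap (k + n).
  elim: n => [|n [IH1 IH2]]; first by rewrite addn0; split; lra.
  rewrite addnS; have := hu (k + n)%N; have := gapS (k + n)%N.
  by rewrite ler_norml => h /andP[h1 h2]; split; lra.
have hle i j : u i - gap i <= u j + gap j.
  have [ij|ji] := leqP i j.
    have [_] := up i (j - i)%N; rewrite subnKC//.
    by have := gap_gt0 j; lra.
  have [+ _] := up j (i - j)%N; rewrite subnKC; last exact: ltnW.
  by have := gap_gt0 i; lra.
have hS : has_sup S.
  split; first by exists (u 0%N - gap 0), 0%N.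
  by exists (u 0%N + gap 0) => _ [i _ <-].
move=> k; have h1 : u k - gap k <= sup S by apply: sup_upper_bound => //; exists k.
have h2 : sup S <= u k + gap k by apply: sup_le_ub => //; [case: hS|move=> _ [i _ <-]].
by rewrite ler_norml; apply/andP; split; lra.
Qed.

Lemma wave_integrable (m : probability (measurableTypeR R) R) (xi th : R) (D : set R) :
  measurable D -> m.-integrable D (EFin \o wave xi th).
Proof.
move=> mD; apply: measurable_bounded_integrable => //.
- by apply: le_lt_trans (probability_le1 m mD) _; rewrite ltry.
- apply: measurable_funTS; apply: continuous_measurable_fun; exact: wave_continuous.
- exists 1; split => // M M1 x _ /=.
  exact: le_trans (wave_le1 _ _ _) (ltW M1).
Qed.

Variables (f : nat -> R -> R).
Hypothesis f_density : forall k, density (f k).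
Hypothesis f_int : Int (f 0%N) = 1.
Hypothesis f_close : forall k b, `|cdf (f k.+1) b - cdf (f k) b| <= gap k.+1.

Let Phi (b : R) : R := sup [set cdf (f k) b - gap k | k in setT].

Let Phi_close b k : `|Phi b - cdf (f k) b| <= gap k.
Proof. exact: (squeeze_limit (fun k => f_close k b)). Qed.

Let Phi_diff a b k : Phi b <= Phi a + (cdf (f k) b - cdf (f k) a) + (gap k + gap k).
Proof.
have := Phi_close a k; have := Phi_close b k; clear -f_density f_int f_close.
by rewrite !ler_norml => /andP[_ h1] /andP[h2 _]; lra.
Qed.

Let Phi_le a b : a <= b -> Phi a <= Phi b.
Proof.
move=> ab; apply: le_gap => k; apply: (le_trans (Phi_diff b a k.+1)).
by rewrite gap2 lerD2r gerDl subr_le0; exact: le_cdf.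
Qed.

Let Phi_continuous : continuous Phi.
Proof.
move=> x; apply/(@cvgrPdist_le _ R^o) => /= e e0.
have e4 : 0 < e / 4 by rewrite divr_gt0.
have [k hk] := gap_small e4.
have [C hC] : exists C, C11 C (f k) by case: (f_density k).
have C0 := C11_ge0 hC.
have lip a b : a <= b -> Phi b - Phi a <= C * (b - a) + e / 2.
  move=> ab; have := Phi_diff a b k; have := cdf_lipschitz (f_density k) hC ab.
  by move: hk; clear -f_density f_int f_close; lra.
have C1 : 0 < C + 1 by lra.
near=> y.
have hy : `|x - y| <= e / 2 / (C + 1).
  near: y; apply: (@cvgr_dist_le _ R^o _ (nbhs x) _ id x); first exact: cvg_id.
  by rewrite divr_gt0// divr_gt0.
have hd : C * `|x - y| <= e / 2.
  apply: (@le_trans _ _ ((C + 1) * `|x - y|)); first by rewrite ler_wpM2r// lerDl.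
  by rewrite mulrC -ler_pdivlMr.
have [xy|/ltW yx] := leP x y.
  rewrite distrC ger0_norm ?subr_ge0 ?Phi_le//; have := lip _ _ xy.
  by move: hd; rewrite distrC ger0_norm ?subr_ge0//; clear -f_density f_int f_close; lra.
rewrite ger0_norm ?subr_ge0 ?Phi_le//; have := lip _ _ yx.
by move: hd; rewrite ger0_norm ?subr_ge0//; clear -f_density f_int f_close; lra.
Unshelve. all: by end_near. Qed.

Let Phi_low b : b < 0 -> Phi b = 0.
Proof.
move=> b0; apply/eqP; rewrite eq_le; apply/andP; split; apply: le_gap => k;
  by have := Phi_close b k; rewrite (cdf_low (f_density k) b0) subr0 ler_norml => /andP[? ?]; lra.
Qed.

Let Phi_high b : 1 <= b -> Phi b = Phi 1.
Proof.
move=> b1; rewrite /Phi; congr sup; apply/seteqP.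
by split=> _ [k _ <-]; exists k => //;
  rewrite (cdf_high (f_density k) b1) (cdf_high (f_density k) (lexx 1)).
Qed.

(** The initial mass is 1 and all later changes sum to at most [gap 0 = 1/2]; this makes the final
    normalisation possible. *)
Let mass_ge : 2^-1 <= Phi 1.
Proof.
have := Phi_close 1 0; rewrite (cdf_high (f_density 0) (lexx 1)) f_int.
by rewrite /gap expr1 ler_norml => /andP[? ?]; lra.
Qed.

(** The measure has distribution function [Phi / m], with [m] the limit mass. Uniform convergence of
    the distribution functions suffices for both claims: masses of intervals pass to the limit, and
    so do Stieltjes sums of a wave. *)
Lemma limit_measure : exists (mu : probability (measurableTypeR R) R) (m : R),
  [/\ 0 < m,
    forall (E : set R) k0, closed E -> (forall k x, (k0 <= k)%N -> ~ E x -> f k x = 0) ->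
      mu (~` E) = 0%E &
    forall xi th B, (forall k, `|Int (fun x => f k x * wave xi th x)| <= B) ->
      m * `|Rintegral mu setT (wave xi th)| <= B].
Proof.
set m := Phi 1; have m0 : 0 < m by rewrite (lt_le_trans _ mass_ge).
pose G b := m^-1 * Phi b.
have Gnd : {homo G : x y / x <= y}.
  by move=> a b ab; rewrite /G ler_wpM2l ?Phi_le// invr_ge0 ltW.
have Gc : continuous G.
  by move=> x; apply: cvgM; [exact: cvg_cst|exact: Phi_continuous].
have G0 b : b < 0 -> G b = 0 by move=> b0; rewrite /G Phi_low// mulr0.
have G1 b : 1 <= b -> G b = 1.
  by move=> b1; rewrite /G Phi_high// mulVf// gt_eqF.
have [mu hmu] := cdf_probability Gnd Gc G0 G1.
exists mu, m; split => //.
- move=> E k0 cE hE.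
  (* The open complement of [E] is a countable union of half-open rational intervals, enumerated by
     [pickle]; codes of other intervals yield the empty set. *)
  pose I (pq : rat * rat) : set R := `]ratr pq.1, ratr pq.2]%classic.
  pose J n : set R := if unpickle n is Some pq then
     (if `[< I pq `<=` ~` E >] then I pq else set0) else set0.
  have J0 n : mu.-negligible (J n).
    rewrite /J; case: unpickle => [pq|]; last exact: negligible_set0.
    case: ifPn => [/asboolP IE|_]; last exact: negligible_set0.
    apply/negligibleP; first exact: measurable_itv.
    have [pq12|pq21] := leP (ratr pq.1 : R) (ratr pq.2); last first.
      rewrite /I set_itv_ge ?measure0// bnd_simp -leNgt; exact: ltW.
    transitivity ((G (ratr pq.2) - G (ratr pq.1))%:E); first exact: hmu.
    rewrite /G -mulrBr.
    suff -> : Phi (ratr pq.2) - Phi (ratr pq.1) = 0 by rewrite mulr0.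
    (* From [k0] on the densities vanish on this interval; [Phi] follows their distribution
       functions up to [gap j] for arbitrarily large [j], so its increment is 0 as well. *)
    have h k : (k0 <= k)%N -> cdf (f k) (ratr pq.2) - cdf (f k) (ratr pq.1) = 0.
      move=> kk; rewrite cdfB//.
      rewrite (@eq_Rintegral _ _ _ _ _ (fun=> 0)) ?Rintegral_cst ?mul0r//.
      by move=> x; rewrite inE => xI; apply: (hE k) => //; exact: IE.
    apply/eqP; rewrite subr_eq0 eq_le; apply/andP; split; last exact: Phi_le.
    apply: le_gap => k; pose j := (k0 + k.+1)%N.
    have gj : gap j <= gap k.+1.
      rewrite /gap; apply: ler_wiXn2l; [by rewrite invr_ge0|by rewrite invf_le1// ler1n|].
      by rewrite /j !ltnS leq_addl.
    apply: (le_trans (Phi_diff (ratr pq.1) (ratr pq.2) j)).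
    by rewrite h ?leq_addr// addr0 lerD2l -(gap2 k) lerD.
  apply/negligibleP; first by apply: measurableC; exact: (closed_measurable cE).
  apply: negligibleS (negligible_bigcup J0).
  move=> x nEx; have oE : open (~` E) by rewrite openC.
  have /nbhs_ballP[e /= e0 he] : nbhs x (~` E) by exact: open_nbhs_nbhs.
  have [p] : exists p : rat, (ratr p : R) \in `]x - e, x[%R by apply: rat_in_itvoo; lra.
  rewrite in_itv/= => /andP[p1 p2].
  have [q] : exists q : rat, (ratr q : R) \in `]x, x + e[%R by apply: rat_in_itvoo; lra.
  rewrite in_itv/= => /andP[q1 q2].
  exists (pickle (p, q)); first exact: Logic.I.
  rewrite /J pickleK; case: ifPn => [_|/asboolP h].
    by apply/andP; split; [exact: p2|exact: ltW].
  exfalso; apply: h => y; move=> /andP[y1 y2]; rewrite !bnd_simp/= in y1 y2; apply: he.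
  move: p1 q2 y1 y2; rewrite /ball/= ltr_norml; clear -f_density f_int f_close => *; apply/andP; split; lra.
- move=> xi th B hB.
  set H := wave xi th.
  pose L := 2 * pi * `|xi|.
  have L0 : 0 <= L by rewrite !mulr_ge0 ?pi_ge0.
  (* [mu] gives mass 1 to this window around [[0, 1]], so finitely many cells suffice. *)
  have -> : Rintegral mu setT H = \int[mu]_(x in `]-1, 2]) H x.
    have mD : measurable (`]-1, 2]%classic : set R) by exact: measurable_itv.
    have iT : mu.-integrable setT (EFin \o H) by exact: wave_integrable.
    have dD : [disjoint `]-1, 2]%classic & ~` `]-1, 2]%classic : set R].
      by apply/disj_setPS => x [].
    have := @Rintegral_setU _ _ _ mu `]-1, 2]%classic (~` `]-1, 2]%classic) H mD (measurableC mD).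
    rewrite setUv => ->//; rewrite [X in _ + X](_ : _ = 0) ?addr0//.
    rewrite /Rintegral null_set_integral//; first exact: measurableC.
      by apply: measurable_funTS; case/integrableP: iT.
    have := probability_setC mu mD; rewrite hmu; last by lra.
    by rewrite G1 ?ler1n// G0 ?ltrN10// subr0 subee.
  apply: le_gap => k1.
  (* The partition is fixed before the index k, because the error [gap k] is
     multiplied by the number of cells. *)
  have [N hN] : exists N : nat, (0 < N)%N /\ L * (3 / N%:R) * (m + 2) <= gap k1.+1.
    pose N := (Num.truncn (L * 3 * (m + 2) / gap k1.+1)).+1; exists N; split => //.
    have h0 : 0 <= L * 3 * (m + 2) / gap k1.+1.
      have m2 : 0 <= m + 2 by rewrite addr_ge0// ltW.
      by apply: divr_ge0; [apply: mulr_ge0 => //; exact: mulr_ge0|exact: ltW (gap_gt0 _)].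
    have /andP[_ /ltW] := truncn_itv h0; rewrite -/N.
    rewrite ler_pdivrMr ?gap_gt0// => h.
    have -> : L * (3 / N%:R) * (m + 2) = (L * 3 * (m + 2)) / N%:R by field; rewrite pnatr_eq0.
    by rewrite ler_pdivrMr ?ltr0n// (mulrC (gap _)).
  case: hN => N0 hN; have NR : 0 < N%:R :> R by rewrite ltr0n.
  have [k hk] : exists k, gap k < gap k1.+1 / (2 * N%:R).
    by apply: gap_small; rewrite divr_gt0 ?gap_gt0// mulr_gt0.
  pose h : R := 3 / N%:R; have h0 : 0 <= h by rewrite divr_ge0// ltW.
  have e2 : -1 + N%:R * h = 2 by rewrite /h; field; rewrite gt_eqF.
  have HH (i : nat) x : (i < N)%N -> -1 + i%:R * h < x -> x <= -1 + i.+1%:R * h ->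
      `|H x - H (-1 + i%:R * h)| <= L * h.
    move=> _ x1 x2; apply: (le_trans (wave_lipschitz _ _ _ _)); rewrite ler_wpM2l//.
    rewrite ger0_norm; last by lra.
    by move: x2; rewrite -[i.+1%:R]natr1 mulrDl mul1r; lra.
  have s1 : `|\int[mu]_(x in `]-1, 2]) H x -
     \sum_(i < N) H (-1 + i%:R * h) * (G (-1 + i.+1%:R * h) - G (-1 + i%:R * h))| <= L * h.
    have cell (a b : R) : a <= b -> \int[mu]_(x in `]a, b]) (1 : R) = G b - G a.
      by move=> ab; rewrite Rintegral_cst// mul1r; exact: (congr1 fine (hmu a b ab)).
    have i1 : mu.-integrable `]-1, -1 + N%:R * h] (EFin \o (fun x => 1)).
      have := @wave_integrable mu 0 0 `]-1, -1 + N%:R * h] (measurable_itv _).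
      congr (_.-integrable _ _); apply/funext => x /=.
      by rewrite /wave !(mulr0, mul0r, addr0) cos0.
    have iH : mu.-integrable `]-1, -1 + N%:R * h] (EFin \o (fun x => H x * 1)).
      under [X in EFin \o X]eq_fun do rewrite mulr1.
      exact: wave_integrable.
    have := stieltjes_sum h0 i1 iH (fun=> ler01) HH.
    rewrite e2 cell; last by lra.
    rewrite (G1 2) ?ler1n// (G0 (-1)) ?ltrN10// subr0 mulr1.
    under eq_Rintegral do rewrite mulr1.
    congr (`|_ - _| <= _); apply: eq_bigr => i _; rewrite cell//.
    by rewrite lerD2l ler_wpM2r// ler_nat.
  have cfk := density_ccf (f_density k).
  have Hc : continuous H by exact: wave_continuous.
  have fk0 x : 0 <= f k x by case: (f_density k).
  (* At most [1 + gap 0 + gap k]. This mass weights the mesh error for [f k], and [m] the one for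
     [mu]; hence the factor [m + 2] in the choice of [N]. *)
  have Ifk : Int (f k) <= 2.
    have := Phi_close 1 k; rewrite (cdf_high (f_density k) (lexx 1)).
    have := Phi_close 1 0; rewrite (cdf_high (f_density 0) (lexx 1)) f_int.
    have := gap_le k.
    by rewrite /gap expr1 !ler_norml => ? /andP[? ?] /andP[? ?]; lra.
  have s2 : `|Int (fun x => f k x * H x) -
     \sum_(i < N) H (-1 + i%:R * h) * (cdf (f k) (-1 + i.+1%:R * h) - cdf (f k) (-1 + i%:R * h))| <= L * h * 2.
    have iw := cdf_integrable (f_density k) (measurable_itv `]-1, -1 + N%:R * h]%R).
    have cfH : ccf (fun x => H x * f k x).
      by rewrite (_ : (fun x => _) = (fun x => f k x * H x)); [exact: ccfM|apply/funext => x; rewrite mulrC].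
    have iH : (@lebesgue_measure R).-integrable `]-1, -1 + N%:R * h] (EFin \o (fun x => H x * f k x)).
      by apply: (@integrableS _ _ _ _ setT) => //; exact: ccf_integrable.
    have := stieltjes_sum h0 iw iH fk0 HH; rewrite e2.
    have out x : ~ (0 <= x <= 1) -> f k x = 0.
      move=> hx; apply/eqP; apply: contra_notT hx => hx.
      by case: (f_density k) => _ _; exact.
    rewrite -(Int_itv cfH); last 2 first.
    + by move=> x hx; rewrite out ?mulr0//; lra.
    + by move=> x hx; rewrite out ?mulr0//; lra.
    rewrite -(Int_itv cfk); last 2 first.
    + by move=> x hx; apply: out; lra.
    + by move=> x hx; apply: out; lra.
    under eq_fun do rewrite mulrC.
    move=> hh; apply: le_trans (_ : L * h * Int (f k) <= _); last first.
      by rewrite ler_wpM2l// mulr_ge0.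
    apply: le_trans hh; rewrite le_eqVlt; apply/orP; left; apply/eqP.
    congr (`|_ - _|); apply: eq_bigr => i _; rewrite cdfB//.
    by rewrite lerD2l ler_wpM2r// ler_nat.
  set SG := \sum_(i < N) _ in s1; set SF := \sum_(i < N) _ in s2.
  (* On each cell [m * G = Phi] and the distribution function of [f k] have increments that differ
     by at most [2 gap k]. *)
  have s3 : `|m * SG - SF| <= N%:R * (2 * gap k).
    rewrite /SG /SF mulr_sumr -sumrB; apply: (le_trans (ler_norm_sum _ _ _)).
    apply: (@le_trans _ _ (\sum_(i < N) (2 * gap k))); last first.
      by rewrite sumr_const card_ord -[leLHS]mulr_natl.
    apply: ler_sum => i _.
    have -> : forall z a b c d, m * (z * (G a - G b)) - z * (c - d) = z * ((Phi a - c) - (Phi b - d)).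
      by move=> z a b c d; rewrite /G; field; rewrite gt_eqF.
    rewrite normrM; apply: (@le_trans _ _ (1 * (gap k + gap k))); last by lra.
    apply: ler_pM => //; first exact: wave_le1.
    by apply: (le_trans (ler_normB _ _)); apply: lerD; exact: Phi_close.
  have hNk : N%:R * (2 * gap k) <= gap k1.+1.
    by move: hk; rewrite ltr_pdivlMr ?mulr_gt0//; lra.
  have := hB k; rewrite -/H => hBk.
  set IM := \int[mu]_(x in _) _ in s1 *.
  set IF := Int _ in s2 hBk.
  have -> : m * `|IM| = `|m * IM| by rewrite normrM (gtr0_norm m0).
  have -> : m * IM = m * (IM - SG) + (m * SG - SF) - (IF - SF) + IF by ring.
  apply: (le_trans (ler_normD _ _)).
  apply: (le_trans (lerD (ler_normB _ _) hBk)).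
  apply: (le_trans (lerD (lerD (ler_normD _ _) s2) (lexx _))).
  apply: (le_trans (lerD (lerD (lerD (lexx _) s3) (lexx _)) (lexx _))).
  have : `|m * (IM - SG)| <= m * (L * h) by rewrite normrM (gtr0_norm m0) ler_wpM2l// ltW.
  have := gapS k1; rewrite -/h in hN; lra.
Qed.

End LimitMeasure.

(** * Covering costs and Hausdorff content *)

Section Assembly.
Context {R : realType}.
Implicit Types (alpha : R -> R) (psi : nat -> R).

Lemma closed_near_fraction (P : seq nat) psi : closed (near_fraction P psi).
Proof.
have -> : near_fraction P psi = \bigcup_(q in [set` P])
    \bigcup_(i in `I_(10 * q).+1)
      `[i%:R / q%:R - 5 - psi q / 4, i%:R / q%:R - 5 + psi q / 4]%classic.
  apply/seteqP; split=> [x [q [i [qP iq h]]]|x [q qP [i iq h]]].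
    exists q => //; exists i => //=; rewrite in_itv/=.
    by move: h; rewrite ler_distl.
  exists q, i; split => //; rewrite ler_distl.
  by move: h; rewrite /= in_itv.
apply: closed_bigcup; first exact: finite_seq.
move=> q _; apply: closed_bigcup; first exact: finite_II.
by move=> i _; exact: itv_closed.
Qed.

Lemma diam_ball (c r : R) : 0 <= r ->
  exists2 d, diam `[c - r, c + r]%classic = d%:E & 0 <= d <= 2 * r.
Proof.
move=> r0; rewrite /diam; set S := _ `|` _.
have h1 : (ereal_sup S <= (2 * r)%:E)%E.
  apply: ub_ereal_sup => _ [->|[[x y] /= [+ +] <-]]; first by rewrite lee_fin mulr_ge0.
  rewrite !in_itv/= => /andP[x1 x2] /andP[y1 y2].
  by rewrite lee_fin ler_norml; apply/andP; split; lra.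
have h0 : (0%:E <= ereal_sup S)%E by apply: ereal_sup_ubound; left.
case: (ereal_sup S) h0 h1 => [d| |] //; rewrite !lee_fin => h0 h1.
by exists d => //; rewrite h0.
Qed.

Lemma diam0 : diam (set0 : set R) = 0%E.
Proof.
rewrite /diam (_ : _ `|` _ = [set 0%E]) ?ereal_sup1//.
apply/seteqP; split => [x [->|[[a b] [[]]]]|x ->] //.
by left.
Qed.

Lemma hausdorff_content_ge0 alpha E (delta : R) : dimension_function alpha ->
  (0 <= hausdorff_content alpha E delta)%E.
Proof.
move=> [apos _ _]; apply: le_ereal_inf_tmp => _ [U _ <-].
apply: nneseries_ge0 => i _ _; rewrite lee_fin /gauge.
by case: ifPn => // h; exact/ltW/apos.
Qed.

(** For each [q] there are [10 q + 1] intervals of diameter below [psi q], each costing at most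
    [q ^- 2], in total at most [11 / q]. *)
Lemma hausdorff_content_near alpha psi (P : seq nat) (E : set R) (delta : R) :
  dimension_function alpha -> 0 <= delta -> E `<=` near_fraction P psi ->
  (forall q, q \in P -> [/\ (0 < q)%N, 0 < psi q, psi q <= delta &
     forall y, 0 < y -> y < psi q -> alpha y < q%:R ^- 2]) ->
  (hausdorff_content alpha E delta <= (11 * \sum_(q <- P) q%:R^-1)%:E)%E.
Proof.
move=> adim delta0 EP hP; have [apos _ _] := adim.
pose B (q i : nat) : set R := `[i%:R / q%:R - 5 - psi q / 4, i%:R / q%:R - 5 + psi q / 4]%classic.
pose l := flatten [seq [seq B q i | i <- iota 0 (10 * q).+1] | q <- P].
(* Beyond the list the default value is the empty set, whose gauge is 0. *)
pose U n := nth set0 l n.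
have lP A : A \in l -> exists q i, [/\ q \in P & A = B q i].
  move=> /flattenP[_ /mapP[q qP ->] /mapP[i _ ->]]; by exists q, i.
have gB A : A \in l -> exists q d, [/\ q \in P, diam A = d%:E, 0 <= d & d < psi q].
  move=> /lP[q [i [qP ->]]]; have [q0 p0 _ _] := hP q qP.
  have r0 : 0 <= psi q / 4 by rewrite divr_ge0// ltW.
  have [d dE /andP[d0 d1]] := diam_ball (i%:R / q%:R - 5) r0.
  exists q, d; split => //; lra.
have gauge0 n : 0 <= gauge alpha (fine (diam (U n))).
  by rewrite /gauge; case: ifPn => // h; exact/ltW/apos.
have dU n : (diam (U n) <= delta%:E)%E.
  have [nl|ln] := ltnP n (size l).
    have [q [d [qP -> d0 d1]]] := gB _ (mem_nth set0 nl).
    by have [_ _ pd _] := hP q qP; rewrite lee_fin; lra.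
  by rewrite /U nth_default// diam0 lee_fin.
have cov : E `<=` \bigcup_n U n.
  move=> x /EP[q [i [qP iq h]]].
  have Bl : B q i \in l.
    apply/flattenP; exists [seq B q i | i <- iota 0 (10 * q).+1].
      by apply/mapP; exists q.
    by apply/mapP; exists i => //; rewrite mem_iota.
  have Bx : B q i x by rewrite /B/= in_itv/= -ler_distl.
  by exists (index (B q i) l); rewrite // /U nth_index.
apply: (@le_trans _ _ (\sum_(0 <= i <oo) (gauge alpha (fine (diam (U i))))%:E)%E).
  by apply: ereal_inf_lbound; exists U.
rewrite (nneseries_split 0 (size l)); last by move=> k _; rewrite lee_fin.
rewrite add0n [X in (_ + X)%E]eseries0 ?adde0; last first.
  move=> i il _; rewrite /U nth_default// diam0 /gauge/= ltxx//.
rewrite sumEFin lee_fin.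
have -> : \sum_(0 <= i < size l) gauge alpha (fine (diam (U i))) =
    \sum_(A <- l) gauge alpha (fine (diam A)) by rewrite (big_nth set0).
rewrite /l big_flatten big_map mulr_sumr big_seq [leRHS]big_seq.
apply: ler_sum => q qP; rewrite big_map; have [q0 p0 _ pa] := hP q qP.
have qR : 0 < q%:R :> R by rewrite ltr0n.
apply: (@le_trans _ _ (\sum_(i <- iota 0 (10 * q).+1) q%:R ^- 2)).
  apply: ler_sum => i _; have r0 : 0 <= psi q / 4 by rewrite divr_ge0// ltW.
  have [d dE /andP[d0 d1]] := diam_ball (i%:R / q%:R - 5) r0.
  rewrite /B dE /gauge/=; case: ifPn => dp; last by rewrite invr_ge0 exprn_ge0// ltW.
  by apply/ltW/pa => //; lra.
rewrite big_const_seq count_predT size_iota iter_addr_0 -[leLHS]mulr_natl.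
have -> : (10 * q).+1%:R * q%:R ^- 2 = q%:R^-1 * (10 * q).+1%:R * q%:R^-1 :> R.
  by field; rewrite gt_eqF.
by rewrite ler_wpM2r ?invr_ge0 ?(ltW qR)//; exact: count_le.
Qed.

End Assembly.

(** * The initial density, the Fourier transform and well-approximability *)

Section Construction.
Context {R : realType}.

Lemma initial_density : exists2 f : R -> R, density f & Int f = 1.
Proof.
have h0 : 0 < 2^-1 :> R by rewrite invr_gt0.
exists (fun x => hump 2^-1 (x + - 2^-1)); last first.
  by rewrite (Int_shift (- 2^-1) (hump_ccf h0)) Int_hump.
split; first exact: hump_shift_C11.
- by move=> x; exact: hump_ge0.
- move=> x hx; rewrite leNgt; have [x0|x0] /= := ltP x 0.
    move: hx; rewrite hump_out ?eqxx// ler_normr; apply/orP; right; lra.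
  rewrite leNgt; apply/negP => x1; move: hx; rewrite hump_out ?eqxx//.
  rewrite ler_normr; apply/orP; left; lra.
Qed.

Lemma initial_decay (alpha omega : R -> R) (x0 : R) (f : R -> R) :
  dimension_function alpha -> 0 < x0 ->
  (forall x1 x2 : R, 0 < x1 -> x1 <= x2 -> x2 < x0 -> x1 * alpha x2 <= x2 * alpha x1) ->
  (forall xi : R, 0 <= xi -> 0 < omega xi) ->
  (forall x y : R, 0 <= x -> x <= y -> omega x <= omega y) ->
  density f -> Int f = 1 ->
  exists2 D : R, 0 <= D & forall xi th, xi != 0 ->
    `|Int (fun x => f x * wave xi th x)| <= D * (Num.sqrt (alpha `|xi|^-1) * omega `|xi|).
Proof.
move=> adim x00 ar opos omono df If.
have [C hC] : exists C, C11 C f by case: df.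
have C0 := C11_ge0 hC; have cf := density_ccf df; have [apos amono _] := adim.
have [X X0 hX] := alpha_beats adim x00 ar C0 ltr01.
pose Y := Num.max X 1; have Y0 : 0 < Y by rewrite lt_max ltr01 orbT.
have w0 := opos 0 (lexx 0).
have s0 : 0 < Num.sqrt (alpha Y^-1) by rewrite sqrtr_gt0 apos// invr_gt0.
(* The first term serves [xi > Y], where the transform is at most sqrt(alpha(1/xi)); the second
   serves [xi <= Y], where it is at most the mass 1 and the target is at least its bound at [Y]. *)
pose D := (omega 0)^-1 + (Num.sqrt (alpha Y^-1) * omega 0)^-1.
have i1 : 0 <= (omega 0)^-1 by rewrite invr_ge0 ltW.
have i2 : 0 <= (Num.sqrt (alpha Y^-1) * omega 0)^-1 by rewrite invr_ge0 mulr_ge0// ltW.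
exists D; first exact: addr_ge0.
move=> xi th; wlog xi0 : xi th / 0 < xi => [hw xin0|].
  have [xi0|xi0|xi0] := ltgtP 0 xi; first exact: hw.
    have := hw (- xi) (- th); rewrite oppr_gt0 normrN oppr_eq0 => /(_ xi0 xin0).
    by under eq_fun do rewrite wave_opp opprK.
  by rewrite xi0 eqxx in xin0.
move=> _; rewrite (gtr0_norm xi0).
have wxi : omega 0 <= omega xi by apply: omono => //; exact: ltW.
have sxi : 0 < Num.sqrt (alpha xi^-1) by rewrite sqrtr_gt0 apos// invr_gt0.
set s := Num.sqrt (alpha xi^-1) in sxi *.
have wx0 : 0 < omega xi by exact: lt_le_trans wxi.
have T0 : 0 <= s * omega xi by rewrite mulr_ge0// ltW.
have [xY|Yx] := leP xi Y; last first.
  have x1 : 1 <= xi by apply: le_trans (ltW Yx); rewrite le_max lexx orbT.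
  have xX : X <= xi by apply: le_trans (ltW Yx); rewrite le_max lexx.
  apply: (le_trans (density_wave_decay th df hC x1)).
  apply: (le_trans (hX xi xX)); rewrite mul1r -/s.
  apply: (@le_trans _ _ ((omega 0)^-1 * (s * omega xi))).
    by rewrite mulrC -mulrA -[leLHS]mulr1 ler_wpM2l ?(ltW sxi)// ler_pdivlMr// mul1r.
  by rewrite ler_wpM2r// lerDl.
apply: (@le_trans _ _ 1).
  rewrite -If; apply: le_normr_Int => //.
    by apply: ccfM => //; exact: wave_continuous.
  have f0 : forall x, 0 <= f x by case: df.
  move=> x; rewrite normrM (ger0_norm (f0 x)) -[leRHS]mulr1 ler_wpM2l//.
  exact: wave_le1.
apply: (@le_trans _ _ ((Num.sqrt (alpha Y^-1) * omega 0)^-1 * (s * omega xi))).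
  rewrite mulrC ler_pdivlMr ?mulr_gt0// mul1r.
  apply: ler_pM => //; first exact: ltW.
  rewrite /s ler_sqrt; last by rewrite ltW// apos// invr_gt0.
  by apply: amono; rewrite ?invr_gt0// lef_pV2 ?posrE.
by rewrite ler_wpM2r// lerDr.
Qed.

Lemma normc_le (a b : R) : ComplexField.Normc.normc (a +i* b)%C <= `|a| + `|b|.
Proof.
rewrite /ComplexField.Normc.normc/= -[leRHS]ger0_norm ?addr_ge0// -sqrtr_sqr.
rewrite ler_sqrt ?sqr_ge0// sqrrD !real_normK ?num_real//.
by rewrite addrAC lerDl mulrn_wge0 ?mulr_ge0.
Qed.

(** The phases 0 and [pi / 2] give the real and the imaginary part, and the modulus is at most the
    sum of their absolute values. *)
Lemma fourier_le (mu : probability (measurableTypeR R) R) (xi B : R) :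
  (forall th, `|Rintegral mu setT (wave xi th)| <= B) ->
  ComplexField.Normc.normc (fourier mu xi) <= B + B.
Proof.
move=> h; apply: (le_trans (normc_le _ _)); apply: lerD.
  have := h 0; congr (`|_| <= _); congr Rintegral; apply/funext => x /=.
  by rewrite /wave -cosN; congr cos; ring.
have := h (pi / 2); congr (`|_| <= _); congr Rintegral; apply/funext => x /=.
by rewrite /wave cosDpihalf -sinN; congr sin; ring.
Qed.

(** Finitely many approximating pairs would have denominators at most some [N], yet the primes of
    [P N] all exceed [N]. *)
Lemma near_fraction_well_approximable (psi : nat -> R) (P : nat -> seq nat) x :
  (forall k q, q \in P k -> (k < q)%N /\ 0 < psi q) ->
  (forall k, near_fraction (P k) psi x) -> well_approximable psi x.
Proof.
move=> hP hx; rewrite /well_approximable/= => fin.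
have [N hN] : exists N : nat, forall pq : int * nat,
   [set pq : int * nat | (1 <= pq.2)%N /\ `|x - pq.1%:~R / pq.2%:R| <= psi pq.2] pq -> (pq.2 <= N)%N.
  move: fin; set S := [set pq | _] => /finite_seqP[l ->].
  exists (\max_(pq <- l) pq.2)%N => pq /= pql; exact: leq_bigmax_seq.
have [q [i [qP iq h]]] := hx N; have [Nq p0] := hP N q qP.
have q0 : (0 < q)%N by exact: leq_ltn_trans Nq.
suff : (q <= N)%N by rewrite leqNgt Nq.
(* The centre [i / q - 5] is the fraction with numerator [i - 5 q]. *)
apply: (hN (i%:Z - (5 * q)%:Z, q)); split => //=.
rewrite rmorphB/= -!pmulrn natrM mulrBl mulfK ?pnatr_eq0 -?lt0n//.
by apply: (le_trans h); lra.
Qed.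

End Construction.

(** Dependent choice, obtained from choice by carrying the index in the state. *)
Lemma exists_chain (T U : Type) (Q : nat -> T -> U -> T -> Prop) (t0 : T) :
  (forall k t, exists u t', Q k t u t') ->
  exists (F : nat -> T) (V : nat -> U), F 0%N = t0 /\ forall k, Q k (F k) (V k) (F k.+1).
Proof.
move=> h.
have h' (kt : nat * T) : exists ut : U * T, Q kt.1 kt.2 ut.1 ut.2.
  by have [u [t' H]] := h kt.1 kt.2; exists (u, t').
have [step hstep] := choice h'.
pose F := fix F k : T := if k is k'.+1 then (step (k', F k')).2 else t0.
exists F, (fun k => (step (k, F k)).1); split => // k.
exact: (hstep (k, F k)).
Qed.

Lemma hausdorff_measure_eq0 (R : realType) (alpha : R -> R) (E : set R) :
  dimension_function alpha ->
  (forall d e : R, 0 < d -> 0 < e -> (hausdorff_content alpha E d <= e%:E)%E) ->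
  hausdorff_measure alpha E = 0%E.
Proof.
move=> adim h; rewrite /hausdorff_measure; apply: lim_near_cst => //; near=> d.
have d0 : 0 < d by near: d; exact: nbhs_right_gt.
apply/eqP; rewrite eq_le hausdorff_content_ge0// andbT.
apply/lee_addgt0Pr => e e0; rewrite add0e; exact: h.
Unshelve. all: by end_near. Qed.

Theorem theorem2p3 (R : realType) (alpha omega : R -> R) (nu rho : R)
    (psi : nat -> R)
    (alpha_dim : dimension_function alpha)
    (nu_lim : ln (alpha x) / ln x @[x --> 0^'+] --> nu)
    (nu_gt0 : 0 < nu)
    (rho_lt1 : rho < 1)
    (alpha_rho : exists2 x0 : R, 0 < x0 &
      forall x1 x2 : R, 0 < x1 -> x1 < x2 -> x2 < x0 ->
        (x1 / x2) `^ rho <= alpha x1 / alpha x2)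
    (omega_gt0 : forall xi : R, 0 <= xi -> 0 < omega xi)
    (omega_incr : forall x y : R, 0 <= x -> x <= y -> omega x <= omega y)
    (omega_lim : omega xi @[xi --> +oo] --> +oo)
    (psi_def : \forall q \near \oo, psi q = ginv alpha (q%:R ^- 2)) :
  exists (F : set R) (mu : probability (measurableTypeR R) R) (C : R),
    [/\ compact F,
        hausdorff_measure alpha F = 0%E,
        F `<=` well_approximable psi,
        mu (~` F) = 0%E
      & forall xi : R, xi != 0 ->
          ComplexField.Normc.normc (fourier mu xi)
            <= C * Num.sqrt (alpha (`|xi|^-1)) * omega `|xi| ].
Proof.
have adim := alpha_dim; have [apos amono _] := adim.
have [x0 x00 ar] := alpha_ratio adim rho_lt1 alpha_rho.
have [f0 df0 If0] := @initial_density R.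
have [D D0 hD] := initial_decay adim x00 ar omega_gt0 omega_incr df0 If0.
pose T (xi : R) := Num.sqrt (alpha `|xi|^-1) * omega `|xi|.
(* The requirements on step [k], obtained from [stage] with [s = gap k] and [eps = gap k.+1].
   Densities form a subtype so that every state admits a successor. *)
pose Q (k : nat) (f : {f : R -> R | density f}) (P : seq nat) (g : {f : R -> R | density f}) :=
  [/\ forall q, q \in P -> [/\ (k < q)%N, 0 < psi q, psi q <= k.+1%:R^-1 &
        forall y, 0 < y -> y < psi q -> alpha y < q%:R ^- 2],
      \sum_(q <- P) (q%:R^-1 : R) <= gap k + gap k,
      forall x, sval g x != 0 -> sval f x != 0 /\ near_fraction P psi x,
      forall b, `|cdf (sval g) b - cdf (sval f) b| <= gap k.+1 &
      forall xi th, xi != 0 ->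
        `|Int (fun x => sval g x * wave xi th x) - Int (fun x => sval f x * wave xi th x)|
          <= gap k.+1 * T xi].
have hQ k f : exists P g, Q k f P g.
  have k0 : 0 < k.+1%:R^-1 :> R by rewrite invr_gt0.
  have [M M0 hM] := ginv_facts adim psi_def k0.
  have [P [f' [h1 h2 h3 h4 [h5 h6]]]] := stage adim nu_lim nu_gt0 rho_lt1 alpha_rho
    omega_gt0 omega_incr omega_lim psi_def (maxn k.+1 M) (svalP f) (gap_gt0 k.+1)
    (gap_gt0 k) (gap_le k).
  exists P, (exist _ f' h3); split => // q /h1; rewrite geq_max => /andP[kq /hM].
  by case=> p0 p1 p2 _.
have [F [P [F0 hF]]] := exists_chain (exist _ f0 df0) hQ.
have Fd k : density (sval (F k)) by exact: svalP (F k).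
have F0I : Int (sval (F 0%N)) = 1 by rewrite F0.
have Fc k b : `|cdf (sval (F k.+1)) b - cdf (sval (F k)) b| <= gap k.+1.
  by have [_ _ _ h _] := hF k; exact: h.
have [mu [m [m0 hmu hwave]]] := limit_measure Fd F0I Fc.
(* The unit interval makes the intersection compact; closedness of each [E k] is what
   [limit_measure] requires in order to carry the support to the limit. *)
pose E k : set R := near_fraction (P k) psi `&` `[0, 1]%classic.
have cE k : closed (E k).
  by apply: closedI; [exact: closed_near_fraction|exact: itv_closed].
have psi0 k q : q \in P k -> (k < q)%N /\ 0 < psi q.
  by have [h _ _ _ _] := hF k => /h[].
have supp k j x : (k < j)%N -> ~ E k x -> sval (F j) x = 0.
  move=> kj nE; apply/eqP; apply: contra_notT nE => hx.
  have hx' : sval (F k.+1) x != 0.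
    elim: j kj hx => // j IH; rewrite ltnS leq_eqVlt => /predU1P[->//|kj] hx.
    by apply: IH => //; have [_ _ h _ _] := hF j; case: (h x hx).
  split; first by have [_ _ h _ _] := hF k; case: (h x hx').
  by rewrite /= in_itv/=; case: (Fd k.+1) => _ _; exact.
exists (\bigcap_k E k), mu, (2 * (D + 1) / m); split.
- have cF : closed (\bigcap_k E k) by apply: closed_bigI => k _; exact: cE.
  have F01 : \bigcap_k E k `<=` `[0, 1]%classic by move=> x /(_ 0%N Logic.I)[].
  exact: (subclosed_compact cF (@segment_compact R 0 1) F01).
- apply: hausdorff_measure_eq0 => // d e d0 e0.
  have [k hk] : exists k, gap k < Num.min d (e / 22).
    by apply: gap_small; rewrite lt_min d0 divr_gt0.
  (* A single index must make both the diameters and the cost small; 22 comes from the cost bound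
     [11 * (gap k' + gap k')]. *)
  have [k' hk'] : exists k', k'.+1%:R^-1 < d /\ gap k' < e / 22.
    pose k' := (k + Num.truncn d^-1)%N; exists k'.
    have h0 : 0 <= d^-1 by rewrite invr_ge0 ltW.
    have /andP[_ h1] := truncn_itv h0.
    split.
      rewrite invf_plt ?posrE//; apply: (lt_le_trans h1).
      by rewrite ler_nat ltnS leq_addl.
    apply: (@le_lt_trans _ _ (gap k)); last by move: hk; rewrite lt_min => /andP[].
    rewrite /gap; apply: ler_wiXn2l; [by rewrite invr_ge0|by rewrite invf_le1// ler1n|].
    by rewrite ltnS leq_addr.
  have [h1 h2 _ _ _] := hF k'.
  apply: (@le_trans _ _ (11 * \sum_(q <- P k') (q%:R^-1 : R))%:E).
    apply: (hausdorff_content_near (psi := psi)) => //; first exact: ltW.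
      by move=> x /(_ k' Logic.I)[].
    move=> q /h1[kq p0 p1 p2]; split => //; first exact: leq_ltn_trans kq.
    by apply: (le_trans p1); apply: ltW; case: hk'.
  by rewrite lee_fin; case: hk' => _; lra.
- move=> x hx; apply: (near_fraction_well_approximable psi0) => k.
  by case: (hx k Logic.I).
- have nE k : mu.-negligible (~` E k).
    apply/negligibleP; first by apply: measurableC; exact: (closed_measurable (cE k)).
    by apply: (hmu _ k.+1) => // j x kj; exact: supp.
  apply/negligibleP.
    apply: measurableC; apply: bigcapT_measurable => k.
    exact: (closed_measurable (cE k)).
  by rewrite setC_bigcap; exact: negligible_bigcup.
- move=> xi xi0.
  have T0 : 0 <= T xi by rewrite mulr_ge0 ?sqrtr_ge0// ltW// omega_gt0.
  (* The changes [gap 1 + ... + gap k] add up to [gap 0 - gap k], with [gap 0 = 1/2]. *)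
  have hk th k : `|Int (fun x => sval (F k) x * wave xi th x)| <= (D + (2^-1 - gap k)) * T xi.
    elim: k => [|k IH].
      by rewrite F0 /= /gap expr1 subrr addr0; exact: hD.
    have [_ _ _ _ h] := hF k; have := h xi th xi0.
    set I1 := Int _; set I2 := Int _ in IH *; move=> h1.
    have -> : I1 = (I1 - I2) + I2 by ring.
    apply: (le_trans (ler_normD _ _)); apply: (le_trans (lerD h1 IH)).
    by rewrite -mulrDl -(gap2 k); apply: ler_wpM2r => //; lra.
  have hB th : `|Rintegral mu setT (wave xi th)| <= (D + 1) * T xi / m.
    rewrite ler_pdivlMr// mulrC; apply: hwave => k; apply: (le_trans (hk th k)).
    by apply: ler_wpM2r => //; have := gap_gt0 (R := R) k; lra.
  apply: (le_trans (fourier_le hB)); rewrite le_eqVlt; apply/orP; left; apply/eqP.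
  by rewrite /T; field; rewrite gt_eqF.
Qed.
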